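(* If $1\to R\to F\to G\to 1$ is a free presentation of a group $G$ (with $F$ a free group), and $n\geq 2$ is an integer, then there is a natural isomorphism $$\frac{F\cap \bigl(1+\mathbf{f}\bigl((F'-1)\mathbb{Z}[F]\cap \mathbf{f}^n\bigr)+\mathbf{r}\mathbf{f}^n+\mathbf{f}^{n+2}\bigr)}{[R,R,\underbrace{F,\ldots,F}_{n-1}]\,\bigl(F''\cap \gamma_{n+1}(F)\bigr)\,\gamma_{n+2}(F)}\cong L_1\mathsf{SP}^{n+1}(G_{ab}).$$
   Context: For a normal subgroup $H$ of the free group $F$, the corresponding bold lower-case letter $\mathbf{h}$ denotes the two-sided ideal $(H-1)\mathbb{Z}[F]$ of the integral group ring $\mathbb{Z}[F]$; thus $\mathbf{f},\mathbf{r}$ correspond to $F,R$ (and $\mathbf f$ is the augmentation ideal). Products of ideals are ideal products. For a two-sided ideal $\mathfrak a$ of $\mathbb{Z}[F]$, $F\cap(1+\mathfrak a)=\{w\in F: w-1\in\mathfrak a\}$, a normal subgroup of $F$. $[x,y]=x^{-1}y^{-1}xy$, and multiple commutator subgroups are left-normed: $[A,B,C]=[[A,B],C]$, etc. $\gamma_n(H)$ is the $n$th term of the lower central series of $H$ ($\gamma_1(H)=H$, $\gamma_{n+1}(H)=[H,\gamma_n(H)]$); $H'=\gamma_2(H)$, $H''=(H')'$ is the second derived subgroup, and $H_{ab}=H/H'$. For an endofunctor $T$ of the category of abelian groups, $L_pT$ is the $p$th derived functor at level $0$ in the sense of Dold–Puppe: $L_pT(A)=\pi_p(T(K(P_* )))$,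 where $P_*\to A$ is a projective (free) resolution of $A$ and $K$ is the Dold–Kan functor from non-negatively graded chain complexes to simplicial abelian groups. $\mathsf{SP}^n$ is the $n$th symmetric power functor. *)

(* Defs.v *)
From HB Require Import structures.
From mathcomp Require Import all_boot all_order all_algebra generic_quotient
  ring_quotient.
From mathcomp Require Import perm boolp.
From mathcomp.multinomials Require Import freeg.

Set Implicit Arguments.
Unset Strict Implicit.
Unset Printing Implicit Defensive.

Import GRing.Theory.
Local Open Scope group_scope.
Local Open Scope quotient_scope.

Definition is_free (F : groupType) : Prop :=
  exists (X : Type) (i : X -> F),
    forall (H : groupType) (f : X -> H),
      (exists h : {multiplicative F -> H}, forall x, h (i x) = f x) /\
      (forall h h' : {multiplicative F -> H},
         (forall x, h (i x) = h' (i x)) -> forall w, h w = h' w).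

Section GroupMorphism.
Variables (G H : groupType) (f : {multiplicative G -> H}).

Lemma morph1 : f 1 = 1.
Proof. by apply: (mulgI (f 1)); rewrite -gmulfM !mulg1. Qed.

Lemma morphV x : f x^-1 = (f x)^-1.
Proof. by apply: (mulgI (f x)); rewrite -gmulfM !mulgV morph1. Qed.

Lemma morphR x y : f [~ x, y] = [~ f x, f y].
Proof. by rewrite /commg /conjg !gmulfM !morphV. Qed.

Lemma morphJ x y : f (x ^ y) = f x ^ f y.
Proof. by rewrite /conjg !gmulfM !morphV. Qed.

End GroupMorphism.

Record nsubgroup (G : groupType) := NSubgroup {
  nsg_set :> G -> Prop;
  nsg1 : nsg_set 1;
  nsgM : forall x y, nsg_set x -> nsg_set y -> nsg_set (x * y);
  nsgV : forall x, nsg_set x -> nsg_set x^-1;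
  nsgJ : forall x y, nsg_set x -> nsg_set (x ^ y)
}.

Inductive gspan (G : groupType) (S : G -> Prop) : G -> Prop :=
| gspan_gen x : S x -> gspan S x
| gspan1 : gspan S 1
| gspanM x y : gspan S x -> gspan S y -> gspan S (x * y)
| gspanV x : gspan S x -> gspan S x^-1.

Section NormalSubgroups.
Variable G : groupType.
Implicit Types A B : nsubgroup G.

#[local] Obligation Tactic := idtac.

Definition nsgT : nsubgroup G :=
  @NSubgroup G (fun=> True) I (fun _ _ _ _ => I) (fun _ _ => I) (fun _ _ _ => I).

Program Definition nsgI A B : nsubgroup G := @NSubgroup G (fun x => A x /\ B x) _ _ _ _.
Next Obligation. by move=> A B; split; apply: nsg1. Qed.
Next Obligation. by move=> A B x y [? ?] [? ?]; split; apply: nsgM. Qed.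
Next Obligation. by move=> A B x [? ?]; split; apply: nsgV. Qed.
Next Obligation. by move=> A B x y [? ?]; split; apply: nsgJ. Qed.

Program Definition nsgMul A B : nsubgroup G :=
  @NSubgroup G (fun z => exists a b, [/\ A a, B b & z = a * b]) _ _ _ _.
Next Obligation.
by move=> A B; exists 1, 1; rewrite mulg1; split=> //; apply: nsg1.
Qed.
Next Obligation.
move=> A B _ _ [a [b [Aa Bb ->]]] [c [d [Ac Bd ->]]].
exists (a * c), (b ^ c * d); split; first exact: nsgM.
  by apply: nsgM => //; apply: nsgJ.
by rewrite /conjg !mulgA mulgK.
Qed.
Next Obligation.
move=> A B _ [a [b [Aa Bb ->]]].
exists a^-1, (b^-1 ^ a^-1); split; first exact: nsgV.
  by apply/nsgJ/nsgV.
by rewrite invgM /conjg invgK mulKg.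
Qed.
Next Obligation.
move=> A B _ y [a [b [Aa Bb ->]]].
by exists (a ^ y), (b ^ y); split; [exact: nsgJ|exact: nsgJ|rewrite conjMg].
Qed.

Program Definition nsgR A B : nsubgroup G :=
  @NSubgroup G (gspan (fun z => exists a b, [/\ A a, B b & z = [~ a, b]]))
    _ _ _ _.
Next Obligation. by move=> A B; apply: gspan1. Qed.
Next Obligation. by move=> A B x y; apply: gspanM. Qed.
Next Obligation. by move=> A B x; apply: gspanV. Qed.
Next Obligation.
move=> A B x y; elim=> {x} [_ [a [b [Aa Bb ->]]]||x z _ IHx _ IHz|x _ IHx].
- apply: gspan_gen; exists (a ^ y), (b ^ y); rewrite conjRg.
  by split=> //; apply: nsgJ.
- by rewrite conj1g; apply: gspan1.
- by rewrite conjMg; apply: gspanM.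
- by rewrite conjVg; apply: gspanV.
Qed.

(* [gamma_ i A] is $\gamma_i(A)$ for i >= 1, so gamma_ 1 A = A. *)
Definition gamma_ (i : nat) A : nsubgroup G := iter i.-1 (nsgR A) A.

Definition derived A : nsubgroup G := gamma_ 2 A.

(* Left-normed [A, B, ..., B] with k copies of B. *)
Definition nsgRn (k : nat) A B : nsubgroup G := iter k (fun C => nsgR C B) A.

End NormalSubgroups.

Section QuotientGroup.
Variables (G : groupType) (N : nsubgroup G).

Definition coset_eq (x y : G) : bool := `[< N (x^-1 * y) >].

Lemma coset_eq_equiv : equiv_class_of coset_eq.
Proof.
split=> [x|x y|y x z]; rewrite /coset_eq.
- by apply/asboolP; rewrite mulVg; apply: nsg1.
- by apply/asboolP/asboolP => /nsgV; rewrite invgM invgK.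
- move=> /asboolP xy /asboolP yz; apply/asboolP.
  by have := nsgM xy yz; rewrite mulgA mulgK.
Qed.

Canonical coset_equiv := EquivRelPack coset_eq_equiv.
Canonical coset_encModRel := defaultEncModRel coset_eq.

Definition quotgroup := {eq_quot coset_eq}.

HB.instance Definition _ : EqQuotient G coset_eq quotgroup :=
  EqQuotient.on quotgroup.
HB.instance Definition _ := Choice.on quotgroup.

Definition qpi (x : G) : quotgroup := \pi_quotgroup x.

Lemma qpiP x y : qpi x = qpi y <-> N (x^-1 * y).
Proof. by split=> [/eqmodP/asboolP|h]; last apply/eqmodP/asboolP. Qed.

Lemma qpi_ind (P : quotgroup -> Prop) :
  (forall x, P (qpi x)) -> forall q, P q.
Proof. by move=> h q; rewrite -[q]reprK; apply: h. Qed.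

Definition qone : quotgroup := qpi 1.
Definition qmul (p q : quotgroup) : quotgroup := qpi (repr p * repr q).
Definition qinv (p : quotgroup) : quotgroup := qpi (repr p)^-1.

Lemma repr_qpi x : N (x^-1 * repr (qpi x)).
Proof. by apply/qpiP; rewrite /qpi reprK. Qed.

Lemma qmulE x y : qmul (qpi x) (qpi y) = qpi (x * y).
Proof.
apply/esym/qpiP; move: (repr_qpi x) (repr_qpi y).
set a := repr _; set b := repr _ => Nx Ny.
have -> : (x * y)^-1 * (a * b) = (x^-1 * a) ^ y * (y^-1 * b).
  by rewrite /conjg invgM !mulgA mulgK.
by apply: nsgM => //; apply: nsgJ.
Qed.

Lemma qinvE x : qinv (qpi x) = qpi x^-1.
Proof.
apply/esym/qpiP; move: (repr_qpi x); set a := repr _ => Nx.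
have -> : x^-1^-1 * a^-1 = (x^-1 * a)^-1 ^ x^-1.
  by rewrite /conjg invgM !invgK !mulgA mulgK.
by apply/nsgJ/nsgV.
Qed.

Lemma qmulA : associative qmul.
Proof.
elim/qpi_ind=> x; elim/qpi_ind=> y; elim/qpi_ind=> z.
by rewrite !qmulE mulgA.
Qed.

Lemma qmul1 : left_id qone qmul.
Proof. by elim/qpi_ind=> x; rewrite qmulE mul1g. Qed.

Lemma qmulr1 : right_id qone qmul.
Proof. by elim/qpi_ind=> x; rewrite qmulE mulg1. Qed.

Lemma qmulV : left_inverse qone qinv qmul.
Proof. by elim/qpi_ind=> x; rewrite qinvE qmulE mulVg. Qed.

Lemma qmulrV : right_inverse qone qinv qmul.
Proof. by elim/qpi_ind=> x; rewrite qinvE qmulE mulgV. Qed.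

HB.instance Definition _ :=
  isGroup.Build quotgroup qmulA qmul1 qmulr1 qmulV qmulrV.

Lemma qpiM : {morph qpi : x y / x * y}.
Proof. by move=> x y; rewrite -qmulE. Qed.

HB.instance Definition _ := isMultiplicative.Build G quotgroup qpi qpiM.

End QuotientGroup.

Section QuotientMap.
Variables (G H : groupType) (N : nsubgroup G) (M : nsubgroup H).
Variables (f : {multiplicative G -> H}) (fNM : forall x, N x -> M (f x)).

(* Independent of the representative by [fNM], see qmapE. *)
Definition qmap (q : quotgroup N) : quotgroup M := qpi M (f (repr q)).

Lemma qmapE x : qmap (qpi N x) = qpi M (f x).
Proof.
apply/esym/qpiP; rewrite -morphV -gmulfM; apply: fNM.
exact: repr_qpi.
Qed.
End QuotientMap.

Definition ab (G : groupType) : Type := quotgroup (derived (nsgT G)).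
HB.instance Definition _ (G : groupType) := Choice.on (ab G).

Section Abelianization.
Variable G : groupType.

Definition ab_pi (x : G) : ab G := qpi (derived (nsgT G)) x.

Let add (p q : ab G) : ab G := qmul p q.
Let opp (p : ab G) : ab G := qinv p.
Let zero : ab G := qone (derived (nsgT G)).

Let addA : associative add. Proof. exact: qmulA. Qed.
Let add0 : left_id zero add. Proof. exact: qmul1. Qed.
Let addN : left_inverse zero opp add. Proof. exact: qmulV. Qed.
Let addC : commutative add.
Proof.
elim/qpi_ind=> x; elim/qpi_ind=> y.
rewrite /add !qmulE; apply/qpiP/gspan_gen; exists y, x.
by split=> //; rewrite /commg /conjg invgM !mulgA.
Qed.

HB.instance Definition _ := GRing.isZmodule.Build (ab G) addA addC add0 addN.

Lemma ab_piM x y : ab_pi (x * y)%g = (ab_pi x + ab_pi y)%R.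
Proof. by rewrite [RHS]qmulE. Qed.

Lemma ab_pi_ind (P : ab G -> Prop) : (forall x, P (ab_pi x)) -> forall q, P q.
Proof. exact: qpi_ind. Qed.
End Abelianization.

Lemma nsgR_morph (G H : groupType) (f : {multiplicative G -> H})
    (A B : nsubgroup G) (A' B' : nsubgroup H) :
  (forall x, A x -> A' (f x)) -> (forall x, B x -> B' (f x)) ->
  forall x, nsgR A B x -> nsgR A' B' (f x).
Proof.
move=> fA fB x; elim=> {x} [_ [a [b [Aa Bb ->]]]||x y _ IHx _ IHy|x _ IHx].
- by apply: gspan_gen; exists (f a), (f b); rewrite morphR; split; auto.
- by rewrite morph1; apply: gspan1.
- by rewrite gmulfM; apply: gspanM.
- by rewrite morphV; apply: gspanV.
Qed.

Lemma gamma_morph (G H : groupType) (f : {multiplicative G -> H})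
    (A : nsubgroup G) (A' : nsubgroup H) i :
  (forall x, A x -> A' (f x)) -> forall x, gamma_ i A x -> gamma_ i A' (f x).
Proof.
by move=> fA; rewrite /gamma_; elim: i.-1 => //= k IH; apply: nsgR_morph.
Qed.

Lemma nsgRn_morph (G H : groupType) (f : {multiplicative G -> H})
    (A B : nsubgroup G) (A' B' : nsubgroup H) k :
  (forall x, A x -> A' (f x)) -> (forall x, B x -> B' (f x)) ->
  forall x, nsgRn k A B x -> nsgRn k A' B' (f x).
Proof.
by move=> fA fB; rewrite /nsgRn; elim: k => //= k IH; apply: nsgR_morph.
Qed.

Lemma derivedT_morph (G H : groupType) (f : {multiplicative G -> H}) x :
  derived (nsgT G) x -> derived (nsgT H) (f x).
Proof. exact: gamma_morph. Qed.

Section AbMap.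
Variables (G H : groupType) (f : {multiplicative G -> H}).

Definition ab_map (q : ab G) : ab H := qmap (derived (nsgT H)) f q.

Lemma ab_mapE x : ab_map (ab_pi x) = ab_pi (f x).
Proof. exact/qmapE/derivedT_morph. Qed.

Local Open Scope ring_scope.

Lemma ab_mapD : nmod_morphism ab_map.
Proof.
have D : {morph ab_map : x y / x + y}.
  elim/ab_pi_ind=> x; elim/ab_pi_ind=> y.
  by rewrite -ab_piM !ab_mapE gmulfM ab_piM.
by split=> //; apply: (addrI (ab_map 0)); rewrite -D !addr0.
Qed.

HB.instance Definition _ := GRing.isNmodMorphism.Build (ab G) (ab H) ab_map ab_mapD.
End AbMap.

Local Open Scope ring_scope.

Inductive zspan (V : zmodType) (S : V -> Prop) : V -> Prop :=
| zspan_gen x : S x -> zspan S x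
| zspan0 : zspan S 0
| zspanB x y : zspan S x -> zspan S y -> zspan S (x - y).

Section Span.
Variables (V : zmodType) (S : V -> Prop).

Lemma zspanN x : zspan S x -> zspan S (- x).
Proof. by move=> Sx; rewrite -[- x]add0r; apply/zspanB/Sx/zspan0. Qed.

Lemma zspanD x y : zspan S x -> zspan S y -> zspan S (x + y).
Proof. by move=> Sx Sy; rewrite -[y]opprK; apply/zspanB/zspanN/Sy. Qed.

Lemma zspan_min (T : V -> Prop) :
  (forall x, S x -> T x) -> T 0 -> (forall x y, T x -> T y -> T (x - y)) ->
  forall x, zspan S x -> T x.
Proof. by move=> ST T0 TB x; elim=> //; auto. Qed.

Definition zspanb : {pred V} := fun x => `[< zspan S x >].

Lemma zspanb_closed : zmod_closed zspanb.
Proof.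
split=> [|x y]; rewrite !unfold_in; first exact/asboolP/zspan0.
by move=> /asboolP Sx /asboolP Sy; apply/asboolP/zspanB.
Qed.

HB.instance Definition _ := GRing.isZmodClosed.Build V zspanb zspanb_closed.

Definition quotz : zmodType := {ideal_quot zspanb}.

Definition zpi (x : V) : quotz := \pi_({ideal_quot zspanb}) x.

Lemma zpiB : zmod_morphism zpi.
Proof. exact: (raddfB (\pi_({ideal_quot zspanb}))). Qed.

HB.instance Definition _ := GRing.isZmodMorphism.Build V quotz zpi zpiB.

Lemma zpiP x y : zpi x = zpi y <-> zspan S (x - y).
Proof.
split=> [/eqP|h]; first by rewrite -Quotient.idealrBE => /asboolP.
by apply/eqP; rewrite -Quotient.idealrBE; apply/asboolP.
Qed.

Lemma zpi_eq0 x : zpi x = 0 <-> zspan S x.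
Proof. by rewrite -(raddf0 zpi) zpiP subr0. Qed.

Lemma zpi_ind (P : quotz -> Prop) : (forall x, P (zpi x)) -> forall q, P q.
Proof. by move=> h q; rewrite -[q]reprK; apply: h. Qed.

Variables (W : zmodType) (f : {additive V -> W}).
Variable f0 : forall x, S x -> f x = 0.

Definition zlift (q : quotz) : W := f (repr (q : {ideal_quot zspanb})).

Lemma zliftE x : zlift (zpi x) = f x.
Proof.
apply/eqP; rewrite -subr_eq0 -raddfB; apply/eqP.
have : zspan S (repr (zpi x : {ideal_quot zspanb}) - x).
  by apply/zpiP; rewrite /zpi reprK.
apply: (@zspan_min (fun y => f y = 0)) => //; first exact: raddf0.
by move=> y z fy fz; rewrite raddfB fy fz subr0.
Qed.

Lemma zliftB : zmod_morphism zlift.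
Proof.
elim/zpi_ind=> x; elim/zpi_ind=> y.
rewrite -[zpi x - zpi y]zpiB !zliftE; apply: raddfB.
Qed.
End Span.

Section ZLift.
Variables (V W : zmodType) (S : V -> Prop) (f : {additive V -> W}).
Variable f0 : forall x, S x -> f x = 0.

Definition zfactor of (forall x, S x -> f x = 0) := zlift (S := S) f.

HB.instance Definition _ :=
  GRing.isZmodMorphism.Build (quotz S) W (zfactor f0) (zliftB f0).

Lemma zfactorE x : zfactor f0 (zpi S x) = f x.
Proof. exact: zliftE. Qed.
End ZLift.

Section FreeAbelian.
Variables (K : choiceType) (V : zmodType).

Definition fgl (f : K -> V) (D : {freeg K / int}) : V :=
  fglift (f : K -> zmodule V) D.

Lemma fglB f : zmod_morphism (fgl f).
Proof. by move=> x y; exact: (@lift_is_additive int K (zmodule V) f x y). Qed.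

HB.instance Definition _ f :=
  GRing.isZmodMorphism.Build {freeg K / int} V (fgl f) (fglB f).

Lemma fglU f k : fgl f << k >> = f k.
Proof. by rewrite /fgl liftU scale1r. Qed.

Lemma freeg_ext (f g : {additive {freeg K / int} -> V}) :
  (forall k, f << k >> = g << k >>) -> f =1 g.
Proof.
move=> fg D; rewrite -(freeg_sumE D) !raddf_sum; apply: eq_bigr => k _.
have -> : << coeff k D *g k >> = << k >> *~ coeff k D :> {freeg K / int}.
  by rewrite freeg_mulz intz.
by rewrite !raddfMz fg.
Qed.
End FreeAbelian.

Definition groupring (F : groupType) : Type := {freeg F / int}.
HB.instance Definition _ (F : groupType) := GRing.Zmodule.on (groupring F).

Section GroupRing.
Variable F : groupType.

Definition gr (w : F) : groupring F := << w >>.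

Definition grmul (x y : groupring F) : groupring F :=
  fgl (fun a => fgl (fun b => gr (a * b)%g) y) x.

Definition grmulr (y x : groupring F) : groupring F := grmul x y.

Let grmul_mulr y x : grmulr y x = grmul x y. Proof. by []. Qed.

Lemma grmulBl y : zmod_morphism (grmulr y).
Proof. by move=> a b; apply: (raddfB (fgl _)). Qed.

HB.instance Definition _ y :=
  GRing.isZmodMorphism.Build {freeg F / int} (groupring F) (grmulr y) (grmulBl y).

Lemma grmulBr x : zmod_morphism (grmul x).
Proof.
move=> a b; have E (f g : {additive {freeg F / int} -> groupring F}) :
   f =1 g -> f x = g x by apply.
pose phi c := fgl (fun u => fgl (fun v => gr (u * v)%g) c).
suff /(_ x) : phi (a - b) =1 (phi a \- phi b) by [].
by apply: freeg_ext => k /=; rewrite /phi !fglU raddfB.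
Qed.

HB.instance Definition _ x :=
  GRing.isZmodMorphism.Build {freeg F / int} (groupring F) (grmul x) (grmulBr x).

Lemma grmulE a b : grmul (gr a) (gr b) = gr (a * b)%g.
Proof. by rewrite /grmul !fglU. Qed.

Lemma groupring_ext (V : zmodType) (f g : {additive groupring F -> V}) :
  (forall w, f (gr w) = g (gr w)) -> f =1 g.
Proof. exact: freeg_ext. Qed.

Lemma grmulA : associative grmul.
Proof.
move=> x y z.
apply: (groupring_ext (f := grmulr (grmul y z))
                      (g := grmulr z \o grmulr y)) => a /=.
rewrite !grmul_mulr.
apply: (groupring_ext (f := grmul (gr a) \o grmulr z)
                      (g := grmulr z \o grmul (gr a))) => b /=.
rewrite !grmul_mulr.
apply: (groupring_ext (f := grmul (gr a) \o grmul (gr b))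
                      (g := grmul (grmul (gr a) (gr b)))) => c /=.
by rewrite !grmulE mulgA.
Qed.

Lemma grmul1 : left_id (gr 1%g) grmul.
Proof.
apply: (groupring_ext (f := grmul (gr 1%g)) (g := idfun)) => w /=.
by rewrite grmulE mul1g.
Qed.

Lemma grmulr1 : right_id (gr 1%g) grmul.
Proof.
apply: (groupring_ext (f := grmulr (gr 1%g)) (g := idfun)) => w /=.
by rewrite grmul_mulr grmulE mulg1.
Qed.

Lemma grmulDl : left_distributive grmul +%R.
Proof. by move=> x y z; apply: (raddfD (grmulr z)). Qed.

Lemma grmulDr : right_distributive grmul +%R.
Proof. by move=> x y z; apply: (raddfD (grmul x)). Qed.

HB.instance Definition _ :=
  GRing.Zmodule_isPzRing.Build (groupring F) grmulA grmul1 grmulr1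
    grmulDl grmulDr.

Lemma grM a b : gr (a * b)%g = gr a * gr b.
Proof. by rewrite -grmulE. Qed.

Lemma gr1 : gr 1%g = 1. Proof. by []. Qed.

End GroupRing.

Section GroupRingMap.
Variables (F H : groupType) (f : {multiplicative F -> H}).

Definition grmap (x : groupring F) : groupring H := fgl (fun w => gr (f w)) x.

Lemma grmapB : zmod_morphism grmap.
Proof. by move=> x y; apply: (raddfB (fgl _)). Qed.

HB.instance Definition _ :=
  GRing.isZmodMorphism.Build (groupring F) (groupring H) grmap grmapB.

Lemma grmapE w : grmap (gr w) = gr (f w).
Proof. exact: fglU. Qed.

Lemma grmapM : {morph grmap : x y / x * y}.
Proof.
move=> x y.
apply: (groupring_ext (f := grmap \o grmulr y)
                      (g := grmulr (grmap y) \o grmap)) => a /=.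
rewrite grmapE.
apply: (groupring_ext (f := grmap \o grmul (gr a))
                      (g := grmul (gr (f a)) \o grmap)) => b /=.
by rewrite grmulE !grmapE grmulE gmulfM.
Qed.
End GroupRingMap.

Record ideal (R : pzRingType) := Ideal {
  ideal_set :> R -> Prop;
  ideal0 : ideal_set 0;
  idealB : forall x y, ideal_set x -> ideal_set y -> ideal_set (x - y);
  idealMl : forall a x, ideal_set x -> ideal_set (a * x);
  idealMr : forall a x, ideal_set x -> ideal_set (x * a)
}.

Lemma idealDE (R : pzRingType) (I : ideal R) x y : I x -> I y -> I (x + y).
Proof.
move=> Ix Iy; rewrite -[y]opprK -[- y]add0r.
by apply: idealB => //; apply: idealB => //; apply: ideal0.
Qed.

Section Ideals.
Variable R : pzRingType.
Implicit Types I J : ideal R.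

#[local] Obligation Tactic := idtac.

Program Definition idealI I J : ideal R :=
  @Ideal R (fun x => I x /\ J x) _ _ _ _.
Next Obligation. by move=> I J; split; apply: ideal0. Qed.
Next Obligation. by move=> I J x y [? ?] [? ?]; split; apply: idealB. Qed.
Next Obligation. by move=> I J a x [? ?]; split; apply: idealMl. Qed.
Next Obligation. by move=> I J a x [? ?]; split; apply: idealMr. Qed.

Program Definition idealD I J : ideal R :=
  @Ideal R (fun x => exists i j, [/\ I i, J j & x = i + j]) _ _ _ _.
Next Obligation.
by move=> I J; exists 0, 0; rewrite addr0; split=> //; apply: ideal0.
Qed.
Next Obligation.
move=> I J _ _ [a [b [Ia Jb ->]]] [c [d [Ic Jd ->]]].
exists (a - c), (b - d); split; [exact: idealB|exact: idealB|].
by rewrite opprD addrACA.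
Qed.
Next Obligation.
move=> I J r _ [a [b [Ia Jb ->]]]; exists (r * a), (r * b).
by rewrite mulrDr; split=> //; apply: idealMl.
Qed.
Next Obligation.
move=> I J r _ [a [b [Ia Jb ->]]]; exists (a * r), (b * r).
by rewrite mulrDl; split=> //; apply: idealMr.
Qed.

Program Definition idealM I J : ideal R :=
  @Ideal R (zspan (fun x => exists i j, [/\ I i, J j & x = i * j])) _ _ _ _.
Next Obligation. by move=> I J; apply: zspan0. Qed.
Next Obligation. by move=> I J x y; apply: zspanB. Qed.
Next Obligation.
move=> I J r x; elim=> {x} [_ [i [j [Ii Jj ->]]]||x y _ IHx _ IHy].
- by apply: zspan_gen; exists (r * i), j; rewrite mulrA; split=> //;
    apply: idealMl.
- by rewrite mulr0; apply: zspan0.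
- by rewrite mulrBr; apply: zspanB.
Qed.
Next Obligation.
move=> I J r x; elim=> {x} [_ [i [j [Ii Jj ->]]]||x y _ IHx _ IHy].
- by apply: zspan_gen; exists i, (j * r); rewrite mulrA; split=> //;
    apply: idealMr.
- by rewrite mul0r; apply: zspan0.
- by rewrite mulrBl; apply: zspanB.
Qed.

(* The power I^k for k >= 1. *)
Definition idealX I (k : nat) : ideal R := iter k.-1 (idealM I) I.

End Ideals.

Section AugmentationIdeals.
Variables (F : groupType).

(* The ideal (H - 1)Z[F]; it is two-sided because H is normal. *)
Section Of.
Variable H : nsubgroup F.

Definition aug_set : groupring F -> Prop :=
  zspan (fun x => exists h a, H h /\ x = (gr h - 1) * a).

Lemma aug_grMl w x : aug_set x -> aug_set (gr w * x).
Proof.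
elim=> {x} [_ [h [a [Hh ->]]]||x y _ IHx _ IHy].
- apply: zspan_gen; exists (h ^ w^-1)%g, (gr w * a); split; first exact: nsgJ.
  rewrite !mulrA; congr (_ * a).
  by rewrite mulrBr mulrBl mul1r mulr1 -!grM -conjgCV.
- by rewrite mulr0; apply: zspan0.
- by rewrite mulrBr; apply: zspanB.
Qed.

#[local] Obligation Tactic := idtac.

Program Definition aug : ideal (groupring F) :=
  @Ideal (groupring F) aug_set _ _ _ _.
Next Obligation. exact: zspan0. Qed.
Next Obligation. by move=> x y; apply: zspanB. Qed.
Next Obligation.
move=> a x Hx; have -> : a = \sum_(w <- dom a) << coeff w a *g w >>.
  by rewrite freeg_sumE.
rewrite mulr_suml; elim/big_ind: _ => [|u v Su Sv|w _]; first exact: zspan0.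
- exact: zspanD.
have -> : (<< coeff w a *g w >> : groupring F) = gr w *~ coeff w a.
  by rewrite freeg_mulz intz.
rewrite mulrzAl; move: (coeff w a) => z.
have Swx := aug_grMl w Hx.
have SwxN n : aug_set (gr w * x *+ n).
  by elim: n => [|n IH]; [exact: zspan0 | rewrite mulrS; apply: zspanD].
by case: z => n; rewrite ?NegzE ?mulrNz; [|apply: zspanN]; apply: SwxN.
Qed.
Next Obligation.
move=> a x; elim=> {x} [_ [h [b [Hh ->]]]||x y _ IHx _ IHy].
- by apply: zspan_gen; exists h, (b * a); rewrite mulrA.
- by rewrite mul0r; apply: zspan0.
- by rewrite mulrBl; apply: zspanB.
Qed.
End Of.

(* F \cap (1 + a) *)
Program Definition cap1 (a : ideal (groupring F)) : nsubgroup F :=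
  @NSubgroup F (fun w => a (gr w - 1)) _ _ _ _.
Next Obligation. by rewrite gr1 subrr; apply: ideal0. Qed.
Next Obligation.
have -> : gr (x * y)%g - 1 = (gr x - 1) * gr y + (gr y - 1).
  by rewrite grM mulrBl mul1r addrA subrK.
by apply: idealDE => //; apply: idealMr.
Qed.
Next Obligation.
have -> : gr x^-1%g - 1 = 0 - (gr x - 1) * gr x^-1%g.
  by rewrite mulrBl mul1r -grM mulgV gr1 sub0r opprB.
by apply: idealB; [exact: ideal0 | apply: idealMr].
Qed.
Next Obligation.
have -> : gr (x ^ y)%g - 1 = gr y^-1%g * (gr x - 1) * gr y.
  by rewrite mulrBr mulrBl mulr1 -!grM mulVg gr1 /conjg mulgA.
exact/idealMr/idealMl.
Qed.
End AugmentationIdeals.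

Section IdealMaps.
Variables (F F' : groupType) (f : {multiplicative F -> F'}).
Notation A := (groupring F).
Notation A' := (groupring F').
Notation sends I I' := (forall x, I x -> I' (grmap f x)).

Lemma aug_map (H : nsubgroup F) (H' : nsubgroup F') :
  (forall x, H x -> H' (f x)) -> sends (aug H) (aug H').
Proof.
move=> fH x; elim=> {x} [_ [h [a [Hh ->]]]||x y _ IHx _ IHy].
- apply: zspan_gen; exists (f h), (grmap f a).
  by rewrite grmapM raddfB /= grmapE -(gr1 F) grmapE morph1; split; auto.
- by rewrite raddf0; apply: zspan0.
- by rewrite raddfB; apply: zspanB.
Qed.

Lemma idealI_map (I J : ideal A) (I' J' : ideal A') :
  sends I I' -> sends J J' -> sends (idealI I J) (idealI I' J').
Proof. by move=> fI fJ x [Ix Jx]; split; auto. Qed.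

Lemma idealD_map (I J : ideal A) (I' J' : ideal A') :
  sends I I' -> sends J J' -> sends (idealD I J) (idealD I' J').
Proof.
move=> fI fJ _ [i [j [Ii Jj ->]]]; exists (grmap f i), (grmap f j).
by rewrite raddfD; split; auto.
Qed.

Lemma idealM_map (I J : ideal A) (I' J' : ideal A') :
  sends I I' -> sends J J' -> sends (idealM I J) (idealM I' J').
Proof.
move=> fI fJ x; elim=> {x} [_ [i [j [Ii Jj ->]]]||x y _ IHx _ IHy].
- apply: zspan_gen; exists (grmap f i), (grmap f j).
  by rewrite grmapM; split; auto.
- by rewrite raddf0; apply: zspan0.
- by rewrite raddfB; apply: zspanB.
Qed.

Lemma idealX_map (I : ideal A) (I' : ideal A') k :
  sends I I' -> sends (idealX I k) (idealX I' k).
Proof. by move=> fI; rewrite /idealX; elim: k.-1 => //= j; apply: idealM_map. Qed.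

Lemma cap1_map (I : ideal A) (I' : ideal A') :
  sends I I' -> forall w, cap1 I w -> cap1 I' (f w).
Proof.
move=> fI w /fI; rewrite raddfB /= grmapE.
by rewrite -[X in grmap f X](gr1 F) grmapE morph1.
Qed.
End IdealMaps.

(* Endofunctors of the category of abelian groups; stating the laws up to
   pointwise equality makes fmap independent of the bundled proofs. *)
Record abfunctor := AbFunctor {
  fobj :> zmodType -> zmodType;
  fmap : forall A B : zmodType, {additive A -> B} -> {additive fobj A -> fobj B};
  fmap_id : forall (A : zmodType) (f : {additive A -> A}),
    f =1 id -> fmap f =1 id;
  fmap_comp : forall (A B C : zmodType) (f : {additive A -> B})
      (g : {additive B -> C}) (h : {additive A -> C}),
    h =1 g \o f -> fmap h =1 fmap g \o fmap f
}.

Section SymmetricPower.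
Variable m : nat.

Section Obj.
Variable A : zmodType.

Definition upd (u : {ffun 'I_m -> A}) (i : 'I_m) (x : A) : {ffun 'I_m -> A} :=
  [ffun j => if j == i then x else u j].

(* SP^m(A) is the free abelian group on A^m modulo multilinearity and the
   action of the symmetric group, i.e. the coinvariants of the m-th tensor
   power. *)
Inductive sym_rel : {freeg {ffun 'I_m -> A} / int} -> Prop :=
| sym_rel_add u i x y :
    sym_rel (<< upd u i (x + y) >> - << upd u i x >> - << upd u i y >>)
| sym_rel_perm (u : {ffun 'I_m -> A}) (s : {perm 'I_m}) :
    sym_rel (<< [ffun j => u (s j)] >> - << u >>).

Definition SP_obj : zmodType := quotz sym_rel.

(* The product u_0 u_1 ... u_{m-1} in SP^m(A). *)
Definition sprod (u : {ffun 'I_m -> A}) : SP_obj := zpi sym_rel << u >>.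

Lemma SP_ext (V : zmodType) (f g : {additive SP_obj -> V}) :
  (forall u, f (sprod u) = g (sprod u)) -> f =1 g.
Proof.
move=> fg; elim/zpi_ind=> x.
exact: (freeg_ext (f := f \o zpi sym_rel) (g := g \o zpi sym_rel) fg).
Qed.
End Obj.

Section Map.
Variables (A B : zmodType) (f : {additive A -> B}).

Let g : {freeg {ffun 'I_m -> A} / int} -> SP_obj B :=
  fgl (fun u : {ffun 'I_m -> A} => sprod [ffun j => f (u j)]).

Lemma SP_map_subproof x : sym_rel x -> g x = 0.
Proof.
case=> [u i a b|u s]; rewrite /g !raddfB /= !fglU /sprod -!zpiB;
  apply/zpi_eq0.
- apply: zspan_gen.
  have E c : [ffun j => f (upd u i c j)] = upd [ffun j => f (u j)] i (f c).
    by apply/ffunP => j; rewrite !ffunE; case: eqP.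
  by rewrite !E raddfD; apply: sym_rel_add.
- apply: zspan_gen.
  have -> : [ffun j => f ([ffun j0 => u (s j0)] j)]
            = [ffun j => [ffun j0 => f (u j0)] (s j)].
    by apply/ffunP => j; rewrite !ffunE.
  exact: sym_rel_perm.
Qed.

Definition SP_map : {additive SP_obj A -> SP_obj B} :=
  zfactor SP_map_subproof.

Lemma SP_mapE u : SP_map (sprod u) = sprod [ffun j => f (u j)].
Proof. by rewrite [LHS]zfactorE; apply: fglU. Qed.
End Map.

Lemma SP_map_id (A : zmodType) (f : {additive A -> A}) :
  f =1 id -> SP_map f =1 id.
Proof.
move=> f1; apply: (SP_ext (g := idfun)) => u; rewrite SP_mapE /=.
by congr sprod; apply/ffunP => j; rewrite ffunE f1.
Qed.

Lemma SP_map_comp (A B C : zmodType) (f : {additive A -> B})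
    (g : {additive B -> C}) (h : {additive A -> C}) :
  h =1 g \o f -> SP_map h =1 SP_map g \o SP_map f.
Proof.
move=> hE; apply: (SP_ext (g := SP_map g \o SP_map f)) => u.
rewrite [LHS]SP_mapE [RHS](congr1 (SP_map g) (SP_mapE f u)) SP_mapE.
congr sprod; apply/ffunP => j.
by rewrite !ffunE hE.
Qed.

Definition SP : abfunctor := AbFunctor SP_map_id SP_map_comp.
End SymmetricPower.

(* Morphisms [m] -> [n] of the simplex category. *)
Record mono (m n : nat) := Mono {
  mfun :> {ffun 'I_m.+1 -> 'I_n.+1};
  mfun_mono : [forall i : 'I_m.+1, forall j : 'I_m.+1,
    (i <= j)%N ==> (mfun i <= mfun j)%N]
}.

Lemma monoP m n (a : mono m n) (i j : 'I_m.+1) : (i <= j)%N -> (a i <= a j)%N.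
Proof. by have /forallP/(_ i)/forallP/(_ j)/implyP := mfun_mono a. Qed.

Lemma mono_ext m n (a b : mono m n) : a =1 b -> a = b.
Proof.
case: a b => [a ha] [b hb] /= /ffunP ab; rewrite -{}ab in hb *.
by rewrite (bool_irrelevance ha hb).
Qed.

Section MonoOps.
Local Open Scope nat_scope.

Program Definition mcomp l m n (a : mono m n) (b : mono l m) : mono l n :=
  @Mono l n [ffun i => a (b i)] _.
Next Obligation.
apply/forallP => i; apply/forallP => j; apply/implyP => ij.
by rewrite !ffunE; apply/monoP/monoP.
Qed.

Program Definition coface n (i : 'I_n.+2) : mono n n.+1 :=
  @Mono n n.+1 [ffun j => fintype.lift i j] _.
Next Obligation.
apply/forallP => j; apply/forallP => k; apply/implyP => jk.
by rewrite !ffunE /= leq_bump2.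
Qed.
End MonoOps.

Record simplicial := Simplicial {
  sobj :> nat -> zmodType;
  sact : forall m n, mono m n -> {additive sobj n -> sobj m};
  sact_id : forall n (a : mono n n), a =1 id -> sact a =1 id;
  sact_comp : forall l m n (a : mono m n) (b : mono l m),
    sact (mcomp a b) =1 sact b \o sact a
}.

Record simplicial_map (X Y : simplicial) := SimplicialMap {
  smap :> forall n, {additive X n -> Y n};
  smap_nat : forall m n (a : mono m n) x,
    smap m (sact X a x) = sact Y a (smap n x)
}.

Definition face (X : simplicial) p (i : 'I_p.+2) : {additive X p.+1 -> X p} :=
  sact X (coface i).

(* The homotopy groups are the homology of the Moore complex
   N_p = \bigcap_(i > 0) ker d_i with differential d_0. *)
Section Homotopy.
Variables (X : simplicial) (p : nat).

Definition is_cycle : forall q, X q -> Prop := fun q =>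
  match q return X q -> Prop with
  | 0 => fun=> True
  | _.+1 => fun z => forall i, face X i z = 0
  end.

Definition is_boundary (z : X p) : Prop :=
  exists y : X p.+1, (forall i, i != ord0 -> face X i y = 0) /\ face X ord0 y = z.

Definition cycleb : {pred X p} := fun z => `[< is_cycle z >].

Lemma cycleb_closed : zmod_closed cycleb.
Proof.
split=> [|x y]; rewrite !unfold_in.
  by apply/asboolP; case: p => //= q i; rewrite raddf0.
move=> /asboolP xc /asboolP yc; apply/asboolP.
by case: p x y xc yc => //= q x y xc yc i; rewrite raddfB xc yc subr0.
Qed.

HB.instance Definition _ := GRing.isZmodClosed.Build (X p) cycleb cycleb_closed.

Definition cycles := {z : X p | cycleb z}.
HB.instance Definition _ := Choice.on cycles.
HB.instance Definition _ := SubChoice.on cycles.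
HB.instance Definition _ := [SubChoice_isSubZmodule of cycles by <:].

Definition homotopy : zmodType :=
  quotz (fun z : cycles => is_boundary (val z)).
End Homotopy.

Section HomotopyMap.
Variables (X Y : simplicial) (f : simplicial_map X Y) (p : nat).

Lemma cycles_map_subproof (z : cycles X p) : cycleb (f p (val z)).
Proof.
case: z => /= z /asboolP zc; apply/asboolP; case: p z zc => //= q z zc i.
rewrite /face -smap_nat -[RHS](raddf0 (f q)); congr (f q _); exact: zc.
Qed.

Definition cycles_map (z : cycles X p) : cycles Y p :=
  exist _ (f p (val z)) (cycles_map_subproof z).

Lemma cycles_mapB : zmod_morphism cycles_map.
Proof. by move=> x y; apply: val_inj; rewrite /= !raddfB. Qed.

HB.instance Definition _ :=
  GRing.isZmodMorphism.Build (cycles X p) (cycles Y p) cycles_map cycles_mapB.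

Let g : {additive cycles X p -> homotopy Y p} := zpi _ \o cycles_map.

Lemma homotopy_map_subproof (z : cycles X p) :
  is_boundary (val z) -> g z = 0.
Proof.
move=> [y [y0 yz]]; rewrite /g /=; apply/zpi_eq0/zspan_gen.
 exists (f p.+1 y); split=> /= [i i0|].
  rewrite /face -smap_nat -[RHS](raddf0 (f p)); congr (f p _); exact: y0.
by rewrite /face -smap_nat -yz.
Qed.

Definition homotopy_map : {additive homotopy X p -> homotopy Y p} :=
  zfactor homotopy_map_subproof.
End HomotopyMap.

Section ApplyFunctor.
Variable T : abfunctor.

Program Definition sapply (X : simplicial) : simplicial :=
  @Simplicial (fun n => T (X n)) (fun m n a => fmap T (sact X a)) _ _.
Next Obligation. by apply: fmap_id; apply: sact_id. Qed.
Next Obligation. by apply: fmap_comp; apply: sact_comp. Qed.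

Program Definition sapply_map (X Y : simplicial) (f : simplicial_map X Y) :
    simplicial_map (sapply X) (sapply Y) :=
  @SimplicialMap (sapply X) (sapply Y) (fun n => fmap T (f n)) _.
Next Obligation.
pose h : {additive X n -> Y m} := f m \o sact X a.
have E1 := @fmap_comp T _ _ _ (sact X a) (f m) h (fun=> erefl).
have E2 := @fmap_comp T _ _ _ (f n) (sact Y a) h (smap_nat f a).
by rewrite -[LHS]E1 [LHS]E2.
Qed.
End ApplyFunctor.

Record complex := Complex {
  cobj :> nat -> zmodType;
  cdiff : forall i, {additive cobj i.+1 -> cobj i};
  cdiffK : forall i x, cdiff i (cdiff i.+1 x) = 0
}.

Record chain_map (C D : complex) := ChainMap {
  cmap :> forall i, {additive C i -> D i};
  cmap_diff : forall i x, cmap i (cdiff C i x) = cdiff D i (cmap i.+1 x)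
}.

(* K(C)_n is the group of chain maps from the normalized chain complex of the
   simplex Delta^n to C, the inverse of normalization in the Dold-Kan
   correspondence: an n-simplex is a family of elements x_s of C_k, for all k
   and all k-simplices s of Delta^n, vanishing on the degenerate s and such that
   d x_s = \sum_i (-1)^i x_(d_i s).  Simplicial operators act by
   precomposition. *)
Section DoldKan.
Variable C : complex.

Section Obj.
Variable n : nat.

Definition DKpre := forall k, mono k n -> C k.
HB.instance Definition _ := gen_eqMixin DKpre.
HB.instance Definition _ := gen_choiceMixin DKpre.

Let add (x y : DKpre) : DKpre := fun k s => x k s + y k s.
Let opp (x : DKpre) : DKpre := fun k s => - x k s.
Let zero : DKpre := fun k s => 0.

Lemma DKpre_ext (x y : DKpre) : (forall k s, x k s = y k s) -> x = y.
Proof.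
by move=> xy; apply: functional_extensionality_dep => k;
  apply: functional_extensionality_dep => s.
Qed.

Let addA : associative add.
Proof. by move=> x y z; apply: DKpre_ext => k s; apply: addrA. Qed.
Let addC : commutative add.
Proof. by move=> x y; apply: DKpre_ext => k s; apply: addrC. Qed.
Let add0 : left_id zero add.
Proof. by move=> x; apply: DKpre_ext => k s; apply: add0r. Qed.
Let addN : left_inverse zero opp add.
Proof. by move=> x; apply: DKpre_ext => k s; apply: addNr. Qed.

HB.instance Definition _ := GRing.isZmodule.Build DKpre addA addC add0 addN.

Definition is_simplex (x : DKpre) : Prop :=
  (forall k (s : mono k n), ~ injective s -> x k s = 0) /\
  (forall k (s : mono k.+1 n),
     cdiff C k (x k.+1 s) =
       \sum_(i < k.+2) x k (mcomp s (coface i)) *~ (-1) ^+ i).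

Definition simplexb : {pred DKpre} := fun x => `[< is_simplex x >].

Lemma simplexb_closed : zmod_closed simplexb.
Proof.
split=> [|x y]; rewrite !unfold_in.
  apply/asboolP; split=> // k s; rewrite raddf0.
  by rewrite big1 // => i _; rewrite mul0rz.
move=> /asboolP[x0 xd] /asboolP[y0 yd]; apply/asboolP; split=> k s.
  by move=> sN; rewrite [LHS](congr2 (fun a b => a - b) (x0 k s sN) (y0 k s sN))
    subr0.
rewrite [LHS](raddfB (cdiff C k) (x k.+1 s) (y k.+1 s)) xd yd -sumrB.
by apply: eq_bigr => i _; rewrite -mulrzBl.
Qed.

HB.instance Definition _ := GRing.isZmodClosed.Build DKpre simplexb simplexb_closed.

Definition DKobj := {x : DKpre | simplexb x}.
HB.instance Definition _ := SubChoice.on DKobj.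
HB.instance Definition _ := [SubChoice_isSubZmodule of DKobj by <:].

End Obj.

Section Act.
Variables (m n : nat) (a : mono m n).

Definition DKpre_act (x : DKpre n) : DKpre m := fun k s => x k (mcomp a s).

Lemma DKact_subproof (x : DKobj n) : simplexb (DKpre_act (val x)).
Proof.
case: x => /= x /asboolP[x0 xd]; apply/asboolP; split=> k s => [sN|].
  by apply: x0 => asI; apply: sN => i j ij; apply: asI; rewrite !ffunE ij.
rewrite [LHS]xd; apply: eq_bigr => i _; congr (_ *~ _).
by congr (x k _); apply: mono_ext => j; rewrite !ffunE.
Qed.

Definition DKact_fun (x : DKobj n) : DKobj m :=
  exist _ (DKpre_act (val x)) (DKact_subproof x).

Lemma DKact_funB : zmod_morphism DKact_fun.
Proof. by move=> x y; apply: val_inj; apply: DKpre_ext. Qed.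

HB.instance Definition _ :=
  GRing.isZmodMorphism.Build (DKobj n) (DKobj m) DKact_fun DKact_funB.

Definition DKact : {additive DKobj n -> DKobj m} := DKact_fun.
End Act.

#[local] Obligation Tactic := idtac.

Program Definition DK : simplicial := @Simplicial DKobj DKact _ _.
Next Obligation.
move=> n a a1 x; apply: val_inj; apply: DKpre_ext => k s /=.
by congr (sval x k _); apply: mono_ext => j; rewrite ffunE a1.
Qed.
Next Obligation.
move=> l m n a b x; apply: val_inj; apply: DKpre_ext => k s /=.
by congr (sval x k _); apply: mono_ext => j; rewrite !ffunE.
Qed.
End DoldKan.

Section DoldKanMap.
Variables (C D : complex) (f : chain_map C D).

Section Level.
Variable n : nat.

Definition DKpre_map (x : DKpre C n) : DKpre D n := fun k s => f k (x k s).

Lemma DKmap_subproof (x : DKobj C n) : simplexb (DKpre_map (val x)).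
Proof.
case: x => /= x /asboolP[x0 xd]; apply/asboolP; split=> k s => [sN|].
  by rewrite /DKpre_map x0 ?raddf0.
rewrite /DKpre_map -cmap_diff xd raddf_sum; apply: eq_bigr => i _.
by rewrite raddfMz.
Qed.

Definition DKmap_fun (x : DKobj C n) : DKobj D n :=
  exist _ (DKpre_map (val x)) (DKmap_subproof x).

Lemma DKmap_funB : zmod_morphism DKmap_fun.
Proof.
by move=> x y; apply: val_inj; apply: DKpre_ext => k s; apply: raddfB.
Qed.

HB.instance Definition _ :=
  GRing.isZmodMorphism.Build (DKobj C n) (DKobj D n) DKmap_fun DKmap_funB.
End Level.

Program Definition DKmap : simplicial_map (DK C) (DK D) :=
  @SimplicialMap (DK C) (DK D) (fun n => @DKmap_fun n) _.
Next Obligation. by apply: val_inj. Qed.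
End DoldKanMap.

Definition projective (P : zmodType) : Prop :=
  forall (M N : zmodType) (g : {additive M -> N}) (f : {additive P -> N}),
    (forall y, exists x, g x = y) -> exists h : {additive P -> M}, g \o h =1 f.

Record resolution (A : zmodType) := Resolution {
  res_complex :> complex;
  res_aug : {additive res_complex 0%N -> A};
  res_proj : forall i, projective (res_complex i);
  res_surj : forall a, exists x, res_aug x = a;
  res_exact0 : forall x,
    res_aug x = 0 <-> exists y, cdiff res_complex 0 y = x;
  res_exact : forall i x,
    cdiff res_complex i x = 0 -> exists y, cdiff res_complex i.+1 y = x
}.

Record resolution_map (A B : zmodType) (f : {additive A -> B})
    (P : resolution A) (Q : resolution B) := ResolutionMap {
  rmap :> chain_map P Q;
  rmap_aug : forall x, res_aug Q (rmap 0%N x) = f (res_aug P x)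
}.

(* L_pT(A), computed from the projective resolution P of A. *)
Definition derived_functor (T : abfunctor) (p : nat) (A : zmodType)
    (P : resolution A) : zmodType :=
  homotopy (sapply T (DK P)) p.

Definition derived_functor_map (T : abfunctor) (p : nat) (A B : zmodType)
    (f : {additive A -> B}) (P : resolution A) (Q : resolution B)
    (phi : resolution_map f P Q) :
    {additive derived_functor T p P -> derived_functor T p Q} :=
  homotopy_map (sapply_map T (DKmap phi)) p.

Section Subgroup.
Variables (G : groupType) (N : nsubgroup G).

Definition nsgb : {pred G} := fun x => `[< N x >].

Lemma nsgb_closed : group_closed nsgb.
Proof.
split=> [|x y]; rewrite !unfold_in; first exact/asboolP/nsg1.
by move=> /asboolP Nx /asboolP Ny; apply/asboolP/nsgM/nsgV.
Qed.

Definition subg : Type := {x : G | nsgb x}.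
HB.instance Definition _ := SubChoice.on subg.
HB.instance Definition _ := SubChoice_isSubGroup.Build G nsgb subg nsgb_closed.

Definition subg_val (x : subg) : G := val x.

Lemma subg_valM : {morph subg_val : x y / (x * y)%g}.
Proof. exact: valM. Qed.

HB.instance Definition _ := isMultiplicative.Build subg G subg_val subg_valM.

Program Definition nsg_in (D : nsubgroup G) : nsubgroup subg :=
  @NSubgroup subg (fun x => D (subg_val x)) _ _ _ _.
Next Obligation. by rewrite morph1; apply: nsg1. Qed.
Next Obligation. by rewrite gmulfM; apply: nsgM. Qed.
Next Obligation. by rewrite morphV; apply: nsgV. Qed.
Next Obligation. by rewrite morphJ; apply: nsgJ. Qed.

(* N / (N \cap D), which is N / D when D is contained in N. *)
Definition subquotient (D : nsubgroup G) : groupType := quotgroup (nsg_in D).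
End Subgroup.

Section SubquotientMap.
Variables (G H : groupType) (f : {multiplicative G -> H}).
Variables (N D : nsubgroup G) (N' D' : nsubgroup H).
Hypothesis fN : forall x, N x -> N' (f x).
Hypothesis fD : forall x, D x -> D' (f x).

Lemma subg_map_subproof (x : subg N) : nsgb N' (f (val x)).
Proof. by case: x => x /= /asboolP Nx; apply/asboolP/fN. Qed.

Definition subg_map (x : subg N) : subg N' :=
  exist _ (f (val x)) (subg_map_subproof x).

Lemma subg_mapM : {morph subg_map : x y / (x * y)%g}.
Proof. by move=> x y; apply: val_inj; rewrite /= !gmulfM. Qed.

HB.instance Definition _ :=
  isMultiplicative.Build (subg N) (subg N') subg_map subg_mapM.

(* Well defined on cosets by [fD], see subquotient_mapE. *)
Definition subquotient_map : subquotient N D -> subquotient N' D' :=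
  qmap (nsg_in N' D') subg_map.

Lemma subquotient_mapE x :
  subquotient_map (qpi _ x) = qpi _ (subg_map x).
Proof. by apply: qmapE => y; apply: fD. Qed.
End SubquotientMap.

(* 1 -> R -> F -> G -> 1, with R = pres_ker. *)
Record free_presentation := FreePresentation {
  presF : groupType;
  presG : groupType;
  pres_pi : {multiplicative presF -> presG};
  presF_free : is_free presF;
  pres_surj : forall g, exists w, pres_pi w = g
}.

#[local] Obligation Tactic := idtac.

Program Definition pres_ker (X : free_presentation) : nsubgroup (presF X) :=
  @NSubgroup (presF X) (fun w => pres_pi X w = 1%g) _ _ _ _.
Next Obligation. by move=> X; apply: morph1. Qed.
Next Obligation. by move=> X x y hx hy; rewrite /= gmulfM hx hy mulg1. Qed.
Next Obligation. by move=> X x hx; rewrite /= morphV hx invg1. Qed.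
Next Obligation. by move=> X x y hx; rewrite /= morphJ hx conj1g. Qed.

Record presentation_map (X Y : free_presentation) := PresentationMap {
  pmapF : {multiplicative presF X -> presF Y};
  pmapG : {multiplicative presG X -> presG Y};
  pmap_comm : forall w, pmapG (pres_pi X w) = pres_pi Y (pmapF w)
}.

Section Terms.
Variables (X : free_presentation) (n : nat).

Let F := nsgT (presF X).
Let R := pres_ker X.
Let f := aug F.
Let r := aug R.

(* f ((F' - 1)Z[F] \cap f^n) + r f^n + f^(n+2) *)
Definition num_ideal : ideal (groupring (presF X)) :=
  idealD (idealD (idealM f (idealI (aug (derived F)) (idealX f n)))
                 (idealM r (idealX f n)))
         (idealX f n.+2).

Definition numerator : nsubgroup (presF X) := cap1 num_ideal.

(* [R, R, F, ..., F] (F'' \cap gamma_(n+1)(F)) gamma_(n+2)(F), with n - 1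
   copies of F in the commutator. *)
Definition denominator : nsubgroup (presF X) :=
  nsgMul (nsgMul (nsgRn n.-1 (nsgR R R) F)
                 (nsgI (derived (derived F)) (gamma_ n.+1 F)))
         (gamma_ n.+2 F).
End Terms.

Section TermMaps.
Variables (X Y : free_presentation) (m : presentation_map X Y) (n : nat).

Lemma pres_ker_map w : pres_ker X w -> pres_ker Y (pmapF m w).
Proof. by rewrite /= -pmap_comm => ->; apply: morph1. Qed.

Lemma numerator_map w : numerator X n w -> numerator Y n (pmapF m w).
Proof.
have fF := @aug_map _ _ (pmapF m) (nsgT _) (nsgT _) (fun _ _ => I).
apply: cap1_map; apply: idealD_map; last exact: idealX_map.
apply: idealD_map; apply: idealM_map => //.
- apply: idealI_map; last exact: idealX_map.
  by apply: aug_map; apply: derivedT_morph.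
- by apply: aug_map; apply: pres_ker_map.
- exact: idealX_map.
Qed.

Lemma nsgMul_map (G H : groupType) (h : {multiplicative G -> H})
    (A B : nsubgroup G) (A' B' : nsubgroup H) :
  (forall x, A x -> A' (h x)) -> (forall x, B x -> B' (h x)) ->
  forall x, nsgMul A B x -> nsgMul A' B' (h x).
Proof.
move=> hA hB _ [a [b [Aa Bb ->]]]; exists (h a), (h b).
by rewrite gmulfM; split; auto.
Qed.

Lemma denominator_map w : denominator X n w -> denominator Y n (pmapF m w).
Proof.
apply: nsgMul_map; last exact: gamma_morph.
apply: nsgMul_map.
  by apply: nsgRn_morph => //; apply: nsgR_morph; apply: pres_ker_map.
move=> x [Ax Bx]; split; last exact: gamma_morph Bx.
by apply: gamma_morph Ax; apply: derivedT_morph.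
Qed.

Definition quotient_map :
    subquotient (numerator X n) (denominator X n) ->
    subquotient (numerator Y n) (denominator Y n) :=
  @subquotient_map _ _ _ _ (denominator X n) _ (denominator Y n)
    numerator_map.

Lemma quotient_mapE x : quotient_map (qpi _ x) = qpi _ (subg_map numerator_map x).
Proof. exact/subquotient_mapE/denominator_map. Qed.

End TermMaps.

(* Main.v *)
(* Let A = F_ab and pi : A -> G_ab, with kernel B. Pairs (a, a') with
   pi a = pi a', thought of as arrows a -> a', generate a commutative ring T
   with source and target maps to Sym A, subject to the relations
   (0, b)(b', 0) = 0, which make it a groupoid object in rings. T is functorial,
   and any two lifts of the same map between the targets of two such pi are
   related by a natural transformation, so they agree on the group K_m of arrows
   of degree m from 0 to 0. For a projective resolution P of G_ab, sending a
   1-simplex x of K(P) to the arrow (d_1 x, d_0 x) identifies L_1 SP^m(G_ab)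
   with the group K_m of P_0 -> G_ab, hence with that of pi.

   An element w of the numerator satisfies
   w - 1 = sum (r - 1)(w_1 - 1)...(w_n - 1), r in R, modulo
   f((F' - 1)Z[F] /\ f^n) + f^(n+2), and it is sent to the arrow
   sum (0, r) w_1 ... w_n in K_{n+1}(pi). Through the Magnus expansion the left
   hand side becomes an element of A (x) S^n(A), and the arrow depends only on
   this element because S^n(A) is free. Conversely an element of
   A (x) S^n(A) that dies in S^{n+1}(A) comes from gamma_{n+1}(F), which gives
   surjectivity. For injectivity, the dimension subgroups of the free group F are
   the gamma_k(F) (by Hall's collection of brackets along Lyndon words), and
   gamma_{n+1}(F) modulo (F'' /\ gamma_{n+1}(F)) gamma_{n+2}(F) embeds in
   A (x) S^n(A); the elements whose arrow vanishes are spanned there by the images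
   of the [r, r', x_1, ..., x_{n-1}]. *)
Require Import Defs.
From HB Require Import structures.
From mathcomp Require Import all_boot all_order all_algebra.
From mathcomp Require Import perm boolp ring zify wochoice.
From mathcomp.multinomials Require Import freeg.
(* [ring_quotient] has its own [idealB], [idealMr], etc., which must not shadow
   those of Defs. *)
Import Defs.

Set Implicit Arguments.
Unset Strict Implicit.
Unset Printing Implicit Defensive.

Import GRing.Theory.
Local Open Scope ring_scope.

(** * Rings on generators *)

(** The null products come from composition: arrows compose by the additive rule e + e' - id, and
    this rule respects products once every element of source 0 kills every element of target 0. On
    the simplicial side these same products are Moore boundaries, so in each degree [Tr] is the
    symmetric power of the 1-simplices modulo boundaries.

    The obstacle is that the decomposition of w - 1 is not unique, and that neither a basis of F nor
    a lift F_ab -> P_0 may enter a natural map. The correspondence is therefore a basis-free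
    relation; a basis is chosen only inside proofs that it is total, functional and bijective. With
    a basis, the common invariant of both sides is [tau], which sorts all letters of a Magnus
    coefficient except the first. In degree n+1 it forgets precisely the ideal f((F' - 1)Z[F] /\
    f^n), up to f^(n+2), and on gamma_{n+1}(F) it forgets precisely F'' /\ gamma_{n+1}(F), up to
    gamma_{n+2}(F). This is why the first term appears in the numerator and the second in the
    denominator. *)

Lemma freeg_gen_ind (K : choiceType) (P : {freeg K / int} -> Prop) :
  P 0 -> (forall x y, P x -> P y -> P (x - y)) -> (forall k, P << k >>) ->
  forall x, P x.
Proof.
move=> P0 PB Pw x; have PN y : P y -> P (- y) by rewrite -sub0r; apply: PB.
have PD y z : P y -> P z -> P (y + z) by move=> ? /PN; rewrite -{2}[z]opprK; apply: PB.
rewrite -(freeg_sumE x); elim/big_ind: _ => // s _.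
have -> : << coeff s x *g s >> = << s >> *~ coeff s x :> {freeg K / int}.
  by rewrite freeg_mulz intz.
have PM n : P (<< s >> *+ n) by elim: n => // n IH; rewrite mulrS; apply: PD.
by case: (coeff s x) => n; rewrite ?NegzE ?mulrNz; [|apply: PN]; apply: PM.
Qed.

(** The free associative ring on [K]: words form a basis and multiply by concatenation. *)
Definition frg (K : choiceType) : Type := {freeg (seq K) / int}.
HB.instance Definition _ K := GRing.Zmodule.on (frg K).

Section FreeRing.
Variable K : choiceType.

Definition wd (s : seq K) : frg K := << s >>.

Definition flin (V : zmodType) (h : seq K -> V) : {additive frg K -> V} := fgl h.

Lemma flinE (V : zmodType) (h : seq K -> V) s : flin h (wd s) = h s.
Proof. exact: fglU. Qed.

Lemma frg_ext (V : zmodType) (f g : {additive frg K -> V}) :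
  (forall s, f (wd s) = g (wd s)) -> f =1 g.
Proof. exact: freeg_ext. Qed.

Lemma frg_ind (P : frg K -> Prop) :
  P 0 -> (forall x y, P x -> P y -> P (x - y)) -> (forall s, P (wd s)) ->
  forall x, P x.
Proof. exact: freeg_gen_ind. Qed.

Definition fmul (x y : frg K) : frg K :=
  flin (fun a => flin (fun b => wd (a ++ b)) y) x.

Definition fmulr (y x : frg K) : frg K := fmul x y.

Let fmul_mulr y x : fmulr y x = fmul x y. Proof. by []. Qed.

Lemma fmulBl y : zmod_morphism (fmulr y).
Proof. by move=> a b; apply: (raddfB (flin _)). Qed.

HB.instance Definition _ y :=
  GRing.isZmodMorphism.Build (frg K) (frg K) (fmulr y) (fmulBl y).

Lemma fmulBr x : zmod_morphism (fmul x).
Proof.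
move=> a b.
pose phi c := flin (fun u => flin (fun v => wd (u ++ v)) c).
suff /(_ x) : phi (a - b) =1 (phi a \- phi b) by [].
by apply: frg_ext => k /=; rewrite /phi !flinE raddfB.
Qed.

HB.instance Definition _ x :=
  GRing.isZmodMorphism.Build (frg K) (frg K) (fmul x) (fmulBr x).

Lemma fmulE a b : fmul (wd a) (wd b) = wd (a ++ b).
Proof. by rewrite /fmul !flinE. Qed.

Lemma fmulA : associative fmul.
Proof.
move=> x y z.
apply: (frg_ext (f := fmulr (fmul y z)) (g := fmulr z \o fmulr y)) => a /=.
rewrite !fmul_mulr.
apply: (frg_ext (f := fmul (wd a) \o fmulr z) (g := fmulr z \o fmul (wd a))) => b /=.
rewrite !fmul_mulr.
apply: (frg_ext (f := fmul (wd a) \o fmul (wd b))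
                (g := fmul (fmul (wd a) (wd b)))) => c /=.
by rewrite !fmulE catA.
Qed.

Lemma fmul1 : left_id (wd [::]) fmul.
Proof.
by apply: (frg_ext (f := fmul (wd [::])) (g := idfun)) => w /=; rewrite fmulE.
Qed.

Lemma fmulr1 : right_id (wd [::]) fmul.
Proof.
apply: (frg_ext (f := fmulr (wd [::])) (g := idfun)) => w /=.
by rewrite fmul_mulr fmulE cats0.
Qed.

Lemma fmulDl : left_distributive fmul +%R.
Proof. by move=> x y z; apply: (raddfD (fmulr z)). Qed.

Lemma fmulDr : right_distributive fmul +%R.
Proof. by move=> x y z; apply: (raddfD (fmul x)). Qed.

HB.instance Definition _ :=
  GRing.Zmodule_isPzRing.Build (frg K) fmulA fmul1 fmulr1 fmulDl fmulDr.

Lemma wdM a b : wd (a ++ b) = wd a * wd b.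
Proof. by rewrite -fmulE. Qed.

Lemma wd_cons k s : wd (k :: s) = wd [:: k] * wd s.
Proof. by rewrite -wdM. Qed.

Lemma wd0 : wd [::] = 1. Proof. by []. Qed.

Lemma coeff_wd s t : coeff s (wd t) = (t == s)%:R.
Proof. by rewrite coeffU mul1r. Qed.

Lemma mul_ext (R : pzRingType) (f : {additive frg K -> R}) :
  (forall s t, f (wd (s ++ t)) = f (wd s) * f (wd t)) -> {morph f : x y / x * y}.
Proof.
move=> fM x y.
apply: (frg_ext (f := f \o (y \o* idfun)) (g := f y \o* f)) => s /=.
apply: (frg_ext (f := f \o (wd s \*o idfun)) (g := f (wd s) \*o f)) => t /=.
by rewrite -wdM fM.
Qed.

Section Map.
Variables (R : pzRingType) (phi : K -> R).

Definition frmap : frg K -> R := flin (fun s => \prod_(k <- s) phi k).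

Lemma frmapB : zmod_morphism frmap.
Proof. exact: raddfB. Qed.

HB.instance Definition _ := GRing.isZmodMorphism.Build (frg K) R frmap frmapB.

Lemma frmapE s : frmap (wd s) = \prod_(k <- s) phi k.
Proof. exact: flinE. Qed.

Lemma frmap_monoid : monoid_morphism frmap.
Proof.
split; first by rewrite frmapE big_nil.
by apply: (mul_ext (f := frmap)) => s t; rewrite /= !frmapE big_cat.
Qed.

HB.instance Definition _ := GRing.isMonoidMorphism.Build (frg K) R frmap frmap_monoid.

Lemma frmap1 k : frmap (wd [:: k]) = phi k.
Proof. by rewrite frmapE big_seq1. Qed.
End Map.

End FreeRing.

(** * Commutative rings with quadratic monomial relations *)

Section CommPresentation.
Variables (V : zmodType) (rho : V -> V -> Prop).

(** The relations are stated inside arbitrary words [s] and [t], so their additive span is already a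
    two-sided ideal ([galg_spanM]). It also allows additive, non-multiplicative maps out of the
    quotient to be defined word by word ([galg_lift]). *)
Inductive galg_rel : frg V -> Prop :=
| galg_add s t x y :
    galg_rel (wd (s ++ (x + y) :: t) - wd (s ++ x :: t) - wd (s ++ y :: t))
| galg_swap s t x y : galg_rel (wd (s ++ [:: x, y & t]) - wd (s ++ [:: y, x & t]))
| galg_rho s t x y : rho x y -> galg_rel (wd (s ++ [:: x, y & t])).

Lemma galg_relM u x v : galg_rel x -> galg_rel (wd u * x * wd v).
Proof.
have E p q r : wd u * wd (p ++ q ++ r) * wd v = wd ((u ++ p) ++ q ++ (r ++ v)).
  by rewrite -!wdM !catA.
case=> [s t a b|s t a b|s t a b r].
- rewrite !mulrBr !mulrBl.
  rewrite (E s [:: a + b] t) (E s [:: a] t) (E s [:: b] t).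
  exact: (galg_add (u ++ s) (t ++ v) a b).
- rewrite !mulrBr !mulrBl (E s [:: a; b] t) (E s [:: b; a] t).
  exact: (galg_swap (u ++ s) (t ++ v) a b).
- by rewrite (E s [:: a; b] t); apply: (galg_rho (u ++ s) (t ++ v)).
Qed.

Lemma galg_spanM a b x : zspan galg_rel x -> zspan galg_rel (a * x * b).
Proof.
move=> Sx; elim/frg_ind: a x Sx => [x _|a a' IHa IHa' x Sx|u x Sx].
- by rewrite !mul0r; apply: zspan0.
- by rewrite !mulrBl; apply: zspanB; [apply: IHa|apply: IHa'].
elim/frg_ind: b x Sx => [x _|b b' IHb IHb' x Sx|v x Sx].
- by rewrite mulr0; apply: zspan0.
- by rewrite mulrBr; apply: zspanB; [apply: IHb|apply: IHb'].
elim: Sx => [y Sy||y z _ IHy _ IHz].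
- exact/zspan_gen/galg_relM.
- by rewrite mulr0 mul0r; apply: zspan0.
- by rewrite mulrBr mulrBl; apply: zspanB.
Qed.

Definition galg : Type := quotz galg_rel.
HB.instance Definition _ := GRing.Zmodule.on galg.

Definition gpi : {additive frg V -> galg} := zpi galg_rel.

Definition gw (s : seq V) : galg := gpi (wd s).

Definition gl (x : V) : galg := gw [:: x].

Lemma galg_ind (P : galg -> Prop) : (forall x, P (gpi x)) -> forall q, P q.
Proof. exact: zpi_ind. Qed.

Lemma gpiP x y : gpi x = gpi y <-> zspan galg_rel (x - y).
Proof. exact: zpiP. Qed.

Lemma galg_exists q : exists x, gpi x = q.
Proof. by elim/galg_ind: q => x; exists x. Qed.

Definition grepr (q : galg) : frg V := projT1 (cid (galg_exists q)).

Lemma greprK q : gpi (grepr q) = q.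
Proof. exact: projT2 (cid (galg_exists q)). Qed.

Definition gmul (p q : galg) : galg := gpi (grepr p * grepr q).

Lemma gmulE x y : gmul (gpi x) (gpi y) = gpi (x * y).
Proof.
apply/gpiP.
have h z : zspan galg_rel (grepr (gpi z) - z) by apply/gpiP; rewrite greprK.
have -> : grepr (gpi x) * grepr (gpi y) - x * y =
    1 * (grepr (gpi x) - x) * grepr (gpi y) + x * (grepr (gpi y) - y) * 1.
  by rewrite mul1r mulr1 mulrBl mulrBr addrA subrK.
by apply: zspanD; apply: galg_spanM.
Qed.

Lemma gmulA : associative gmul.
Proof.
by elim/galg_ind=> x; elim/galg_ind=> y; elim/galg_ind=> z; rewrite !gmulE mulrA.
Qed.

Lemma gmul1 : left_id (gpi 1) gmul.
Proof. by elim/galg_ind=> x; rewrite gmulE mul1r. Qed.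

Lemma gmulDl : left_distributive gmul +%R.
Proof.
elim/galg_ind=> x; elim/galg_ind=> y; elim/galg_ind=> z.
by rewrite -raddfD !gmulE mulrDl raddfD.
Qed.

Lemma gw_swap s t x y : gw (s ++ [:: x, y & t]) = gw (s ++ [:: y, x & t]).
Proof. by apply/gpiP/zspan_gen; constructor. Qed.

Lemma gw_catC s t : gw (s ++ t) = gw (t ++ s).
Proof.
have mv x u w : gw (w ++ x :: u) = gw (w ++ rcons u x).
  elim: u w => //= y u IH w; rewrite gw_swap.
  by have := IH (rcons w y); rewrite !cat_rcons.
elim: s t => [|x s IH] t /=; first by rewrite cats0.
by rewrite (mv x _ [::]) /= rcons_cat IH cat_rcons.
Qed.

Lemma gmulC : commutative gmul.
Proof.
elim/galg_ind=> x; elim/galg_ind=> y; rewrite !gmulE.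
apply: (frg_ext (f := gpi \o (y \o* idfun)) (g := gpi \o (y \*o idfun))) => s /=.
apply: (frg_ext (f := gpi \o (wd s \*o idfun)) (g := gpi \o (wd s \o* idfun))) => t /=.
by rewrite -!wdM; apply: gw_catC.
Qed.

HB.instance Definition _ :=
  GRing.Zmodule_isComPzRing.Build galg gmulA gmulC gmul1 gmulDl.

Lemma gpi_monoid : monoid_morphism gpi.
Proof. by split=> // x y; rewrite -gmulE. Qed.

HB.instance Definition _ := GRing.isZmodMorphism.Build (frg V) galg gpi (raddfB gpi).
HB.instance Definition _ := GRing.isMonoidMorphism.Build (frg V) galg gpi gpi_monoid.

Lemma gw_cat s t : gw (s ++ t) = gw s * gw t.
Proof. by rewrite /gw wdM rmorphM. Qed.

Lemma gw_cons x s : gw (x :: s) = gl x * gw s.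
Proof. by rewrite -gw_cat. Qed.

Lemma gw_nil : gw [::] = 1. Proof. by []. Qed.

Lemma gwE s : gw s = \prod_(x <- s) gl x.
Proof. by elim: s => [|x s IH]; rewrite ?big_nil ?big_cons // gw_cons IH. Qed.

Lemma glB : zmod_morphism gl.
Proof.
have D x y : gl (x + y) = gl x + gl y.
  apply/eqP; rewrite -subr_eq0 opprD addrA; apply/eqP.
  rewrite -!raddfB; apply/zpi_eq0/zspan_gen; exact: (galg_add [::] [::]).
by move=> x y; apply: (addIr (gl y)); rewrite -D !subrK.
Qed.

HB.instance Definition _ := GRing.isZmodMorphism.Build V galg gl glB.

Lemma gl_rho x y : rho x y -> gl x * gl y = 0.
Proof.
move=> r; rewrite -[gl x * _]gw_cons; apply/zpi_eq0/zspan_gen.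
exact: (galg_rho [::] [::]).
Qed.

Lemma galg_ext (W : zmodType) (f g : {additive galg -> W}) :
  (forall s, f (gw s) = g (gw s)) -> f =1 g.
Proof.
move=> fg; elim/galg_ind=> x.
exact: (frg_ext (f := f \o gpi) (g := g \o gpi) fg).
Qed.

Section Lift.
Variables (W : zmodType) (h : seq V -> W).
Hypothesis hD : forall s t x y,
  h (s ++ (x + y) :: t) = h (s ++ x :: t) + h (s ++ y :: t).
Hypothesis hS : forall s t x y, h (s ++ [:: x, y & t]) = h (s ++ [:: y, x & t]).
Hypothesis hR : forall s t x y, rho x y -> h (s ++ [:: x, y & t]) = 0.

Lemma galg_lift_subproof x : galg_rel x -> flin h x = 0.
Proof.
case=> [s t a b|s t a b|s t a b r]; rewrite ?raddfB /= !flinE.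
- by rewrite hD addrAC addrK subrr.
- by rewrite hS subrr.
- exact: hR.
Qed.

Definition galg_lift : {additive galg -> W} := zfactor galg_lift_subproof.

Lemma galg_liftE s : galg_lift (gw s) = h s.
Proof. by rewrite [LHS]zfactorE; apply: fglU. Qed.
End Lift.

Section Hom.
Variables (R : comPzRingType) (phi : {additive V -> R}).
Hypothesis phiR : forall x y, rho x y -> phi x * phi y = 0.

Lemma galg_hom_subproof x : galg_rel x -> frmap phi x = 0.
Proof.
case=> [s t a b|s t a b|s t a b r]; rewrite ?raddfB /= !frmapE !big_cat /= !big_cons.
- by rewrite raddfD mulrDl mulrDr addrAC addrK subrr.
- by rewrite [phi a * _]mulrCA subrr.
- by rewrite !mulrA -(mulrA _ (phi a)) phiR // mulr0 mul0r.
Qed.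

Definition galg_hom : galg -> R :=
  zfactor galg_hom_subproof.

HB.instance Definition _ :=
  GRing.isZmodMorphism.Build galg R galg_hom (raddfB (zfactor galg_hom_subproof)).

Lemma galg_homE x : galg_hom (gpi x) = frmap phi x.
Proof. exact: zfactorE. Qed.

Lemma galg_hom_monoid : monoid_morphism galg_hom.
Proof.
split; first by rewrite -[1]/(gpi 1) galg_homE rmorph1.
elim/galg_ind=> x; elim/galg_ind=> y.
by rewrite -rmorphM !galg_homE rmorphM.
Qed.

HB.instance Definition _ :=
  GRing.isMonoidMorphism.Build galg R galg_hom galg_hom_monoid.

Lemma galg_hom1 x : galg_hom (gl x) = phi x.
Proof. by rewrite galg_homE frmap1. Qed.
End Hom.

Lemma galg_hom_ext (R : comPzRingType) (f g : {rmorphism galg -> R}) :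
  (forall x, f (gl x) = g (gl x)) -> f =1 g.
Proof.
move=> fg; apply: (galg_ext (f := f) (g := g)) => s; rewrite gwE !rmorph_prod.
by apply: eq_bigr.
Qed.

Definition ghom (m : nat) : galg -> Prop :=
  zspan (fun x => exists2 s, size s = m & x = gw s).
End CommPresentation.

Definition symalg (V : zmodType) : comPzRingType := galg (fun _ _ : V => False).

Lemma symalg_phiR (V : zmodType) (R : comPzRingType) (phi : V -> R) (x y : V) :
  False -> phi x * phi y = 0.
Proof. by []. Qed.

Definition symalg_hom (V : zmodType) (R : comPzRingType) (phi : {additive V -> R}) :
  symalg V -> R := galg_hom (@symalg_phiR V R phi).

HB.instance Definition _ V R phi :=
  GRing.RMorphism.copy (@symalg_hom V R phi) (galg_hom (@symalg_phiR V R phi)).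
Arguments symalg_hom : simpl never.

Lemma symalg_hom1 (V : zmodType) (R : comPzRingType) (phi : {additive V -> R}) x :
  symalg_hom phi (gl _ x) = phi x.
Proof. exact: galg_hom1. Qed.

Definition symalg_map (V W : zmodType) (g : {additive V -> W}) : symalg V -> symalg W :=
  symalg_hom (gl _ \o g : {additive V -> symalg W}).

HB.instance Definition _ V W g :=
  GRing.RMorphism.copy (@symalg_map V W g) (symalg_hom (gl _ \o g : {additive V -> symalg W})).
Arguments symalg_map : simpl never.

Lemma symalg_map1 (V W : zmodType) (g : {additive V -> W}) x :
  symalg_map g (gl _ x) = gl _ (g x).
Proof. exact: symalg_hom1. Qed.

(** * Arrows over a homomorphism of abelian groups *)

Section Groupoid.
Variables (A C : zmodType) (p : {additive A -> C}).

Definition epairb : {pred A * A} := fun x => p x.1 == p x.2.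

Lemma epairb_closed : zmod_closed epairb.
Proof.
split=> [|x y]; rewrite !unfold_in //= => /eqP hx /eqP hy.
by rewrite !raddfB hx hy.
Qed.

HB.instance Definition _ := GRing.isZmodClosed.Build (A * A)%type epairb epairb_closed.

Definition epair := {x : A * A | epairb x}.
HB.instance Definition _ := SubChoice.on epair.
HB.instance Definition _ := [SubChoice_isSubZmodule of epair by <:].

Definition src (e : epair) : A := (val e).1.
Definition tgt (e : epair) : A := (val e).2.

Lemma src_additive : zmod_morphism src. Proof. by []. Qed.
Lemma tgt_additive : zmod_morphism tgt. Proof. by []. Qed.
HB.instance Definition _ := GRing.isZmodMorphism.Build epair A src src_additive.
HB.instance Definition _ := GRing.isZmodMorphism.Build epair A tgt tgt_additive.

Lemma epairP (e : epair) : p (src e) = p (tgt e).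
Proof. exact/eqP/(valP e). Qed.

Definition ep a a' (h : p a = p a') : epair := exist _ (a, a') (introT eqP h).

Lemma ep_ext (e e' : epair) : src e = src e' -> tgt e = tgt e' -> e = e'.
Proof.
move=> h h'; apply: val_inj; move: h h'; rewrite /src /tgt.
by case: (val e) (val e') => [a b] [c d] /= -> ->.
Qed.

(** The form on generators of ker [srcT] * ker [tgtT] = 0, which [ker_src_tgt] extends to all
    elements. *)
Definition comp_null (e e' : epair) : Prop := src e = 0 /\ tgt e' = 0.

Definition Tr : comPzRingType := galg comp_null.

Let lt (e : epair) : Tr := gl comp_null e.
Let lS (a : A) : symalg A := gl _ a.

Lemma src_null (e e' : epair) : comp_null e e' -> lS (src e) * lS (src e') = 0.
Proof. by case=> -> _; rewrite /lS raddf0 mul0r. Qed.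
Lemma tgt_null (e e' : epair) : comp_null e e' -> lS (tgt e) * lS (tgt e') = 0.
Proof. by case=> _ ->; rewrite /lS raddf0 mulr0. Qed.

Definition srcT : Tr -> symalg A :=
  galg_hom (phi := lS \o src : {additive epair -> symalg A}) src_null.

HB.instance Definition _ :=
  GRing.RMorphism.copy srcT
    (galg_hom (phi := lS \o src : {additive epair -> symalg A}) src_null).
Arguments srcT : simpl never.
Definition tgtT : Tr -> symalg A :=
  galg_hom (phi := lS \o tgt : {additive epair -> symalg A}) tgt_null.

HB.instance Definition _ :=
  GRing.RMorphism.copy tgtT
    (galg_hom (phi := lS \o tgt : {additive epair -> symalg A}) tgt_null).
Arguments tgtT : simpl never.

Lemma srcT1 e : srcT (lt e) = lS (src e). Proof. exact: galg_hom1. Qed.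
Lemma tgtT1 e : tgtT (lt e) = lS (tgt e). Proof. exact: galg_hom1. Qed.

Definition ediag (a : A) : epair := ep (erefl (p a)).

Lemma ediagB : zmod_morphism ediag.
Proof. by move=> a b; apply: ep_ext. Qed.
HB.instance Definition _ := GRing.isZmodMorphism.Build A epair ediag ediagB.

Definition idT : symalg A -> Tr :=
  symalg_hom (lt \o ediag : {additive A -> Tr}).

HB.instance Definition _ :=
  GRing.RMorphism.copy idT
    (symalg_hom (lt \o ediag : {additive A -> Tr})).
Arguments idT : simpl never.

Lemma idT1 a : idT (lS a) = lt (ediag a). Proof. exact: symalg_hom1. Qed.

Lemma src_idT x : srcT (idT x) = x.
Proof.
apply: (galg_hom_ext (f := srcT \o idT) (g := idfun)) => a /=.
by rewrite idT1 srcT1.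
Qed.

Lemma tgt_idT x : tgtT (idT x) = x.
Proof.
apply: (galg_hom_ext (f := tgtT \o idT) (g := idfun)) => a /=.
by rewrite idT1 tgtT1.
Qed.

Let dsrc x := x - idT (srcT x).
Let dtgt x := x - idT (tgtT x).

(** [dsrc] behaves like a twisted derivation: on a product it is a combination of its values on the
    factors. On a generator it is a generator of source 0, which [comp_null] kills against [e]. *)
Lemma dsrc_null x e : tgt e = 0 -> dsrc x * lt e = 0.
Proof.
move=> e0; pose f : {additive Tr -> Tr} := lt e \o* (idfun \- (idT \o srcT)).
suff /(_ x) : f =1 \0 by [].
apply: galg_ext => s; rewrite /f /=.
elim: s => [|e' s IH]; first by rewrite gw_nil !rmorph1 subrr mul0r.
rewrite gw_cons -/(lt e') !rmorphM /= srcT1 idT1.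
have -> : lt e' * gw comp_null s - lt (ediag (src e')) * idT (srcT (gw comp_null s))
  = gw comp_null s * (lt e' - lt (ediag (src e'))) +
    lt (ediag (src e')) * (gw comp_null s - idT (srcT (gw comp_null s))).
  by rewrite mulrBr mulrBr [gw _ _ * lt e']mulrC [gw _ _ * lt (ediag _)]mulrC addrA subrK.
rewrite mulrDl -mulrA -[_ * _ * lt e]mulrA IH mulr0 addr0 -raddfB gl_rho ?mulr0 //.
by split=> //=; rewrite /src /= subrr.
Qed.

Lemma dsrc_dtgt x y : dsrc x * dtgt y = 0.
Proof.
pose f : {additive Tr -> Tr} := dsrc x \*o (idfun \- (idT \o tgtT)).
suff /(_ y) : f =1 \0 by [].
apply: galg_ext => s; rewrite /f /=.
elim: s => [|e' s IH]; first by rewrite gw_nil !rmorph1 subrr mulr0.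
rewrite gw_cons -/(lt e') !rmorphM /= tgtT1 idT1.
have -> : lt e' * gw comp_null s - lt (ediag (tgt e')) * idT (tgtT (gw comp_null s))
  = (lt e' - lt (ediag (tgt e'))) * gw comp_null s +
    lt (ediag (tgt e')) * (gw comp_null s - idT (tgtT (gw comp_null s))).
  by rewrite mulrBl mulrBr addrA subrK.
rewrite mulrDr [X in _ + X]mulrCA IH mulr0 addr0 mulrA -raddfB dsrc_null ?mul0r //.
by rewrite /tgt /= subrr.
Qed.

Lemma ker_src_tgt x y : srcT x = 0 -> tgtT y = 0 -> x * y = 0.
Proof.
by move=> hx hy; have := dsrc_dtgt x y; rewrite /dsrc /dtgt hx hy !rmorph0 !subr0.
Qed.

(* [f1 x] and [f2 x] are composable arrows of an internal groupoid in rings, and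
   [f1 + f2 - id] is their composite; composition is multiplicative because
   [ker src * ker tgt = 0]. *)
Lemma comp_ext (V : zmodType) (rho : V -> V -> Prop)
    (f1 f2 f3 : {rmorphism galg rho -> Tr}) :
  (forall v, tgtT (f1 (gl rho v)) = srcT (f2 (gl rho v))) ->
  (forall v, f3 (gl rho v) =
     f1 (gl rho v) + f2 (gl rho v) - idT (tgtT (f1 (gl rho v)))) ->
  forall x, f3 x = f1 x + f2 x - idT (tgtT (f1 x)).
Proof.
move=> h12 h3.
have {}h12 : tgtT \o f1 =1 srcT \o f2 by apply: galg_hom_ext.
apply: (galg_ext (f := f3) (g := (f1 \+ f2) \- (idT \o tgtT \o f1))) => s /=.
elim: s => [|v s IH]; first by rewrite gw_nil !rmorph1 addrK.
rewrite gw_cons !rmorphM IH h3.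
set x := f1 _; set y := f2 _; set u := idT _; set x' := f1 _; set y' := f2 _.
set u' := idT _.
have E a b c d : tgtT a = tgtT (idT c) -> srcT b = srcT (idT d) ->
    (a - idT c) * (b - idT d) = 0.
  move=> h h'; rewrite mulrC; apply: ker_src_tgt; by rewrite raddfB /= ?h ?h' subrr.
have E1 : (x - u) * (y' - u') = 0.
  apply: E; rewrite ?src_idT ?tgt_idT //; exact/esym/h12.
have E2 : (x' - u') * (y - u) = 0.
  apply: E; rewrite ?src_idT ?tgt_idT //; exact/esym/h12.
apply/eqP; rewrite -subr_eq0; apply/eqP.
have -> : (x + y - u) * (x' + y' - u') - (x * x' + y * y' - u * u') =
   (x - u) * (y' - u') + (x' - u') * (y - u).
  by ring.
by rewrite E1 E2 addr0.
Qed.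

Definition Kset (m : nat) (x : Tr) : Prop :=
  [/\ ghom m x, srcT x = 0 & tgtT x = 0].
End Groupoid.

Section GroupoidMorphisms.
Variables (A C : zmodType) (p : {additive A -> C}).
Implicit Types x y : Tr p.
Implicit Types u v : symalg A.
Lemma srcTM x y : srcT (x * y) = srcT x * srcT y. Proof. exact: rmorphM. Qed.
Lemma srcTB x y : srcT (x - y) = srcT x - srcT y. Proof. exact: raddfB. Qed.
Lemma srcT0 : srcT (0 : Tr p) = 0. Proof. exact: raddf0. Qed.
Lemma tgtTM x y : tgtT (x * y) = tgtT x * tgtT y. Proof. exact: rmorphM. Qed.
Lemma tgtTB x y : tgtT (x - y) = tgtT x - tgtT y. Proof. exact: raddfB. Qed.
Lemma tgtT0 : tgtT (0 : Tr p) = 0. Proof. exact: raddf0. Qed.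
Lemma idTM u v : idT p (u * v) = idT p u * idT p v. Proof. exact: rmorphM. Qed.
Lemma idTB u v : idT p (u - v) = idT p u - idT p v. Proof. exact: raddfB. Qed.
Lemma idT0 : idT p 0 = 0. Proof. exact: raddf0. Qed.
Lemma srcT_1 : srcT (1 : Tr p) = 1. Proof. exact: rmorph1. Qed.
Lemma tgtT_1 : tgtT (1 : Tr p) = 1. Proof. exact: rmorph1. Qed.
Lemma idT_1 : idT p 1 = 1. Proof. exact: rmorph1. Qed.
End GroupoidMorphisms.

Section GroupoidMap.
Variables (A C A' C' : zmodType) (p : {additive A -> C}) (p' : {additive A' -> C'}).
Variables (h : C -> C').

Definition lies_over (g : {additive A -> A'}) := forall a, p' (g a) = h (p a).

Section Two.
Variables (g g' : {additive A -> A'}) (hg : lies_over g) (hg' : lies_over g').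

Lemma ehom_subproof (e : epair p) : p' (g (src e)) = p' (g' (tgt e)).
Proof. by rewrite hg hg' epairP. Qed.

Definition ehom (e : epair p) : epair p' := ep (ehom_subproof e).

Lemma ehomB : zmod_morphism ehom.
Proof. by move=> a b; apply: ep_ext; rewrite /src /tgt /= raddfB. Qed.
HB.instance Definition _ := GRing.isZmodMorphism.Build (epair p) (epair p') ehom ehomB.

Lemma ehom_null e e' : comp_null e e' -> gl (@comp_null _ _ p') (ehom e) * gl _ (ehom e') = 0.
Proof.
case=> e0 e1; apply: gl_rho; split; rewrite /src /tgt /=.
  by rewrite e0 raddf0.
by rewrite e1 raddf0.
Qed.

(** Sends a -> a' to g a -> g' a'. For g = g' this is functoriality; for two lifts it is the
    diagonal of the naturality square, and [Tmap_homotopy] factors that diagonal along both sides of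
    the square. *)
Definition Thom : Tr p -> Tr p' :=
  galg_hom (phi := gl _ \o ehom : {additive epair p -> Tr p'}) ehom_null.

HB.instance Definition _ :=
  GRing.RMorphism.copy Thom
    (galg_hom (phi := gl _ \o ehom : {additive epair p -> Tr p'}) ehom_null).
Arguments Thom : simpl never.

Lemma Thom1 e : Thom (gl _ e) = gl _ (ehom e). Proof. exact: galg_hom1. Qed.

Lemma src_Thom x : srcT (Thom x) = symalg_map g (srcT x).
Proof.
pose f1 : {rmorphism Tr p -> symalg A'} := @srcT _ _ p' \o Thom.
pose f2 : {rmorphism Tr p -> symalg A'} := symalg_map g \o @srcT _ _ p.
suff /(_ x) : f1 =1 f2 by [].
apply: galg_hom_ext => e; rewrite /f1 /f2 /=.
by rewrite Thom1 !srcT1 symalg_map1.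
Qed.

Lemma tgt_Thom x : tgtT (Thom x) = symalg_map g' (tgtT x).
Proof.
pose f1 : {rmorphism Tr p -> symalg A'} := @tgtT _ _ p' \o Thom.
pose f2 : {rmorphism Tr p -> symalg A'} := symalg_map g' \o @tgtT _ _ p.
suff /(_ x) : f1 =1 f2 by [].
apply: galg_hom_ext => e; rewrite /f1 /f2 /=.
by rewrite Thom1 !tgtT1 symalg_map1.
Qed.
End Two.

Definition Tmap g (hg : lies_over g) : Tr p -> Tr p' := Thom hg hg.

HB.instance Definition _ g hg := GRing.RMorphism.copy (@Tmap g hg) (Thom hg hg).
Arguments Tmap : simpl never.

Lemma Tmap1 g (hg : lies_over g) e : Tmap hg (gl _ e) = gl _ (ehom hg hg e).
Proof. exact: Thom1. Qed.

Lemma Kset_Tmap g (hg : lies_over g) m x : Kset m x -> Kset m (Tmap hg x).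
Proof.
case=> hm hs ht; split; last 2 first.
- by rewrite src_Thom hs rmorph0.
- by rewrite tgt_Thom ht rmorph0.
elim: hm => [y [s <- ->]||y z _ IHy _ IHz]; last 2 first.
- by rewrite rmorph0; apply: zspan0.
- by rewrite rmorphB; apply: zspanB.
apply: zspan_gen; exists (map (ehom hg hg) s); first by rewrite size_map.
rewrite !gwE rmorph_prod big_map; by apply: eq_bigr => e _ /=; rewrite Tmap1.
Qed.

(* Conjugating by the natural transformation a |-> (g a -> g' a). *)
Lemma Tmap_homotopy g g' (hg : lies_over g) (hg' : lies_over g') x :
  srcT x = 0 -> tgtT x = 0 -> Tmap hg x = Tmap hg' x.
Proof.
move=> sx tx.
have key a : p' (g a) = p' (g' a) by rewrite hg hg'.
have [H HE] : exists H : {rmorphism symalg A -> Tr p'},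
    forall a, H (gl _ a) = gl _ (ehom hg hg' (ediag p a)).
  by exists (Thom hg hg' \o idT p : {rmorphism symalg A -> Tr p'}) => a /=;
    rewrite (idT1 p a) Thom1.
have E1 y : Thom hg hg' y = Tmap hg y + H (tgtT y) - idT p' (tgtT (Tmap hg y)).
  apply: (comp_ext (f2 := H \o @tgtT _ _ p)) => e /=.
    by rewrite !tgtT1 ?Tmap1 ?Thom1 HE tgtT1 srcT1.
  rewrite !tgtT1 ?Tmap1 ?Thom1 HE tgtT1 (idT1 p') -raddfD -raddfB; congr gl.
  by apply: ep_ext; rewrite /src /tgt /= ?addrK // addrC addKr.
have E2 y : Thom hg hg' y = H (srcT y) + Tmap hg' y - idT p' (tgtT (H (srcT y))).
  apply: (comp_ext (f1 := H \o @srcT _ _ p)) => e /=.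
    by rewrite !srcT1 ?Tmap1 ?Thom1 HE tgtT1 srcT1.
  rewrite !srcT1 ?Tmap1 ?Thom1 HE tgtT1 (idT1 p') -raddfD -raddfB; congr gl.
  by apply: ep_ext; rewrite /src /tgt /= ?addrK // addrC addKr.
have := E1 x; rewrite (E2 x) sx tx !rmorph0 addr0 add0r !subr0.
by rewrite tgt_Thom tx !rmorph0 subr0 => ->.
Qed.
End GroupoidMap.

Section TmapMorphism.
Variables (A C A' C' : zmodType) (p : {additive A -> C}) (p' : {additive A' -> C'}).
Variables (h : C -> C') (g : {additive A -> A'}) (hg : lies_over p p' h g).
Implicit Types x y : Tr p.
Lemma TmapM x y : Tmap hg (x * y) = Tmap hg x * Tmap hg y. Proof. exact: rmorphM. Qed.
Lemma TmapB x y : Tmap hg (x - y) = Tmap hg x - Tmap hg y. Proof. exact: raddfB. Qed.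
Lemma TmapD x y : Tmap hg (x + y) = Tmap hg x + Tmap hg y. Proof. exact: raddfD. Qed.
Lemma Tmap0 : Tmap hg 0 = 0. Proof. exact: raddf0. Qed.
Lemma Tmap_1 : Tmap hg 1 = 1. Proof. exact: rmorph1. Qed.
End TmapMorphism.

Lemma Tmap_comp (A B D A' B' D' : zmodType) (p : {additive A -> A'})
    (q : {additive B -> B'}) (r : {additive D -> D'}) h h' h''
    (g : {additive A -> B}) (g' : {additive B -> D}) (g'' : {additive A -> D})
    (hg : lies_over p q h g) (hg' : lies_over q r h' g') (hg'' : lies_over p r h'' g'') :
  g'' =1 g' \o g -> forall x, Tmap hg' (Tmap hg x) = Tmap hg'' x.
Proof.
move=> gE; apply: (galg_hom_ext (f := Tmap hg' \o Tmap hg)) => e /=.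
by rewrite !Tmap1; congr gl; apply: ep_ext; rewrite /src /tgt /= gE.
Qed.

Lemma Tmap_id (A C : zmodType) (p : {additive A -> C}) h (g : {additive A -> A})
    (hg : lies_over p p h g) : g =1 id -> Tmap hg =1 id.
Proof.
move=> gE; apply: (galg_hom_ext (g := idfun)) => e /=.
by rewrite !Tmap1; congr gl; apply: ep_ext; rewrite /src /tgt /= gE.
Qed.

(** * Symmetric powers and simplices of low dimension *)

Section SPProps.
Variables (m : nat) (V : zmodType).

Lemma sprod_upd (u : {ffun 'I_m -> V}) i x y :
  sprod (upd u i (x + y)) = sprod (upd u i x) + sprod (upd u i y).
Proof.
apply/eqP; rewrite -subr_eq0 opprD addrA /sprod -!raddfB; apply/eqP.
by apply/zpi_eq0/zspan_gen; constructor.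
Qed.

Lemma sprod_perm (u : {ffun 'I_m -> V}) (s : {perm 'I_m}) :
  sprod [ffun j => u (s j)] = sprod u.
Proof.
apply/eqP; rewrite -subr_eq0 /sprod -!raddfB; apply/eqP.
by apply/zpi_eq0/zspan_gen; constructor.
Qed.

(** The value 0 on lists of the wrong length keeps the product multilinear and symmetric on all
    lists, so that it extends to the whole symmetric algebra as the projection [Sym_SP]. *)
Definition sps (s : seq V) : SP_obj m V :=
  if size s == m then sprod [ffun j : 'I_m => nth 0 s j] else 0.

Lemma spsE (u : {ffun 'I_m -> V}) : sps [seq u j | j <- enum 'I_m] = sprod u.
Proof.
rewrite /sps size_map size_enum_ord eqxx; congr sprod; apply/ffunP => j.
by rewrite ffunE (nth_map j) ?size_enum_ord // nth_ord_enum.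
Qed.

Lemma sps_nth s : size s = m -> sps s = sprod [ffun j : 'I_m => nth 0 s j].
Proof. by rewrite /sps => ->; rewrite eqxx. Qed.

Lemma spsD s t x y : sps (s ++ (x + y) :: t) = sps (s ++ x :: t) + sps (s ++ y :: t).
Proof.
rewrite /sps !size_cat /=; case: eqP => [sm|]; last by rewrite addr0.
have si : (size s < m)%N by rewrite -sm addnS ltnS leq_addr.
pose u := [ffun j : 'I_m => nth 0 (s ++ 0 :: t) j].
have E z : [ffun j : 'I_m => nth 0 (s ++ z :: t) j] = upd u (Ordinal si) z.
  apply/ffunP => j; rewrite !ffunE !nth_cat -val_eqE /=.
  case: ltngtP => //= [sj|->]; last by rewrite subnn.
  by case: (j - size s)%N (subn_gt0 (size s) j); rewrite ?sj.
by rewrite !E sprod_upd.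
Qed.

Lemma sps_swap s t x y : sps (s ++ [:: x, y & t]) = sps (s ++ [:: y, x & t]).
Proof.
rewrite /sps !size_cat /=; case: eqP => // sm.
have si : (size s < m)%N by rewrite -sm addnS ltnS leq_addr.
have sj : ((size s).+1 < m)%N by rewrite -sm !addnS !ltnS leq_addr.
rewrite -(sprod_perm _ (tperm (Ordinal si) (Ordinal sj))); congr sprod.
apply/ffunP => j; rewrite !ffunE; case: tpermP => [->|->|]; rewrite !nth_cat /=.
- by rewrite subnn ltnn ltnNge leqnSn subSnn.
- by rewrite subnn ltnn ltnNge leqnSn subSnn.
move=> /eqP; rewrite -val_eqE /= => j1 /eqP; rewrite -val_eqE /= => j2.
case: ltnP => // sj'; have : (1 < j - size s)%N by lia.
by case: (j - size s)%N => // [[]].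
Qed.

Lemma sps_subst s t x y : sps (s ++ (x - y) :: t) = sps (s ++ x :: t) - sps (s ++ y :: t).
Proof. by apply/eqP; rewrite eq_sym subr_eq -spsD subrK. Qed.

Section Lift.
Variables (R : comPzRingType) (phi : {additive V -> R}).

Let h : {additive {freeg {ffun 'I_m -> V} / int} -> R} :=
  fgl (fun u : {ffun 'I_m -> V} => \prod_j phi (u j)).

Lemma SP_lift_subproof x : sym_rel x -> h x = 0.
Proof.
case=> [u i a b|u s]; rewrite /h !raddfB /= !fglU.
  have E c : \prod_(j < m) phi (upd u i c j) =
      phi c * \prod_(j < m | j != i) phi (u j).
    rewrite (bigD1 i) //= ffunE eqxx; congr (_ * _).
    by apply: eq_bigr => j /negPf ji; rewrite ffunE ji.
  by rewrite !E raddfD mulrDl addrAC addrK subrr.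
rewrite [X in _ - X](reindex_inj (@perm_inj _ s)) /=.
apply/eqP; rewrite subr_eq0; apply/eqP.
by apply: eq_bigr => j _; rewrite ffunE.
Qed.

Definition SP_lift : {additive SP_obj m V -> R} := zfactor SP_lift_subproof.

Lemma SP_liftE u : SP_lift (sprod u) = \prod_j phi (u j).
Proof. by rewrite [LHS]zfactorE; apply: fglU. Qed.
End Lift.

Definition SP_Sym : {additive SP_obj m V -> symalg V} := SP_lift (gl _).

Definition Sym_SP : {additive symalg V -> SP_obj m V} :=
  galg_lift (rho := fun _ _ => False) spsD sps_swap (fun _ _ _ _ (e : False) => False_ind _ e).

(** Makes SP^m a direct summand of the symmetric algebra, so that equations in SP^m can be tested in
    a ring. *)
Lemma SP_SymK x : Sym_SP (SP_Sym x) = x.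
Proof.
apply: (SP_ext (f := Sym_SP \o SP_Sym) (g := idfun)) => u.
have E : SP_Sym (sprod u) = gw _ [seq u j | j <- enum 'I_m].
  by rewrite [LHS]SP_liftE gwE big_map big_enum.
by rewrite [LHS](congr1 Sym_SP E) [LHS]galg_liftE spsE.
Qed.
End SPProps.

Lemma SP_lift_comp m (V W : zmodType) (R R' : comPzRingType) (f : {additive V -> W})
    (phi : {additive W -> R}) (phi' : {additive V -> R'}) (r : {rmorphism R' -> R}) :
  (forall x, r (phi' x) = phi (f x)) ->
  forall x, r (SP_lift m phi' x) = SP_lift m phi (SP_map m f x).
Proof.
move=> E x; apply: (SP_ext (f := r \o SP_lift m phi') (g := SP_lift m phi \o SP_map m f)) => u.
rewrite [LHS](congr1 r (SP_liftE phi' u)) [RHS](congr1 (SP_lift m phi) (SP_mapE f u)).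
by rewrite SP_liftE rmorph_prod; apply: eq_bigr => j _; rewrite E ffunE.
Qed.

Lemma SP_map_sps m (V W : zmodType) (f : {additive V -> W}) s :
  SP_map m f (sps m s) = sps m (map f s).
Proof.
rewrite /sps size_map; case: eqP => sm; last by rewrite raddf0.
rewrite SP_mapE; congr sprod; apply/ffunP => j; rewrite !ffunE (nth_map 0) //.
by rewrite sm.
Qed.

Lemma sps0 m (V : zmodType) (s t : seq V) : sps m (s ++ 0 :: t) = 0.
Proof. by rewrite -(subrr 0) sps_subst subrr. Qed.

Lemma SP_lift_sps m (V : zmodType) (R : comPzRingType) (phi : {additive V -> R}) s :
  size s = m -> SP_lift m phi (sps m s) = \prod_(v <- s) phi v.
Proof.
move=> sm; rewrite sps_nth // SP_liftE (big_nth 0) sm big_mkord.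
by apply: eq_bigr => j _; rewrite ffunE.
Qed.

Lemma mcompE l m n (a : mono m n) (b : mono l m) j : mcomp a b j = a (b j).
Proof. by rewrite ffunE. Qed.

Lemma cofaceE n (i : 'I_n.+2) j : coface i j = fintype.lift i j.
Proof. by rewrite ffunE. Qed.

Lemma mono_inj_leq m n (s : mono m n) : injective s -> (m <= n)%N.
Proof. by move/leq_card; rewrite !card_ord. Qed.

Lemma mono_inj_lt m n (s : mono m n) (i j : 'I_m.+1) : injective s -> (i < j)%N -> (s i < s j)%N.
Proof.
move=> sI ij; rewrite ltn_neqAle monoP 1?ltnW // andbT.
by apply/eqP => /val_inj/sI ij'; rewrite ij' ltnn in ij.
Qed.

Lemma mono_inj_id n (s : mono n n) : injective s -> s =1 id.
Proof.
move=> sI i; apply: val_inj => /=; apply/eqP; rewrite eqn_leq; apply/andP; split.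
  have H k (j : 'I_n.+1) : (n - j)%N = k -> (s j <= j)%N.
    elim: k j => [|k IH] j jk; first by have := ltn_ord (s j); lia.
    have j1 : (j.+1 < n.+1)%N by lia.
    have := IH (Ordinal j1); have := @mono_inj_lt _ _ s j (Ordinal j1) sI (ltnSn _).
    by move=> h /=; move: (s (Ordinal j1)) h => q h /(_ ltac:(lia)); lia.
  exact: (H (n - i)%N).
have H k (j : 'I_n.+1) : nat_of_ord j = k -> (j <= s j)%N.
  elim: k j => [|k IH] j jk; first by rewrite jk.
  have j1 : (k < n.+1)%N by have := ltn_ord j; lia.
  have := IH (Ordinal j1) erefl; have := @mono_inj_lt _ _ s (Ordinal j1) j sI.
  rewrite /= jk => /(_ (ltnSn _)); lia.
exact: (H i).
Qed.

Lemma mono_ninj n m (s : mono n.+1 m) : ~ injective s ->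
  exists i : 'I_n.+1, s (widen_ord (leqnSn _) i) = s (fintype.lift ord0 i).
Proof.
move=> sN; apply: contrapT => H; apply: sN.
have lt (i j : 'I_n.+2) : (i < j)%N -> (s i < s j)%N.
  move=> ij; have i1 : (i < n.+1)%N by have := ltn_ord j; lia.
  have h1 : (s i <= s (fintype.lift ord0 (Ordinal i1)))%N by apply: monoP; rewrite /= /bump; lia.
  have h2 : (s (fintype.lift ord0 (Ordinal i1)) <= s j)%N by apply: monoP; rewrite /= /bump; lia.
  apply: leq_trans h2; rewrite ltn_neqAle h1 andbT.
  apply/eqP => /val_inj e; apply: H; exists (Ordinal i1); rewrite -e.
  by congr (s _); apply: val_inj.
move=> i j; case: (ltngtP i j) => [/lt|/lt|/val_inj //]; by [move=> h e; rewrite e ltnn in h].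
Qed.

(** A degenerate simplex repeats two neighbouring vertices. The faces omitting either of them
    coincide and have opposite signs, and all other faces stay degenerate. Hence the boundary
    equation of K(P) has to be checked on injective [s] only. *)
Lemma alt_sum_degenerate (V : zmodType) k n (s : mono k.+1 n) (f : mono k n -> V) :
  ~ injective s -> (forall t : mono k n, ~ injective t -> f t = 0) ->
  \sum_(i < k.+2) f (mcomp s (coface i)) *~ (-1) ^+ i = 0.
Proof.
move=> /mono_ninj [i0 si0] f0.
set a := widen_ord _ _ in si0; set b := fintype.lift ord0 i0 in si0.
have bE : b = a.+1 :> nat by rewrite /= /bump; lia.
rewrite (bigD1 a) //= (bigD1 b) /=; last by apply/eqP => e; have := bE; rewrite e; lia.
rewrite big1 => [|i /andP[ia ib]]; last first.
  rewrite f0 ?mul0rz // => sI.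
  have {}ia : i != a :> nat by [].
  have {}ib : i != b :> nat by [].
  have [ja jaE] : exists ja, fintype.lift i ja = a.
    by case: (unliftP i a) => [j ->|e]; [exists j|rewrite e eqxx in ia].
  have [jb jbE] : exists jb, fintype.lift i jb = b.
    by case: (unliftP i b) => [j ->|e]; [exists j|rewrite e eqxx in ib].
  have e : ja = jb by apply: sI; rewrite !mcompE !cofaceE jaE jbE.
  by have := bE; rewrite -jbE -e jaE; lia.
rewrite addr0.
have -> : mcomp s (coface b) = mcomp s (coface a).
  apply: mono_ext => j; rewrite !mcompE !cofaceE.
  have [->|/eqP ji] := eqVneq j i0.
    have -> : fintype.lift b i0 = a by apply: val_inj; rewrite /= /bump /=; lia.
    have -> // : fintype.lift a i0 = b by apply: val_inj; rewrite /= /bump /=; lia.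
  have {}ji : j <> i0 :> nat by move=> /val_inj.
  by congr (s _); apply: val_inj; rewrite /= /bump /=; lia.
by rewrite -[bump 0 i0]/(i0.+1) exprS mulN1r mulrNz subrr.
Qed.

Lemma mkmono_subproof m n (f : 'I_m.+1 -> 'I_n.+1) :
  (forall i j : 'I_m.+1, (i <= j)%N -> (f i <= f j)%N) ->
  [forall i : 'I_m.+1, forall j : 'I_m.+1,
    (i <= j)%N ==> ([ffun k => f k] i <= [ffun k => f k] j)%N].
Proof.
move=> h; apply/forallP => i; apply/forallP => j; apply/implyP => ij.
by rewrite !ffunE; apply: h.
Qed.

Definition mkmono m n (f : 'I_m.+1 -> 'I_n.+1)
    (h : forall i j : 'I_m.+1, (i <= j)%N -> (f i <= f j)%N) : mono m n :=
  Mono (mkmono_subproof h).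

Definition mid n : mono n n := @mkmono n n id (fun _ _ ij => ij).

Lemma midE n i : mid n i = i. Proof. by rewrite ffunE. Qed.

(** * Vertices, edges and fillers of K(P) *)

Section LowDegrees.
Variable P : complex.
Notation d := (cdiff P).

Definition vtx0 (x : DK P 0) : P 0%N := val x 0%N (mid 0).
Definition edge1 (x : DK P 1) : P 1%N := val x 1%N (mid 1).

Lemma vtx0B : zmod_morphism vtx0. Proof. by []. Qed.
Lemma edge1B : zmod_morphism edge1. Proof. by []. Qed.
HB.instance Definition _ := GRing.isZmodMorphism.Build (DK P 0) (P 0%N) vtx0 vtx0B.
HB.instance Definition _ := GRing.isZmodMorphism.Build (DK P 1) (P 1%N) edge1 edge1B.

Lemma DK_simplex n (x : DKobj P n) : is_simplex (val x).
Proof. exact/asboolP/(valP x). Qed.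

Lemma DK_ext n (x y : DKobj P n) :
  (forall k (s : mono k n), injective s -> val x k s = val y k s) -> x = y.
Proof.
move=> h; apply: val_inj; apply: DKpre_ext => k s.
case: (pselect (injective s)) => [|sN]; first exact: h.
by rewrite (DK_simplex x).1 // (DK_simplex y).1.
Qed.

Lemma vtx0_inj : injective vtx0.
Proof.
move=> x y xy; apply: DK_ext => k s sI.
have k0 : k = 0%N by have := mono_inj_leq sI; lia.
subst k; have -> // : s = mid 0.
by apply: mono_ext => i; rewrite (mono_inj_id sI) midE.
Qed.

Definition V0_pre (a : P 0%N) : DKpre P 0 := fun k =>
  match k return mono k 0 -> P k with 0%N => fun=> a | _ => fun=> 0 end.

Lemma V0_subproof a : simplexb (V0_pre a).
Proof.
apply/asboolP; split=> [[|k] s //|k s].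
  by case; move=> i j _; rewrite !ord1.
rewrite raddf0; case: k s => [|k] s.
  by rewrite big_ord_recr big_ord_recr big_ord0 /= add0r expr0 expr1 mulrN1z mulr1z subrr.
by rewrite big1 // => i _; rewrite mul0rz.
Qed.

Definition V0 (a : P 0%N) : DK P 0 := exist _ (V0_pre a) (V0_subproof a).

Lemma vtx0_V0 a : vtx0 (V0 a) = a. Proof. by []. Qed.

Lemma V0_vtx0 x : V0 (vtx0 x) = x. Proof. exact: vtx0_inj. Qed.

Lemma V0B : zmod_morphism V0. Proof. by move=> a b; apply: vtx0_inj. Qed.
HB.instance Definition _ := GRing.isZmodMorphism.Build (P 0%N) (DK P 0) V0 V0B.

Definition bd (i : 'I_2) (x : DK P 1) : P 0%N := vtx0 (face (DK P) i x).

Lemma bdB i : zmod_morphism (bd i).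
Proof. by move=> x y; rewrite /bd !raddfB. Qed.
HB.instance Definition _ i := GRing.isZmodMorphism.Build (DK P 1) (P 0%N) (bd i) (bdB i).

Lemma bd_edge x : d 0%N (edge1 x) = bd ord0 x - bd ord_max x.
Proof.
rewrite /edge1 (DK_simplex x).2 big_ord_recr big_ord_recr big_ord0 /= add0r.
rewrite expr0 expr1 mulrN1z mulr1z; congr (_ - _); rewrite /bd /vtx0 /=;
  congr (sval x 0%N _); apply: mono_ext => j; rewrite !mcompE midE !cofaceE midE;
  by apply: val_inj => /=.
Qed.

Lemma V1_ext x y : bd ord0 x = bd ord0 y -> bd ord_max x = bd ord_max y ->
  edge1 x = edge1 y -> x = y.
Proof.
move=> h0 h1 h; apply: DK_ext => k s sI.
have := mono_inj_leq sI; case: k s sI => [|[|k]] s sI // _; last first.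
  have -> : s = mid 1 by apply: mono_ext => i; rewrite (mono_inj_id sI) midE.
  exact: h.
have sE (i : 'I_2) : s ord0 = fintype.lift i ord0 -> s = mcomp (coface i) (mid 0).
  by move=> e; apply: mono_ext => j; rewrite mcompE cofaceE midE ord1.
case: (unliftP ord0 (s ord0)) => [j e|e].
  by rewrite (sE ord0) //; rewrite e; congr fintype.lift; rewrite ord1.
by rewrite (sE ord_max) // e; apply: val_inj.
Qed.

Lemma simplex_of_injective n (x : DKpre P n) :
  (forall k (s : mono k n), ~ injective s -> x k s = 0) ->
  (forall k (s : mono k.+1 n), injective s -> d k (x k.+1 s) =
     \sum_(i < k.+2) x k (mcomp s (coface i)) *~ (-1) ^+ i) ->
  simplexb x.
Proof.
move=> x0 xd; apply/asboolP; split=> // k s.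
case: (pselect (injective s)) => [|sN]; first exact: xd.
by rewrite x0 // raddf0 alt_sum_degenerate // => t; apply: x0.
Qed.

Lemma mid_comp n k (s : mono k n) : mcomp (mid n) s = s.
Proof. by apply: mono_ext => j; rewrite mcompE midE. Qed.

Lemma mono_inj_mid n (s : mono n n) : injective s -> s = mid n.
Proof. by move=> sI; apply: mono_ext => i; rewrite (mono_inj_id sI) midE. Qed.

Lemma mid_inj n : injective (mid n).
Proof. by move=> i j; rewrite !midE. Qed.

Lemma mono1_ninj n (s : mono 1 n) : ~ injective s -> s ord0 = s ord_max.
Proof.
have E (i : 'I_2) : i = ord0 \/ i = ord_max.
  by case: i => [[|[|i]] Hi] //; [left|right]; apply: val_inj.
move=> sN; apply: contrapT => h; apply: sN => i j.
by case: (E i) (E j) => [] -> [] -> // /esym.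
Qed.

(* The element of [K(P)_n] supported on the top cell, with all faces but the
   zeroth one equal to zero. *)
Definition E1_pre (c : P 1%N) : DKpre P 1 := fun k =>
  match k return mono k 1 -> P k with
  | 0%N => fun s => if s ord0 == 1%N :> nat then d 0%N c else 0
  | 1%N => fun s => if `[< injective s >] then c else 0
  | _ => fun=> 0
  end.

Lemma E1_subproof c : simplexb (E1_pre c).
Proof.
apply: simplex_of_injective => [[|[|k]] s //= sN|k s sI].
- by case: sN => i j _; rewrite !ord1.
- by case: asboolP.
have k0 : k = 0%N by have := mono_inj_leq sI; lia.
subst k; rewrite (mono_inj_mid sI) 2!big_ord_recr big_ord0 !mid_comp /=.
by rewrite ?cofaceE ?ffunE /= asboolT ?mulr1z ?mul0rz ?add0r ?addr0 //; apply: mid_inj.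
Qed.

Definition E1 (c : P 1%N) : DK P 1 := exist _ (E1_pre c) (E1_subproof c).

Lemma edge1_E1 c : edge1 (E1 c) = c.
Proof. by rewrite /edge1 /= asboolT //; apply: mid_inj. Qed.

Lemma bd1_E1 c : bd ord_max (E1 c) = 0.
Proof. by rewrite /bd /vtx0 /= /DKpre_act /= !ffunE. Qed.

Lemma bd0_E1 c : bd ord0 (E1 c) = d 0%N c.
Proof. by rewrite /bd /vtx0 /= /DKpre_act /= !ffunE. Qed.

Definition E2_pre (c : P 2%N) : DKpre P 2 := fun k =>
  match k return mono k 2 -> P k with
  | 0%N => fun=> 0
  | 1%N => fun s => if (s ord0 == 1%N :> nat) && (s ord_max == 2%N :> nat)
                    then d 1%N c else 0
  | 2%N => fun s => if `[< injective s >] then c else 0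
  | _ => fun=> 0
  end.

Lemma E2_subproof c : simplexb (E2_pre c).
Proof.
apply: simplex_of_injective => [[|[|[|k]]] s //= sN|k s sI].
- by rewrite (mono1_ninj sN); case: eqP => //= ->.
- by case: asboolP.
have := mono_inj_leq sI; case: k s sI => [|[|k]] s sI // _.
  rewrite big1 => [|i _]; last by rewrite mul0rz.
  by rewrite /=; case: ifP => // _; rewrite ?raddf0 // cdiffK.
rewrite (mono_inj_mid sI) 3!big_ord_recr big_ord0 !mid_comp /=.
rewrite asboolT; last exact: mid_inj.
by rewrite ?cofaceE ?ffunE /= ?mulr1z ?mul0rz ?add0r ?addr0.
Qed.

Definition E2 (c : P 2%N) : DK P 2 := exist _ (E2_pre c) (E2_subproof c).

Lemma edge_E2 (i : 'I_3) c :
  edge1 (face (DK P) i (E2 c)) = if i == ord0 then d 1%N c else 0.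
Proof.
rewrite /edge1 /= /DKpre_act /= !ffunE.
by case: i => [[|[|[|i]]] Hi].
Qed.

Lemma bd_E2 (i : 'I_3) j c : bd j (face (DK P) i (E2 c)) = 0.
Proof. by []. Qed.

Lemma E1_0 : E1 0 = 0.
Proof.
by apply: V1_ext; rewrite ?bd0_E1 ?bd1_E1 ?edge1_E1 ?raddf0 //= /bd /vtx0 /= /DKpre_act /= !ffunE.
Qed.

Lemma face_E2 (i : 'I_3) c :
  face (DK P) i (E2 c) = if i == ord0 then E1 (d 1%N c) else 0.
Proof.
have -> : (if i == ord0 then E1 (d 1%N c) else 0) =
   E1 (if i == ord0 then d 1%N c else 0) by case: eqP => //; rewrite E1_0.
apply: V1_ext; rewrite ?bd_E2 ?bd0_E1 ?bd1_E1 ?edge1_E1 ?edge_E2 //.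
by case: eqP; rewrite ?cdiffK ?raddf0.
Qed.
End LowDegrees.

(** * The first derived functor of a symmetric power *)

Section HomotopyOfSP.
Variables (m : nat) (A : zmodType) (P : resolution A).
Notation X := (DK P).
Notation aug := (res_aug P).
Notation SPX := (sapply (SP m) X).

Lemma aug_bd x : aug (bd ord_max x) = aug (bd ord0 x).
Proof.
apply/eqP; rewrite eq_sym -subr_eq0 -raddfB; apply/eqP/res_exact0.
by exists (edge1 x); rewrite bd_edge.
Qed.

Definition ebd (x : X 1%N) : epair aug := ep (aug_bd x).

Lemma ebdB : zmod_morphism ebd.
Proof. by move=> x y; apply: ep_ext; rewrite /src /tgt /= raddfB. Qed.
HB.instance Definition _ := GRing.isZmodMorphism.Build (X 1%N) (epair aug) ebd ebdB.

Definition mcst : mono 1 0 := @mkmono 1 0 (fun=> ord0) (fun _ _ _ => isT).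

Lemma bd_mcst i a : bd i (sact X mcst (V0 a)) = a.
Proof.
rewrite /bd -[RHS](vtx0_V0 (P := P)); congr vtx0.
rewrite -[LHS]/((sact X (coface i) \o sact X mcst) (V0 a)).
by rewrite -(sact_comp (s := X)) (sact_id (s := X)) // => j; rewrite [LHS]ord1 [RHS]ord1.
Qed.

Lemma ebd_surj e : exists x, ebd x = e.
Proof.
have [c dc] : exists c, cdiff P 0 c = tgt e - src e.
  by apply/res_exact0; rewrite raddfB epairP subrr.
exists (sact X mcst (V0 (src e)) + E1 c); apply: ep_ext;
  rewrite /src /tgt /= raddfD /= bd_mcst ?bd1_E1 ?bd0_E1 ?addr0 //.
by rewrite dc addrC subrK.
Qed.

Definition elift e := projT1 (cid (ebd_surj e)).

Lemma eliftK e : ebd (elift e) = e.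
Proof. exact: projT2 (cid (ebd_surj e)). Qed.

(** An edge with zero endpoints has zero differential, so by exactness at P_1 it bounds some [c];
    [E2 c] is then a filler whose other two faces vanish. *)
Lemma ebd_ker x : ebd x = 0 -> exists c, x = face X ord0 (E2 c).
Proof.
move=> x0; have b1 : bd ord_max x = 0 by rewrite -[LHS]/(src (ebd x)) x0.
have b0 : bd ord0 x = 0 by rewrite -[LHS]/(tgt (ebd x)) x0.
have [c dc] : exists c, cdiff P 1 c = edge1 x.
  by apply: res_exact; rewrite bd_edge b0 b1 subrr.
exists c; rewrite face_E2 /=; apply: V1_ext; rewrite ?edge1_E1 //.
- by rewrite bd0_E1 dc bd_edge b0 b1 subrr.
- by rewrite bd1_E1.
Qed.

Definition lam : {additive SP_obj m (X 1%N) -> Tr aug} :=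
  SP_lift m (gl _ \o ebd : {additive X 1%N -> Tr aug}).

Lemma lam_sps s : size s = m -> lam (sps m s) = gw _ (map ebd s).
Proof. by move=> sm; rewrite /lam SP_lift_sps // gwE big_map. Qed.

Definition SP_vtx0 : {additive SP_obj m (X 0%N) -> symalg (P 0%N)} :=
  SP_lift m (gl _ \o @vtx0 P : {additive X 0%N -> symalg (P 0%N)}).

(** Lets [srcT] and [tgtT] detect vanishing faces: K(P)_0 is P_0, and SP^m of it is a summand of the
    symmetric algebra. *)
Lemma SP_vtx0_inj : injective SP_vtx0.
Proof.
have E x : SP_vtx0 x = SP_Sym m _ (SP_map m (@vtx0 P) x).
  pose S := symalg (P 0%N).
  exact: (@SP_lift_comp m _ _ S S (@vtx0 P) (gl _)
    (gl _ \o @vtx0 P : {additive X 0%N -> S}) idfun (fun=> erefl) x).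
move=> x y; rewrite !E => /(congr1 (@Sym_SP m _)); rewrite !SP_SymK.
move=> /(congr1 (SP_map m (@V0 P))).
have K z : SP_map m (@V0 P) (SP_map m (@vtx0 P) z) = z.
  apply: esym; rewrite -[LHS](SP_map_id (f := idfun)) //.
  by apply: SP_map_comp => w /=; rewrite V0_vtx0.
by rewrite !K.
Qed.

Lemma src_lam z : srcT (lam z) = SP_vtx0 (face SPX ord_max z).
Proof. by apply: SP_lift_comp => x /=; rewrite srcT1. Qed.

Lemma tgt_lam z : tgtT (lam z) = SP_vtx0 (face SPX ord0 z).
Proof. by apply: SP_lift_comp => x /=; rewrite tgtT1. Qed.

Lemma bd_face (i i' : 'I_2) (j j' : 'I_3) (v : X 2%N) :
  fintype.lift j (fintype.lift i ord0) = fintype.lift j' (fintype.lift i' ord0) :> 'I_3 ->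
  bd i (face X j v) = bd i' (face X j' v).
Proof.
move=> h; rewrite /bd; congr vtx0.
rewrite -[LHS]/((sact X (coface i) \o sact X (coface j)) v).
rewrite -[RHS]/((sact X (coface i') \o sact X (coface j')) v) -!(sact_comp (s := X)).
by congr (sact X _ v); apply: mono_ext => k; rewrite !mcompE !cofaceE ord1.
Qed.

Let ff i : {additive X 2%N -> Tr aug} := gl _ \o ebd \o face X i.
Notation f_ i := (symalg_hom (ff i)).

Lemma lam_face (i : 'I_3) y : lam (face SPX i y) = f_ i (SP_Sym m _ y).
Proof. by apply: esym; apply: SP_lift_comp => x /=; rewrite symalg_hom1. Qed.

(** The face d_1 of a 2-simplex is the composite of d_2 and d_0, and [comp_ext] carries this over to
    products. If d_1 y and d_2 y vanish, the composition formula leaves lam (d_0 y) = 0. *)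
Lemma lam_boundary z : is_boundary (X := SPX) (p := 1) z -> lam z = 0.
Proof.
case=> y [y0 <-]; rewrite lam_face.
have E := @comp_ext _ _ aug _ _ (f_ ord_max) (f_ ord0) (f_ (inord 1)) _ _ (SP_Sym m _ y).
have I1 : inord 1 = Ordinal (isT : (1 < 3)%N) by apply: val_inj; rewrite /= inordK.
have Y1 : face SPX (inord 1) y = 0.
  by apply: y0; apply/eqP => /(congr1 val); rewrite /= inordK.
have Y2 : face SPX ord_max y = 0 by apply: y0.
move: E => /=; rewrite -!lam_face Y1 Y2 !raddf0.
rewrite add0r addr0 => <- // v.
  rewrite !symalg_hom1 /= tgtT1 srcT1; congr gl; rewrite /src /tgt /=.
  by apply: bd_face; apply: val_inj.
rewrite !symalg_hom1 /= tgtT1 (idT1 aug) -raddfD -raddfB; congr gl.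
have e : bd ord_max (face X ord0 v) = bd ord0 (face X ord_max v).
  by apply: bd_face; apply: val_inj.
apply: ep_ext; rewrite /src /tgt /= I1.
  by rewrite e addrK; apply: bd_face; apply: val_inj.
by rewrite addrC addKr; apply: bd_face; apply: val_inj.
Qed.

Definition bnd (z : SP_obj m (X 1%N)) : Prop := is_boundary (X := SPX) (p := 1) z.

Lemma bnd_span z : zspan bnd z -> bnd z.
Proof.
apply: zspan_min => //.
  by exists 0; split=> [i _|]; rewrite raddf0.
move=> x y [x' [x0 <-]] [y' [y0 <-]]; exists (x' - y'); split=> [i i0|].
  by rewrite raddfB x0 // y0 // subrr.
by rewrite raddfB.
Qed.

Lemma face_sps i s : face SPX i (sps m s : SPX 2%N) = sps m (map (face X i) s).
Proof. exact: SP_map_sps. Qed.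

(** [dg0] and [dg1] are the degeneracies s_0 and s_1, that is 0,1,2 -> 0,0,1 and 0,1,2 -> 0,1,1. *)
Definition dg0 : mono 2 1 := @mkmono 2 1 (fun j => inord j.-1)
  ltac:(move=> i j ij; have hi := ltn_ord i; have hj := ltn_ord j; rewrite !inordK; lia).

Definition dg1 : mono 2 1 := @mkmono 2 1 (fun j => inord (minn j 1))
  ltac:(move=> i j ij; have hi := ltn_ord i; have hj := ltn_ord j; rewrite !inordK; lia).

Lemma face_sact (i : 'I_3) (g : mono 2 1) x :
  face X i (sact X g x) = sact X (mcomp g (coface i)) x.
Proof. by rewrite [RHS](sact_comp (s := X)). Qed.

Lemma face_dg0 (i : 'I_3) x : i != ord_max -> face X i (sact X dg0 x) = x.
Proof.
move=> i2; rewrite face_sact (sact_id (s := X)) // => j.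
apply: val_inj; rewrite mcompE cofaceE !ffunE /=.
have hj := ltn_ord j; have hi := ltn_ord i; rewrite inordK /bump; last first.
  by case: leqP => /=; lia.
move: i2; rewrite -val_eqE /=; case: leqP => /=; lia.
Qed.

Lemma face_dg1 (i : 'I_3) x : i != ord0 -> face X i (sact X dg1 x) = x.
Proof.
move=> i2; rewrite face_sact (sact_id (s := X)) // => j.
apply: val_inj; rewrite mcompE cofaceE !ffunE /=.
have hj := ltn_ord j; have hi := ltn_ord i; rewrite inordK /bump; last first.
  by case: leqP => /=; lia.
move: i2; rewrite -val_eqE /=; case: leqP => /=; lia.
Qed.

Lemma face_dg_end (i : 'I_3) (k : 'I_2) g x :
  (forall j : 'I_2, mcomp g (coface i) j = fintype.lift k ord0) ->
  face X k x = 0 -> face X i (sact X g x) = 0.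
Proof.
move=> h x0; rewrite face_sact.
have -> : mcomp g (coface i) = mcomp (coface k) (@mkmono 1 0 (fun=> ord0) (fun _ _ _ => isT)).
  by apply: mono_ext => j; rewrite h mcompE cofaceE ffunE.
by rewrite (sact_comp (s := X)) /= -[sact X (coface k) x]/(face X k x) x0 raddf0.
Qed.

(** Multiply the filler [E2 c] by s_0 of the other factors: d_0 s_0 is the identity, and the faces
    d_1 and d_2 contain a zero factor. *)
Lemma bnd_E2 c s t : bnd (sps m (s ++ face X ord0 (E2 c) :: t)).
Proof.
exists (sps m (map (sact X dg0) s ++ E2 c :: map (sact X dg0) t)); split=> [i i0|].
  by rewrite face_sps map_cat /= face_E2 (negPf i0) sps0.
rewrite face_sps map_cat /= -!map_comp; congr (sps m (_ ++ _ :: _));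
  by apply: map_id_in => x _ /=; rewrite face_dg0.
Qed.

(** The filler is the product of s_0 u, s_0 v - s_1 v and s_0 of the rest. Its d_1 vanishes since
    d_1 s_0 = d_1 s_1, its d_2 since d_2 s_0 u is constant at the source 0 of u, and d_0 s_1 v is
    constant at the target 0 of v, so d_0 returns the given product. *)
Lemma bnd_null u v s t : comp_null (ebd u) (ebd v) -> bnd (sps m (s ++ [:: u, v & t])).
Proof.
case=> su tv; have u1 : face X ord_max u = 0.
  by apply: vtx0_inj; rewrite -[LHS]/(src (ebd u)) su.
have v0 : face X ord0 v = 0.
  by apply: vtx0_inj; rewrite -[LHS]/(tgt (ebd v)) tv.
exists (sps m (map (sact X dg0) s ++
   [:: sact X dg0 u, sact X dg0 v - sact X dg1 v & map (sact X dg0) t])).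
split=> [i i0|]; rewrite face_sps map_cat /=; last first.
  rewrite -!map_comp raddfB /= !face_dg0 //.
  rewrite (@face_dg_end ord0 ord0 dg1) ?subr0 //; last first.
    by move=> j; apply: val_inj; rewrite mcompE cofaceE ffunE /= inordK; have hj := ltn_ord j; rewrite /bump /=; lia.
  congr (sps m (_ ++ [:: _, _ & _]));
  by apply: map_id_in => x _ /=; rewrite face_dg0.
have [->|i2] := eqVneq i ord_max.
  rewrite (@face_dg_end ord_max ord_max dg0) ?sps0 // => j.
  by apply: val_inj; rewrite mcompE cofaceE ffunE /= inordK; have hj := ltn_ord j; rewrite /bump /=; lia.
rewrite raddfB /= [X in _ - X]face_dg1 // [X in X - _]face_dg0 // subrr.
by rewrite -cat_rcons sps0.
Qed.

(** [elift] is a bare choice of preimages and is not additive; modulo [bnd] the choice is irrelevant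
    by [sps_ebd], whence the quotient as codomain. *)
Definition back_word (s : seq (epair aug)) : quotz bnd := zpi bnd (sps m (map elift s)).

Lemma zpi_bnd z : bnd z -> zpi bnd z = 0.
Proof. by move=> bz; apply/zpi_eq0/zspan_gen. Qed.

Lemma sps_ebd s t x y : ebd x = ebd y ->
  zpi bnd (sps m (s ++ x :: t)) = zpi bnd (sps m (s ++ y :: t)).
Proof.
move=> xy; apply/eqP; rewrite -subr_eq0 -raddfB -sps_subst; apply/eqP/zpi_bnd.
have [c ->] : exists c, x - y = face X ord0 (E2 c).
  by apply: ebd_ker; rewrite raddfB /= xy subrr.
exact: bnd_E2.
Qed.

Lemma back_wordD s t x y :
  back_word (s ++ (x + y) :: t) = back_word (s ++ x :: t) + back_word (s ++ y :: t).
Proof.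
rewrite /back_word !map_cat /= -raddfD -spsD; apply: sps_ebd.
by rewrite [RHS]raddfD /= !eliftK.
Qed.

Lemma back_word_swap s t x y :
  back_word (s ++ [:: x, y & t]) = back_word (s ++ [:: y, x & t]).
Proof. by rewrite /back_word !map_cat /= sps_swap. Qed.

Lemma back_word_null s t x y : comp_null x y -> back_word (s ++ [:: x, y & t]) = 0.
Proof.
by move=> h; rewrite /back_word map_cat; apply/zpi_bnd/bnd_null; rewrite !eliftK.
Qed.

Definition back : {additive Tr aug -> quotz bnd} :=
  galg_lift back_wordD back_word_swap back_word_null.

Lemma backE s : back (gw _ s) = back_word s.
Proof. exact: galg_liftE. Qed.

Lemma back_lam z : back (lam z) = zpi bnd z.
Proof.
apply: (SP_ext (f := back \o lam) (g := zpi bnd)) => u.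
rewrite -spsE; set s := [seq _ | _ <- _].
have sm : size s = m by rewrite size_map size_enum_ord.
rewrite [LHS](congr1 back (lam_sps sm)) backE /back_word -map_comp.
suff H t : zpi bnd (sps m (t ++ map (elift \o ebd) s)) = zpi bnd (sps m (t ++ s)) by exact: (H [::]).
elim: s {sm} t => //= x s IH t; rewrite -cat_rcons IH cat_rcons.
by apply: sps_ebd; rewrite eliftK.
Qed.

(** [back] composed with [lam] is the projection modulo boundaries, so the kernel of [lam] contains
    nothing else. *)
Lemma lam_eq0 z : lam z = 0 -> bnd z.
Proof.
move=> z0; apply: bnd_span; apply/zpi_eq0.
by rewrite -back_lam z0 raddf0.
Qed.

Lemma lam_ghom x : ghom m x -> exists z, lam z = x.
Proof.
elim=> [_ [s sm ->]||y z _ [y' <-] _ [z' <-]].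
- exists (sps m (map elift s)); rewrite lam_sps ?size_map // -map_comp.
  by rewrite (eq_map (g := id)) ?map_id // => e /=; apply: eliftK.
- by exists 0; rewrite raddf0.
- by exists (y' - z'); rewrite raddfB.
Qed.

Lemma ghom_lam z : ghom m (lam z).
Proof.
elim/zpi_ind: z; apply: freeg_gen_ind => [|x y hx hy|u].
- by rewrite !raddf0; apply: zspan0.
- by rewrite !raddfB; apply: zspanB.
have sz : size [seq u j | j <- enum 'I_m] = m by rewrite size_map size_enum_ord.
rewrite -[zpi _ _]/(sprod u) -spsE (lam_sps sz).
by apply: zspan_gen; exists (map ebd [seq u j | j <- enum 'I_m]); rewrite // size_map.
Qed.

Notation H1 := (homotopy SPX 1).

Lemma lam_cycles_subproof (z : cycles SPX 1) : bnd (val z) -> (lam \o val) z = 0.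
Proof. exact: lam_boundary. Qed.

Definition lamH : {additive H1 -> Tr aug} := zfactor lam_cycles_subproof.

Lemma lamHE z : lamH (zpi _ z) = lam (val z).
Proof. exact: zfactorE. Qed.

Lemma lamH_inj : injective lamH.
Proof.
move=> x y /eqP; rewrite -subr_eq0 -raddfB => /eqP xy; apply/eqP.
rewrite -subr_eq0; apply/eqP; move: (x - y) xy; elim/zpi_ind => z.
rewrite lamHE => /lam_eq0 bz; apply/zpi_eq0; exact: zspan_gen.
Qed.

Lemma Kset_lamH x : Kset m (lamH x).
Proof.
elim/zpi_ind: x => z; rewrite lamHE; have /asboolP cz := valP z.
split; first exact: ghom_lam.
  by rewrite src_lam [X in SP_vtx0 X]cz raddf0.
by rewrite tgt_lam [X in SP_vtx0 X]cz raddf0.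
Qed.

Lemma lamH_Kset x : Kset m x -> exists z, lamH z = x.
Proof.
case=> /lam_ghom [z <-] zs zt.
have cz : cycleb (X := SPX) (p := 1) z.
  apply/asboolP => i; apply: SP_vtx0_inj; rewrite raddf0.
  have [->|->] : i = ord0 \/ i = ord_max.
  - by case: i => [[|[|i]] Hi] //; [left|right]; apply: val_inj.
  - by rewrite -tgt_lam.
  - by rewrite -src_lam.
by exists (zpi _ (exist _ z cz : cycles SPX 1)); rewrite lamHE.
Qed.
End HomotopyOfSP.

Lemma lamH_natural m (A B : zmodType) (P : resolution A) (Q : resolution B)
    (f : {additive A -> B}) (phi : resolution_map f P Q)
    (hphi : lies_over (res_aug P) (res_aug Q) f (phi 0%N)) x :
  lamH m Q (derived_functor_map (SP m) 1 phi x) = Tmap hphi (lamH m P x).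
Proof.
elim/zpi_ind: x => z; rewrite lamHE.
have E : derived_functor_map (SP m) 1 phi (zpi _ z) =
    zpi _ (cycles_map (sapply_map (SP m) (DKmap phi)) z) by exact: zfactorE.
rewrite E lamHE; set y := val z; rewrite -[LHS]/(lam m Q (SP_map m (DKmap phi 1%N) y)).
apply: esym; apply: SP_lift_comp => x /=; rewrite Tmap1; congr gl.
by apply: ep_ext.
Qed.

(** * Commutator calculus *)

Local Open Scope group_scope.

Section CommutatorIdentities.
Variable G : groupType.
Implicit Types x y z : G.

Lemma commMgJ x y z : [~ x * y, z] = [~ x, z] ^ y * [~ y, z].
Proof. by rewrite /commg /conjg !invgM !mulgA !mulgK ?mulgVK. Qed.

Lemma commgMJ x y z : [~ x, y * z] = [~ x, z] * [~ x, y] ^ z.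
Proof. by rewrite /commg /conjg !invgM !mulgA !mulgK ?mulgVK. Qed.

Lemma commgVJ x y : [~ x, y]^-1 = [~ y, x].
Proof. by rewrite /commg /conjg !invgM !invgK !mulgA. Qed.

Lemma hall_witt x y z :
  [~ [~ x, y^-1], z] ^ y * [~ [~ y, z^-1], x] ^ z * [~ [~ z, x^-1], y] ^ x = 1.
Proof.
rewrite /commg /conjg !invgM !invgK !mulgA.
by rewrite !(mulgK, mulgVK, mulVg, mulgV, mul1g, mulg1).
Qed.

Lemma nsgR_sub (A B : nsubgroup G) x : nsgR A B x -> B x.
Proof.
elim=> {x} [_ [a [b [_ Bb ->]]]||x y _ Bx _ By|x _ Bx].
- by rewrite commgEr; apply: nsgM => //; apply/nsgJ/nsgV.
- exact: nsg1.
- exact: nsgM.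
- exact: nsgV.
Qed.

Lemma nsgR_comm (A B : nsubgroup G) x y : A x -> B y -> nsgR A B [~ x, y].
Proof. by move=> Ax By; apply: gspan_gen; exists x, y. Qed.

Lemma nsgR_min (A B C : nsubgroup G) :
  (forall x y, A x -> B y -> C [~ x, y]) -> forall x, nsgR A B x -> C x.
Proof.
move=> h x; elim=> {x} [_ [a [b [Aa Bb ->]]]||x y _ Bx _ By|x _ Bx].
- exact: h.
- exact: nsg1.
- exact: nsgM.
- exact: nsgV.
Qed.

Notation g k := (gamma_ k (nsgT G)).

Lemma gammaS_sub k x : g k.+1 x -> g k x.
Proof. by case: k => // k; apply: nsgR_sub. Qed.

Lemma gamma_le i j x : (i <= j)%N -> g j x -> g i x.
Proof. by move=> /subnK <-; elim: (j - i)%N => // k IH /gammaS_sub/IH. Qed.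

Lemma gamma_comm1 k x y : g k.+1 y -> g k.+2 [~ x, y].
Proof. exact: nsgR_comm. Qed.

Lemma comm_gspan_l (A C : nsubgroup G) (S : G -> Prop) y :
  (forall x, S x -> C [~ x, y]) -> forall x, gspan S x -> C [~ x, y].
Proof.
move=> h x; elim=> {x} [x /h //||x x' _ IHx _ IHx'|x _ IHx].
- by rewrite comm1g; apply: nsg1.
- by rewrite commMgJ; apply: nsgM => //; apply: nsgJ.
have := commMgJ x x^-1 y; rewrite mulgV comm1g => /esym e.
have -> : [~ x^-1, y] = ([~ x, y] ^ x^-1)^-1 by apply: (mulgI ([~ x, y] ^ x^-1)); rewrite e mulgV.
exact/nsgV/nsgJ.
Qed.

Lemma nsgJ_inv (C : nsubgroup G) x y : C (x ^ y) -> C x.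
Proof. by move=> h; rewrite -(conjgK y x); apply: nsgJ. Qed.

(** Induction on [i]. For x = [a, b] the Hall-Witt identity expresses a conjugate of [[a, b], y] by
    commutators [[y, a^-1], b^-1] and [[b^-1, y^-1], a], in which the entry from the lower central
    series has smaller weight. *)
Lemma gamma_comm i j x y : g i.+1 x -> g j.+1 y -> g (i + j).+2 [~ x, y].
Proof.
elim: i j x y => [|i IH] j x y gx gy; first exact: gamma_comm1.
apply: (@comm_gspan_l (nsgT G) _ _ y _ x gx) => {gx} _ [a [b [_ gb ->]]].
have := hall_witt a b^-1 y; rewrite invgK.
set u := _ ^ _; set v := _ ^ _; set w := _ ^ _ => uvw.
apply: (@nsgJ_inv _ _ b^-1); rewrite -/u.
have -> : u = w^-1 * v^-1 by rewrite -invgM; apply: (mulIg (v * w)); rewrite mulVg mulgA.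
apply: nsgM; apply/nsgV/nsgJ.
  rewrite -commgVJ; apply/nsgV.
  have -> : (i.+1 + j).+2 = (i + j.+1).+2 by rewrite addSnnS.
  have gya : g j.+2 [~ y, a^-1] by rewrite -commgVJ; apply/nsgV/gamma_comm1.
  by apply: IH => //; apply: nsgV.
rewrite -commgVJ; apply/nsgV/gamma_comm1.
by apply: IH; [apply: nsgV|apply: nsgV].
Qed.
End CommutatorIdentities.

(** * Abelian subquotients of a group, written additively *)

Section ZQ.
Variable G : groupType.

Section AbLift.
Variables (V : zmodType) (phi : G -> V).
Hypothesis phiM : forall x y, phi (x * y) = (phi x + phi y)%R.

Lemma ab_lift1 : phi 1 = 0%R.
Proof. by apply: (addrI (phi 1)); rewrite -phiM mulg1 addr0. Qed.

Lemma ab_liftV x : phi x^-1 = (- phi x)%R.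
Proof. by apply/eqP; rewrite -addr_eq0 -phiM mulVg ab_lift1. Qed.

Lemma ab_lift_derived x : derived (nsgT G) x -> phi x = 0%R.
Proof.
elim=> {x} [_ [a [b [_ _ ->]]]||x y _ hx _ hy|x _ hx].
- by rewrite /commg /conjg !phiM !ab_liftV [(phi a + _)%R]addrC addKr addNr.
- exact: ab_lift1.
- by rewrite phiM hx hy addr0.
- by rewrite ab_liftV hx oppr0.
Qed.

Definition ab_lift_fun (q : ab G) : V := phi (repr q).

Lemma ab_lift_funE x : ab_lift_fun (ab_pi x) = phi x.
Proof.
apply/eqP; rewrite -subr_eq0 -opprB oppr_eq0 addrC -ab_liftV -phiM; apply/eqP.
rewrite -[LHS]opprK -ab_liftV invgM invgK.
rewrite (ab_lift_derived (repr_qpi (derived (nsgT G)) x)) oppr0 //.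
Qed.

Lemma ab_lift_funB : zmod_morphism ab_lift_fun.
Proof.
elim/ab_pi_ind=> x; elim/ab_pi_ind=> y.
have -> : (ab_pi x - ab_pi y)%R = ab_pi (x * y^-1) :> ab G.
  by rewrite ab_piM; congr (_ + _)%R; apply: qinvE.
by rewrite !ab_lift_funE phiM ab_liftV.
Qed.

HB.instance Definition _ := GRing.isZmodMorphism.Build (ab G) V ab_lift_fun ab_lift_funB.

Definition ab_lift : {additive ab G -> V} := ab_lift_fun.

Lemma ab_liftE x : ab_lift (ab_pi x) = phi x. Proof. exact: ab_lift_funE. Qed.
End AbLift.

Lemma ab_pi_eq0 (x : G) : ab_pi x = 0%R -> derived (nsgT G) x.
Proof.
by move/esym/qpiP; rewrite invg1 mul1g.
Qed.

Lemma ab_piV (x : G) : ab_pi x^-1 = (- ab_pi x)%R.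
Proof. exact/esym/qinvE. Qed.
End ZQ.

Section ZQuotient.
Variables (G : groupType) (N M : nsubgroup G).

Definition zq_rel (v : ab (subg N)) : Prop :=
  exists2 h : subg N, M (subg_val h) & v = ab_pi h.

(* [N / M] as an additive group, when [M] contains the commutators of [N]. *)
Definition zq : zmodType := quotz zq_rel.

Lemma subg_valP (x : subg N) : N (subg_val x).
Proof. exact/asboolP/(valP x). Qed.

Definition to_subg w (Nw : N w) : subg N := exist _ w (asboolT Nw : nsgb N w).

(* Junk value 0 outside N. *)
Definition cl (w : G) : zq :=
  if pselect (N w) is left Nw then zpi zq_rel (ab_pi (to_subg Nw)) else 0%R.

Lemma clE w (Nw : N w) : cl w = zpi zq_rel (ab_pi (to_subg Nw)).
Proof.
rewrite /cl; case: pselect => // Nw'; congr (zpi _ (ab_pi _)); exact: val_inj.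
Qed.

Lemma clM x y : N x -> N y -> cl (x * y) = (cl x + cl y)%R.
Proof.
move=> Nx Ny; rewrite (clE Nx) (clE Ny) (clE (nsgM Nx Ny)) -raddfD -ab_piM.
by congr (zpi _ (ab_pi _)); apply: val_inj.
Qed.

Lemma cl0 x : M x -> cl x = 0%R.
Proof.
move=> Mx; rewrite /cl; case: pselect => // Nx.
by apply/zpi_eq0/zspan_gen; exists (to_subg Nx).
Qed.

Lemma cl1 : cl 1 = 0%R. Proof. exact/cl0/nsg1. Qed.

Lemma clV x : N x -> cl x^-1 = (- cl x)%R.
Proof.
move=> Nx; apply/eqP; rewrite -addr_eq0 -clM ?mulVg ?cl1 //; exact: nsgV.
Qed.

Lemma zq_ind (P : zq -> Prop) : (forall x, N x -> P (cl x)) -> forall q, P q.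
Proof.
move=> h; elim/zpi_ind; elim/ab_pi_ind => x.
have Nx := subg_valP x.
by have := h _ Nx; rewrite (clE Nx); congr (P (zpi _ (ab_pi _))); apply: val_inj.
Qed.

Lemma cl_eq0 x : (forall a b, N a -> N b -> M [~ a, b]) -> N x -> cl x = 0%R -> M x.
Proof.
move=> NM Nx; rewrite (clE Nx) => /zpi_eq0 h.
have der y : derived (nsgT (subg N)) y -> M (subg_val y).
  elim=> {y} [_ [a [b [_ _ ->]]]||y z _ hy _ hz|y _ hy].
  - by rewrite morphR; apply: NM; apply: subg_valP.
  - by rewrite morph1; apply: nsg1.
  - by rewrite gmulfM; apply: nsgM.
  - by rewrite morphV; apply: nsgV.
suff [y My e] : exists2 y : subg N, M (subg_val y) & ab_pi (to_subg Nx) = ab_pi y.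
  have /ab_pi_eq0/der : (ab_pi (to_subg Nx * y^-1) = 0)%R by rewrite ab_piM ab_piV e subrr.
  by rewrite gmulfM morphV => h'; have := nsgM h' My; rewrite mulgVK.
elim: h => // [|u v _ [y My ->] _ [z Mz ->]].
  by exists 1; [rewrite morph1; apply: nsg1|].
by exists (y * z^-1); rewrite ?ab_piM ?ab_piV // gmulfM morphV; apply/nsgM/nsgV.
Qed.

Section Lift.
Variables (V : zmodType) (phi : G -> V).
Hypothesis phiM : forall x y, N x -> N y -> phi (x * y) = (phi x + phi y)%R.
Hypothesis phi0 : forall x, N x -> M x -> phi x = 0%R.

Lemma zq_lift_subproof1 (x y : subg N) :
  phi (subg_val (x * y)) = (phi (subg_val x) + phi (subg_val y))%R.
Proof. by rewrite gmulfM phiM //; apply: subg_valP. Qed.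

Lemma zq_lift_subproof v : zq_rel v -> ab_lift zq_lift_subproof1 v = 0%R.
Proof.
by case=> x Mx ->; rewrite ab_liftE phi0 //; apply: subg_valP.
Qed.

Definition zq_lift : {additive zq -> V} := zfactor zq_lift_subproof.

Lemma zq_liftE x : N x -> zq_lift (cl x) = phi x.
Proof. by move=> Nx; rewrite (clE Nx) [LHS]zfactorE [LHS]ab_liftE. Qed.
End Lift.
End ZQuotient.

(** * Brackets on lower central quotients *)

Section GammaBilinear.
Variable G : groupType.
Notation g k := (gamma_ k (nsgT G)).
Variables (i j d : nat) (M : nsubgroup G).
Hypothesis hd : d = (i + j).+2.
Hypothesis hM : forall x, g d.+1 x -> M x.
Local Notation cld := (cl (g d) M).

Let gC x y : g i.+1 x -> g j.+1 y -> g d [~ x, y].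
Proof. by rewrite hd; apply: gamma_comm. Qed.

Lemma cl_conj x z : g d x -> cld (x ^ z) = cld x.
Proof.
move=> gx; have -> : x ^ z = x * [~ x, z] by rewrite commgEl mulVKg.
have gxz : g d.+1 [~ x, z].
  by rewrite hd in gx *; rewrite -commgVJ; apply/nsgV/gamma_comm1.
by rewrite clM // ?(cl0 _ (hM gxz)) ?addr0 //; apply: gammaS_sub.
Qed.

Lemma cl_commMl x x' y : g i.+1 x -> g i.+1 x' -> g j.+1 y ->
  cld [~ x * x', y] = (cld [~ x, y] + cld [~ x', y])%R.
Proof.
by move=> gx gx' gy; rewrite commMgJ clM ?cl_conj //; try exact: gC; apply/nsgJ/gC.
Qed.

Lemma cl_commMr x y y' : g i.+1 x -> g j.+1 y -> g j.+1 y' ->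
  cld [~ x, y * y'] = (cld [~ x, y] + cld [~ x, y'])%R.
Proof.
by move=> gx gy gy'; rewrite commgMJ clM ?cl_conj 1?addrC //; try exact: gC; apply/nsgJ/gC.
Qed.

Lemma cl_comm0l x y : g i.+2 x -> g j.+1 y -> cld [~ x, y] = 0%R.
Proof. by move=> gx gy; apply/cl0/hM; rewrite hd; apply: (@gamma_comm G i.+1 j). Qed.

Lemma cl_comm0r x y : g i.+1 x -> g j.+2 y -> cld [~ x, y] = 0%R.
Proof.
move=> gx gy; apply/cl0/hM; rewrite hd.
by have := @gamma_comm G i j.+1 _ _ gx gy; rewrite addnS.
Qed.

Lemma cl_commC x y : g i.+1 x -> g j.+1 y -> cld [~ y, x] = (- cld [~ x, y])%R.
Proof. by move=> gx gy; rewrite -commgVJ clV //; apply: gC. Qed.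

Lemma cl_commVr x y : g i.+1 x -> g j.+1 y -> cld [~ x, y^-1] = (- cld [~ x, y])%R.
Proof.
move=> gx gy; apply/eqP; rewrite -addr_eq0 -cl_commMr ?mulVg ?commg1 ?cl1 //.
exact: nsgV.
Qed.

Definition bracketr y (gy : g j.+1 y) : {additive zq (g i.+1) (g i.+2) -> zq (g d) M} :=
  zq_lift (fun x x' gx gx' => cl_commMl gx gx' gy) (fun x _ gx => cl_comm0l gx gy).

Lemma bracketrE y (gy : g j.+1 y) x : g i.+1 x -> bracketr gy (cl _ _ x) = cld [~ x, y].
Proof. by move=> gx; rewrite /bracketr zq_liftE. Qed.

Definition bracketl x (gx : g i.+1 x) : {additive zq (g j.+1) (g j.+2) -> zq (g d) M} :=
  zq_lift (fun y y' gy gy' => cl_commMr gx gy gy') (fun y _ gy => cl_comm0r gx gy).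

Lemma bracketlE x (gx : g i.+1 x) y : g j.+1 y -> bracketl gx (cl _ _ y) = cld [~ x, y].
Proof. by move=> gy; rewrite /bracketl zq_liftE. Qed.
End GammaBilinear.

Section Jacobi.
Variables (G : groupType) (d : nat) (M : nsubgroup G).
Hypothesis hM : forall x, gamma_ d.+1 (nsgT G) x -> M x.
Local Notation cl := (cl (gamma_ d (nsgT G)) M).

(** The Hall-Witt identity modulo gamma_{d+1}: conjugations disappear and inverses become signs. [M]
    is kept general because it is taken to be gamma_{d+1} for Hall collection and [mgamma] for the
    metabelian quotients. *)
Lemma cl_jacobi i j k a b c : d = (i + j + k).+3 ->
  gamma_ i.+1 (nsgT G) a -> gamma_ j.+1 (nsgT G) b -> gamma_ k.+1 (nsgT G) c ->
  cl [~ [~ a, b], c] = (cl [~ [~ a, c], b] + cl [~ a, [~ b, c]])%R.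
Proof.
move=> hd ga gb gc.
have key i' j' k' x y z : (i + j + k = i' + j' + k')%N -> gamma_ i'.+1 (nsgT G) x ->
    gamma_ j'.+1 (nsgT G) y -> gamma_ k'.+1 (nsgT G) z ->
    gamma_ d (nsgT G) [~ [~ x, y^-1], z] /\
    cl [~ [~ x, y^-1], z] = (- cl [~ [~ x, y], z])%R.
  move=> e gx gy gz; have gxy := gamma_comm gx gy; have gxy' := gamma_comm gx (nsgV gy).
  have hd' : d = ((i' + j').+1 + k').+2 by rewrite hd e.
  split; first by rewrite hd'; apply: gamma_comm.
  rewrite -(bracketrE hd' hM gz gxy') (cl_commVr (erefl _) _ gx gy) //.
  by rewrite raddfN; congr (- _)%R; apply: (bracketrE hd' hM gz gxy).
have [g1 e1] := key i j k a b c erefl ga gb gc.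
have [g2 e2] := key j k i b c a ltac:(lia) gb gc ga.
have [g3 e3] := key k i j c a b ltac:(lia) gc ga gb.
have gac : gamma_ (i + k).+2 (nsgT G) [~ a, c] by apply: gamma_comm.
have gbc : gamma_ (j + k).+2 (nsgT G) [~ b, c] by apply: gamma_comm.
have E : cl 1 = 0%R by apply: cl1.
have cJ x z : gamma_ d (nsgT G) x -> cl (x ^ z) = cl x.
  exact: (@cl_conj G (i + j).+1 k d M hd hM).
have g1' := nsgJ b g1; have g2' := nsgJ c g2; have g3' := nsgJ a g3.
move: E; rewrite -(hall_witt a b c).
rewrite (clM _ (nsgM g1' g2') g3') (clM _ g1' g2') (cJ _ _ g1) (cJ _ _ g2) (cJ _ _ g3).
rewrite e1 e2 e3.
have -> : cl [~ [~ b, c], a] = (- cl [~ a, [~ b, c]])%R.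
  by apply: (@cl_commC G i (j + k).+1 d) => //; rewrite hd; lia.
have -> : cl [~ [~ c, a], b] = (- cl [~ [~ a, c], b])%R.
  rewrite -(commgVJ a c).
  have hd' : d = ((i + k).+1 + j).+2 by rewrite hd; lia.
  rewrite -(bracketrE hd' hM gb (nsgV gac)) clV // raddfN.
  by congr (- _)%R; apply: (bracketrE hd' hM gb gac).
rewrite !opprK -addrA => /eqP; rewrite addrC subr_eq0 => /eqP <-.
by rewrite addrC.
Qed.
End Jacobi.

Local Close Scope group_scope.

(** * The Magnus expansion *)

Section UnitGroup.
Variable E : pzRingType.

Definition is_unit_pair : pred (E * E) := fun p => (p.1 * p.2 == 1) && (p.2 * p.1 == 1).

(** A unit is stored with its two-sided inverse, so that the group operations are explicit;
    [unit_ext] shows that the inverse carries no further information. *)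
Definition units := {p : E * E | is_unit_pair p}.
HB.instance Definition _ := Choice.on units.

Definition uval (u : units) : E := (val u).1.
Definition uinvval (u : units) : E := (val u).2.

Lemma uvalV u : uval u * uinvval u = 1.
Proof. by have /andP[/eqP] := valP u. Qed.

Lemma uVval u : uinvval u * uval u = 1.
Proof. by have /andP[_ /eqP] := valP u. Qed.

Lemma unit_ext u v : uval u = uval v -> u = v.
Proof.
move=> e; apply: val_inj.
rewrite (surjective_pairing (val u)) (surjective_pairing (val v)).
congr pair; first exact: e.
rewrite -[LHS]mul1r -(uVval v) -mulrA -/(uval v) -e.
by rewrite -[(val u).2]/(uinvval u) uvalV mulr1.
Qed.

Lemma umk_subproof a b : a * b = 1 -> b * a = 1 -> is_unit_pair (a, b).
Proof. by move=> ab ba; rewrite /is_unit_pair ab ba !eqxx. Qed.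

Definition umk a b (ab : a * b = 1) (ba : b * a = 1) : units :=
  exist _ (a, b) (umk_subproof ab ba).

Definition umul (u v : units) : units.
Proof.
apply: (@umk (uval u * uval v) (uinvval v * uinvval u)).
  by rewrite mulrA -(mulrA (uval u)) uvalV mulr1 uvalV.
by rewrite mulrA -(mulrA (uinvval v)) uVval mulr1 uVval.
Defined.

Definition uinv (u : units) : units := umk (uVval u) (uvalV u).
Definition uone : units := umk (mul1r 1) (mul1r 1).

Lemma umulA : associative umul.
Proof. by move=> u v w; apply: unit_ext; rewrite /uval /= mulrA. Qed.
Lemma umul1 : left_id uone umul.
Proof. by move=> u; apply: unit_ext; rewrite /uval /= mul1r. Qed.
Lemma umulr1 : right_id uone umul.
Proof. by move=> u; apply: unit_ext; rewrite /uval /= mulr1. Qed.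
Lemma umulV : left_inverse uone uinv umul.
Proof. by move=> u; apply: unit_ext; apply: uVval. Qed.
Lemma umulrV : right_inverse uone uinv umul.
Proof. by move=> u; apply: unit_ext; apply: uvalV. Qed.

HB.instance Definition _ := isGroup.Build units umulA umul1 umulr1 umulV umulrV.

End UnitGroup.

(** * Formal power series over a noncommutative ring *)

Section Series.
Variable R : pzRingType.

(** Power series in a central variable t. Over the free ring, coefficients of t^k homogeneous of
    degree k ([homog]) make this a model of noncommutative power series in the letters. *)
Definition series : Type := nat -> R.
HB.instance Definition _ := gen_eqMixin series.
HB.instance Definition _ := gen_choiceMixin series.
Implicit Types a b c : series.

Lemma series_ext a b : (forall k, a k = b k) -> a = b.
Proof. exact: functional_extensionality_dep. Qed.

Definition sadd a b : series := fun k => a k + b k.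
Definition sopp a : series := fun k => - a k.
Definition szero : series := fun=> 0.

Lemma saddA : associative sadd. Proof. by move=> *; apply: series_ext => k; apply: addrA. Qed.
Lemma saddC : commutative sadd. Proof. by move=> *; apply: series_ext => k; apply: addrC. Qed.
Lemma sadd0 : left_id szero sadd. Proof. by move=> *; apply: series_ext => k; apply: add0r. Qed.
Lemma saddN : left_inverse szero sopp sadd.
Proof. by move=> *; apply: series_ext => k; apply: addNr. Qed.
HB.instance Definition _ := GRing.isZmodule.Build series saddA saddC sadd0 saddN.

Lemma saddE a b k : (a + b) k = a k + b k. Proof. by []. Qed.
Lemma sBE a b k : (a - b) k = a k - b k. Proof. by []. Qed.

Definition smul a b : series := fun k => \sum_(i < k.+1) a i * b (k - i)%N.
Definition sone : series := fun k => (k == 0%N)%:R.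

Lemma smulE_rev a b k : smul a b k = \sum_(i < k.+1) a (k - i)%N * b i.
Proof.
rewrite /smul (reindex_inj rev_ord_inj) /=; apply: eq_bigr => i _.
by rewrite subSS subKn // -ltnS.
Qed.

Lemma smulA : associative smul.
Proof.
move=> a b c; apply: series_ext => k.
pose T i j : R := a i * (b j * c (k - i - j)%N).
have -> : smul a (smul b c) k = \sum_(i < k.+1) \sum_(j < k.+1 | (i + j <= k)%N) T i j.
  apply: eq_bigr => i _; rewrite /smul mulr_sumr.
  rewrite (big_ord_widen_cond k.+1 xpredT (fun j => a i * (b j * c (k - i - j)%N))); last first.
    by rewrite ltnS leq_subr.
  by apply: eq_bigl => j /=; have := ltn_ord i; lia.
have -> : smul (smul a b) c k = \sum_(l < k.+1) \sum_(i < k.+1 | (i <= l)%N) T i (l - i)%N.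
  apply: eq_bigr => l _; rewrite /smul mulr_suml.
  rewrite (big_ord_widen_cond k.+1 xpredT (fun i => a i * b (l - i)%N * c (k - l)%N)); last first.
    exact: ltn_ord.
  apply: eq_big => [i|i /= il]; first by rewrite /= ltnS.
  by rewrite /T -mulrA; congr (_ * (_ * c _)); lia.
rewrite [RHS](exchange_big_dep xpredT) //=; apply: eq_bigr => i _; apply: esym.
(* Reindex by l = i + j. When i + j > k the value of [inord] is arbitrary, and the pair is excluded
   because l - i = j would force l > k. *)
rewrite (reindex_onto (fun j : 'I_k.+1 => inord (i + j) : 'I_k.+1) (fun l => inord (l - i)%N)) /=.
  apply: eq_big => [j|j /andP[h1 /eqP h2]].
    have hi := ltn_ord i; have hj := ltn_ord j.
    case: (leqP (i + j) k) => ij.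
      by rewrite inordK // leq_addr addKn inord_val !eqxx.
    have := ltn_ord (inord (i + j) : 'I_k.+1); move: (nat_of_ord (inord _)) => l hl.
    apply/negP => /andP[h1 /eqP /(congr1 val)].
    by rewrite /= inordK; lia.
  have ij : (i + j <= k)%N.
    move: h1 h2; have := ltn_ord (inord (i + j) : 'I_k.+1).
    move: (nat_of_ord (inord _)) => l hl h1 /(congr1 val).
    by rewrite /= inordK; lia.
  by rewrite inordK // addKn.
by move=> l il; apply: val_inj; have hl := ltn_ord l; rewrite /= !inordK; lia.
Qed.

Lemma smul1 : left_id sone smul.
Proof.
move=> a; apply: series_ext => k; rewrite /smul big_ord_recl /= subn0 mul1r.
by rewrite big1 ?addr0 // => i _; rewrite mul0r.
Qed.

Lemma smulr1 : right_id sone smul.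
Proof.
move=> a; apply: series_ext => k; rewrite smulE_rev big_ord_recl /= subn0 mulr1.
by rewrite big1 ?addr0 // => i _; rewrite mulr0.
Qed.

Lemma smulDl : left_distributive smul +%R.
Proof.
move=> a b c; apply: series_ext => k; rewrite saddE /smul -big_split.
by apply: eq_bigr => i _; rewrite saddE mulrDl.
Qed.

Lemma smulDr : right_distributive smul +%R.
Proof.
move=> a b c; apply: series_ext => k; rewrite saddE /smul -big_split.
by apply: eq_bigr => i _; rewrite saddE mulrDr.
Qed.

HB.instance Definition _ :=
  GRing.Zmodule_isPzRing.Build series smulA smul1 smulr1 smulDl smulDr.

Lemma smulE a b k : (a * b) k = \sum_(i < k.+1) a i * b (k - i)%N.
Proof. by []. Qed.

Lemma smul0E a b : (a * b) 0%N = a 0%N * b 0%N.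
Proof. by rewrite smulE big_ord1. Qed.

Lemma s1E k : (1 : series) k = (k == 0%N)%:R. Proof. by []. Qed.

(** [slin x] is 1 + x t and [sgeo x] is the geometric series of x t, so the inverse of the first is
    the second at - x. *)
Definition slin (x : R) : series := fun k => if k is k'.+1 then (k' == 0%N)%:R * x else 1.
Definition sgeo (x : R) : series := fun k => x ^+ k.

Lemma slin_geo x : slin x * sgeo (- x) = 1.
Proof.
apply: series_ext => k; rewrite smulE s1E; case: k => [|k].
  by rewrite big_ord1 mul1r.
rewrite !big_ord_recl /= mul1r mul1r big1 ?addr0 => [|i _]; last by rewrite !mul0r.
by rewrite /sgeo subn1 subn0 /= exprS mulNr addNr.
Qed.

Lemma sgeo_lin x : sgeo (- x) * slin x = 1.
Proof.
apply: series_ext => k; rewrite [LHS]smulE_rev s1E; case: k => [|k].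
  by rewrite big_ord1 mulr1.
rewrite !big_ord_recl /= mul1r mulr1 big1 ?addr0 => [|i _]; last by rewrite mul0r mulr0.
by rewrite /sgeo subn1 subn0 /= exprSr mulrN addNr.
Qed.

Definition unit_lin x : units series := umk (slin_geo x) (sgeo_lin x).

Definition low (k : nat) a : Prop := forall j, (j < k)%N -> a j = 0.

Lemma low_mul i j a b : low i a -> low j b -> low (i + j) (a * b).
Proof.
move=> la lb k kij; rewrite smulE big1 // => l _; have hl := ltn_ord l.
by case: (ltnP l i) => li; [rewrite la // mul0r | rewrite lb ?mulr0 //; lia].
Qed.

Lemma low_mul_lead i j a b : low i a -> low j b -> (a * b) (i + j)%N = a i * b j.
Proof.
move=> la lb; have hi : (i < (i + j).+1)%N by rewrite ltnS leq_addr.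
rewrite smulE (bigD1 (Ordinal hi)) //= addKn big1 ?addr0 // => l.
rewrite -val_eqE /= => li; have hl := ltn_ord l.
by case: (ltngtP l i) li => // li _; [rewrite la // mul0r | rewrite lb ?mulr0 //; lia].
Qed.

Lemma lowD k a b : low k a -> low k b -> low k (a + b).
Proof. by move=> la lb j jk; rewrite saddE la // lb // addr0. Qed.

Lemma lowN k a : low k a -> low k (- a).
Proof. by move=> la j jk; rewrite -[LHS]/(- a j) la // oppr0. Qed.

Lemma low_le i k a : (i <= k)%N -> low k a -> low i a.
Proof. by move=> ik la j ji; apply: la; apply: leq_trans ik. Qed.
End Series.

Lemma smulC (R : comPzRingType) (a b : series R) : a * b = b * a.
Proof.
apply: series_ext => k; rewrite smulE [RHS]smulE_rev.
by apply: eq_bigr => i _; rewrite mulrC.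
Qed.

Section SeriesMap.
Variables (R R' : pzRingType) (f : {rmorphism R -> R'}).

Definition series_map (a : series R) : series R' := fun k => f (a k).

Lemma series_mapM a b : series_map (a * b) = series_map a * series_map b.
Proof.
apply: series_ext => k; rewrite /series_map !smulE rmorph_sum.
by apply: eq_bigr => i _; rewrite rmorphM.
Qed.

Lemma series_map1 : series_map 1 = 1.
Proof. by apply: series_ext => k; rewrite /series_map !s1E; case: eqP => _; rewrite ?rmorph1 ?rmorph0. Qed.
End SeriesMap.

Definition free_on (F : groupType) (K : Type) (b : K -> F) : Prop :=
  forall (H : groupType) (f : K -> H),
    (exists h : {multiplicative F -> H}, forall x, h (b x) = f x) /\
    (forall h h' : {multiplicative F -> H},
       (forall x, h (b x) = h' (b x)) -> forall w, h w = h' w).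

Section Generation.
Variables (F : groupType) (K : Type) (b : K -> F).
Hypothesis bF : free_on b.
Variable S : F -> Prop.
Hypothesis S1 : S 1%g.
Hypothesis SM : forall x y, S x -> S y -> S (x * y)%g.
Hypothesis SV : forall x, S x -> S x^-1%g.
Hypothesis Sb : forall x, S (b x).

Let sb : {pred F} := fun x => `[< S x >].

Let sb_closed : group_closed sb.
Proof.
split=> [|x y]; rewrite !unfold_in; first exact/asboolP.
by move=> /asboolP Sx /asboolP Sy; apply/asboolP/SM/SV.
Qed.

Let gsub : Type := {x : F | sb x}.
#[local] HB.instance Definition _ := SubChoice.on gsub.
#[local] HB.instance Definition _ := SubChoice_isSubGroup.Build F sb gsub sb_closed.

(** The universal property gives a homomorphism from F to the subgroup cut out by [S] that fixes the
    basis. Followed by the inclusion it is the identity, by uniqueness. *)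
Lemma free_ind w : S w.
Proof.
have [[h hb] _] := bF (fun x => exist _ (b x) (asboolT (Sb x)) : gsub).
pose k (u : F) : F := val (h u).
have kM : {morph k : x y / (x * y)%g} by move=> x y; rewrite /k gmulfM.
pose k' : {multiplicative F -> F} := HB.pack k (isMultiplicative.Build F F k kM).
pose i' : {multiplicative F -> F} := HB.pack (@id F) (isMultiplicative.Build F F id (fun _ _ => erefl)).
have -> : w = k w.
  have [_ /(_ i' k')] := bF b; apply => x; rewrite /= /k hb //.
exact/asboolP/(valP (h w)).
Qed.
End Generation.

Lemma subrBB (V : zmodType) (x y a c : V) : x - y - (a - c) = (x - a) - (y - c).
Proof. by rewrite !opprD !opprK addrACA. Qed.

Lemma mul_sub1 (R : pzRingType) (x y : R) : (x - 1) * (y - 1) = x * y - (x + y - 1).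
Proof. by rewrite mulrBr mulrBl mulr1 mul1r -addrA -opprD addrA [y + x]addrC. Qed.

Lemma mulM_sub1 (R : pzRingType) (x y : R) :
  x * y - 1 = (x - 1) * (y - 1) + ((x - 1) + (y - 1)).
Proof.
by rewrite mul_sub1 (addrACA x) (addrA (x + y)) [RHS]addrA subrK.
Qed.

Lemma mulrBB (R : pzRingType) (x y a c : R) : x * y - a * c = x * (y - c) + (x - a) * c.
Proof. by rewrite mulrBr mulrBl addrA subrK. Qed.

(** * Powers of the augmentation ideal *)

Section AugPowers.
Variable G : groupType.
Notation A := (groupring G).
Notation f := (aug (nsgT G)).
Notation fX := (idealX f).

Lemma aug_gr (H : nsubgroup G) w : H w -> aug H (gr w - 1).
Proof. by move=> Hw; apply: zspan_gen; exists w, 1; rewrite mulr1. Qed.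

Lemma augT_gr w : f (gr w - 1).
Proof. exact: aug_gr. Qed.

Lemma idealM_subr (I J : ideal A) x : idealM I J x -> J x.
Proof.
elim=> {x} [_ [i [j [Ii Jj ->]]]||y z _ Iy _ Iz].
- exact: idealMl.
- exact: ideal0.
- exact: idealB.
Qed.

Lemma idealM_gen (I J : ideal A) x y : I x -> J y -> idealM I J (x * y).
Proof. by move=> Ix Jy; apply: zspan_gen; exists x, y. Qed.

Lemma fX_sub k x : fX k.+1 x -> fX k x.
Proof. by case: k => // k; apply: idealM_subr. Qed.

Lemma fX_le i j x : (i <= j)%N -> fX j x -> fX i x.
Proof. by move=> /subnK <-; elim: (j - i)%N => // k IH /fX_sub/IH. Qed.

Lemma fX_mul i j x y : fX i.+1 x -> fX j.+1 y -> fX (i + j).+2 (x * y).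
Proof.
elim: i x => [|i IH] x fx fy; first exact: idealM_gen.
elim: fx => [_ [a [x' [fa fx' ->]]]||x1 x2 _ h1 _ h2].
- by rewrite -mulrA; apply: (@idealM_gen f (fX (i + j).+2)) => //; apply: IH.
- by rewrite mul0r; apply: ideal0.
- by rewrite mulrBl; apply: idealB.
Qed.

Lemma gr_comm x y : gr [~ x, y]%g - 1 =
  gr (x^-1 * y^-1)%g * ((gr x - 1) * (gr y - 1) - (gr y - 1) * (gr x - 1)) :> A.
Proof.
have -> : (gr x - 1) * (gr y - 1) - (gr y - 1) * (gr x - 1) =
    gr x * gr y - gr y * gr x :> A.
  by rewrite !mul_sub1 [gr y + gr x]addrC; move: (gr x + gr y - 1) => c; rewrite opprB addrA subrK.
rewrite mulrBr -!grM; congr (gr _ - _); first by rewrite /commg /conjg !mulgA.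
by rewrite -invgM mulVg.
Qed.

Lemma comm_ideal (I J L : ideal A) x y : I (gr x - 1) -> J (gr y - 1) ->
  (forall a c, I a -> J c -> L (a * c) /\ L (c * a)) -> cap1 L [~ x, y]%g.
Proof.
move=> Ix Jy h; rewrite /= gr_comm; apply/idealMl.
by have [h1 h2] := h _ _ Ix Jy; apply: idealB.
Qed.

(** The half of the dimension subgroup theorem valid in every group; [magnus] is the converse for
    free groups. *)
Lemma gamma_fX k w : gamma_ k.+1 (nsgT G) w -> fX k.+1 (gr w - 1).
Proof.
elim: k w => [|k IH] w; first by move=> _; apply: augT_gr.
apply: (@nsgR_min _ _ _ (cap1 (fX k.+2))) => x y _ /IH gy.
apply: (comm_ideal (augT_gr x) gy) => a c fa fc.
split; first exact: (@fX_mul 0).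
by have := @fX_mul k 0 _ _ fc fa; rewrite addn0.
Qed.

Lemma groupring_ind (P : A -> Prop) :
  P 0 -> (forall x y, P x -> P y -> P (x - y)) -> (forall w, P (gr w)) -> forall x, P x.
Proof. exact: freeg_gen_ind. Qed.
End AugPowers.

Definition fhom (K : choiceType) (k : nat) : frg K -> Prop :=
  zspan (fun x => exists2 s, size s = k & x = wd s).

Section FHom.
Variable K : choiceType.
Implicit Types x y : frg K.

Lemma fhomM i j x y : fhom i x -> fhom j y -> fhom (i + j) (x * y).
Proof.
move=> hx hy; elim: hx => [_ [s ss ->]||x1 x2 _ h1 _ h2].
- elim: hy => [_ [t st ->]||y1 y2 _ h1 _ h2].
  + by apply: zspan_gen; exists (s ++ t); rewrite ?wdM // size_cat ss st.
  + by rewrite mulr0; apply: zspan0.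
  + by rewrite mulrBr; apply: zspanB.
- by rewrite mul0r; apply: zspan0.
- by rewrite mulrBl; apply: zspanB.
Qed.

Lemma fhom_wd s : fhom (size s) (wd s : frg K).
Proof. by apply: zspan_gen; exists s. Qed.

Lemma fhom_sum k I (r : seq I) (P : pred I) (E : I -> frg K) :
  (forall i, P i -> fhom k (E i)) -> fhom k (\sum_(i <- r | P i) E i).
Proof.
move=> h; elim/big_ind: _ => //; first exact: zspan0.
exact: zspanD.
Qed.

Definition homog (a : series (frg K)) : Prop := forall k, fhom k (a k).

Lemma homogM a b : homog a -> homog b -> homog (a * b).
Proof.
move=> ha hb k; rewrite smulE; apply: fhom_sum => i _.
by have := fhomM (ha i) (hb (k - i)%N); rewrite subnKC // -ltnS.
Qed.

Lemma homog1 : homog 1.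
Proof.
move=> k; rewrite s1E; case: eqP => [->|_]; last exact: zspan0.
exact: (fhom_wd [::]).
Qed.
End FHom.

Section Magnus.
Variables (F : groupType) (K : choiceType) (b : K -> F).
Hypothesis bF : free_on b.
Notation R := (frg K).
Notation A := (groupring F).
Notation f := (aug (nsgT F)).
Notation fX := (idealX f).

Definition mag : {multiplicative F -> units (series R)} :=
  projT1 (cid (proj1 (bF (fun x => unit_lin (wd [:: x] : R))))).

Lemma mag_b x : mag (b x) = unit_lin (wd [:: x]).
Proof. exact: projT2 (cid (proj1 (bF _))) x. Qed.

Definition mu : A -> series R := fgl (fun w => uval (mag w)).

Lemma muB : zmod_morphism mu. Proof. exact: raddfB. Qed.
HB.instance Definition _ := GRing.isZmodMorphism.Build A (series R) mu muB.

Lemma mu_gr w : mu (gr w) = uval (mag w). Proof. exact: fglU. Qed.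

Lemma mu_monoid : monoid_morphism mu.
Proof.
split=> [|x y]; first by rewrite -gr1 mu_gr morph1.
elim/groupring_ind: x => [|x x' hx hx'|w]; first by rewrite mul0r raddf0 mul0r.
  by rewrite mulrBl !raddfB /= hx hx' mulrBl.
elim/groupring_ind: y => [|y y' hy hy'|v]; first by rewrite mulr0 raddf0 mulr0.
  by rewrite mulrBr !raddfB /= hy hy' mulrBr.
by rewrite -grM !mu_gr gmulfM.
Qed.
HB.instance Definition _ := GRing.isMonoidMorphism.Build A (series R) mu mu_monoid.

Lemma mu0E k : mu 0 k = 0. Proof. by rewrite raddf0. Qed.

Lemma muBE u v k : mu (u - v) k = mu u k - mu v k. Proof. by rewrite raddfB. Qed.

Lemma mu_b x : mu (gr (b x)) = slin (wd [:: x]). Proof. by rewrite mu_gr mag_b. Qed.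

Lemma mu_homog w : homog (mu (gr w)).
Proof.
suff [] : homog (mu (gr w)) /\ homog (mu (gr w^-1%g)) by [].
elim/(free_ind bF): w => [|x y [hx hx'] [hy hy']|x [hx hx']|x].
- by rewrite invg1 gr1 rmorph1; split; apply: homog1.
- by rewrite invgM !grM !rmorphM; split; apply: homogM.
- by rewrite invgK; split.
rewrite !mu_gr morphV mag_b; split=> k.
  rewrite /uval /=; case: k => [|[|k]] /=; rewrite ?mul1r ?mul0r; [exact: (fhom_wd [::])|exact: (fhom_wd [:: x])|exact: zspan0].
have -> : uval (unit_lin (wd [:: x] : R))^-1%g = sgeo (- wd [:: x]) by [].
rewrite /sgeo; elim: k => [|k IH]; first exact: (fhom_wd [::]).
rewrite exprS mulNr; apply: zspanN; exact: (fhomM (fhom_wd [:: x]) IH).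
Qed.

Lemma mu_fhom u k : fhom k (mu u k).
Proof.
elim/groupring_ind: u => [|x y hx hy|w]; last exact: mu_homog.
  by rewrite raddf0; apply: zspan0.
by rewrite raddfB sBE; apply: zspanB.
Qed.

Lemma mu_gr0 w : mu (gr w) 0%N = 1.
Proof.
elim/(free_ind bF): w => [|x y hx hy|x hx|x].
- by rewrite gr1 rmorph1.
- by rewrite grM rmorphM /= smul0E hx hy mulr1.
- have : (mu (gr x^-1%g) * mu (gr x)) 0%N = 1 by rewrite -rmorphM -grM mulVg gr1 rmorph1.
  by rewrite smul0E hx mulr1.
- by rewrite mu_b.
Qed.

Lemma mu_aug_low u : f u -> low 1 (mu u).
Proof.
elim=> {u} [_ [h [a [_ ->]]]||x y _ hx _ hy] j; rewrite ltnS leqn0 => /eqP ->.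
- by rewrite rmorphM /= smul0E rmorphB rmorph1 /= sBE mu_gr0 subrr mul0r.
- by rewrite raddf0.
- by rewrite raddfB /= sBE hx // hy // subrr.
Qed.

Lemma mu_low k u : fX k.+1 u -> low k.+1 (mu u).
Proof.
elim: k u => [|k IH] u; first exact: mu_aug_low.
elim=> {u} [_ [x [y [fx fy ->]]]||x y _ hx _ hy].
- by rewrite rmorphM; apply: (@low_mul _ 1 k.+1); [apply: mu_aug_low|apply: IH].
- by rewrite raddf0.
- by rewrite raddfB; apply/lowD/lowN.
Qed.

Definition ev (x : R) : A := frmap (fun k => gr (b k) - 1) x.
HB.instance Definition _ := GRing.RMorphism.copy ev (frmap (fun k => gr (b k) - 1)).

Lemma ev1 k : ev (wd [:: k]) = gr (b k) - 1. Proof. exact: frmap1. Qed.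

Lemma ev_wd_fX s : s != [::] -> fX (size s) (ev (wd s)).
Proof.
elim: s => // k [|k' s] IH _; first by rewrite ev1; apply: augT_gr.
by rewrite wd_cons rmorphM /=; apply: (@fX_mul _ 0 (size s)); [rewrite ev1; apply: augT_gr|apply: IH].
Qed.

Lemma ev_fX k x : fhom k.+1 x -> fX k.+1 (ev x).
Proof.
elim=> [_ [s ss ->]||y z _ hy _ hz].
- by rewrite -ss; apply: ev_wd_fX; case: s ss.
- by rewrite raddf0; apply: ideal0.
- by rewrite raddfB; apply: idealB.
Qed.

Lemma ev_mu0 u : f (u - ev (mu u 0%N)).
Proof.
elim/groupring_ind: u => [|x y hx hy|w].
- by rewrite mu0E raddf0 subr0; apply: ideal0.
- by rewrite muBE raddfB subrBB; apply: idealB.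
- by rewrite mu_gr0 rmorph1; apply: augT_gr.
Qed.

Lemma ev_mu1_gr w : fX 2 (gr w - 1 - ev (mu (gr w) 1%N)).
Proof.
elim/(free_ind bF): w => [|x y hx hy|x hx|x].
- by rewrite gr1 rmorph1 s1E subrr sub0r raddf0 oppr0; apply: ideal0.
- have -> : gr (x * y)%g - 1 - ev (mu (gr (x * y)%g) 1%N) =
      (gr x - 1) * (gr y - 1) + ((gr x - 1 - ev (mu (gr x) 1%N)) +
        (gr y - 1 - ev (mu (gr y) 1%N))).
    rewrite grM rmorphM /= smulE big_ord_recl big_ord1 /= !mu_gr0 mul1r mulr1 raddfD /=.
    rewrite (addrACA (gr x - 1)) -opprD addrA -mulM_sub1.
    by rewrite [ev (mu (gr y) _) + _]addrC.
  by apply: idealDE; [apply: idealM_gen; apply: augT_gr|apply: idealDE].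
- have e : mu (gr x^-1%g) 1%N = - mu (gr x) 1%N.
    have : (mu (gr x^-1%g) * mu (gr x)) 1%N = 0 by rewrite -rmorphM -grM mulVg gr1 rmorph1.
    by rewrite smulE big_ord_recl big_ord1 /= !mu_gr0 mul1r mulr1 addrC => /eqP; rewrite addr_eq0 => /eqP.
  have -> : gr x^-1%g - 1 - ev (mu (gr x^-1%g) 1%N) =
      0 - ((gr x - 1 - ev (mu (gr x) 1%N)) + (gr x - 1) * (gr x^-1%g - 1)).
    rewrite e raddfN opprK mul_sub1 -grM mulgV gr1 sub0r.
    rewrite (addrA (gr x - 1 - _)) [_ - _ + 1]addrAC subrK !opprB -(addrA (gr x)) [gr x + _]addrC.
    by rewrite addrACA subrr addr0.
  apply: idealB; first exact: ideal0.
  by apply: idealDE => //; apply: idealM_gen; apply: augT_gr.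
- have -> : mu (gr (b x)) 1%N = wd [:: x] by rewrite mu_b /= mul1r.
  by rewrite ev1 subrr; apply: ideal0.
Qed.

Lemma ev_mu1 u : f u -> fX 2 (u - ev (mu u 1%N)).
Proof.
elim=> {u} [_ [h [a [_ ->]]]||x y _ hx _ hy].
- have l1 : low 1 (mu (gr h - 1)) by apply/mu_aug_low/augT_gr.
  have -> : mu ((gr h - 1) * a) 1%N = mu (gr h) 1%N * mu a 0%N.
    rewrite rmorphM (@low_mul_lead _ 1 0) //; congr (_ * _).
    by rewrite rmorphB rmorph1 /= sBE s1E subr0.
  rewrite [ev _]rmorphM mulrBB.
  apply: idealDE; first by apply: idealM_gen; [apply: augT_gr|apply: ev_mu0].
  by apply/idealMr/ev_mu1_gr.
- by rewrite mu0E raddf0 subr0; apply: ideal0.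
- by rewrite muBE raddfB subrBB; apply: idealB.
Qed.

(* The degree k part of the Magnus expansion induces f^k / f^(k+1) -> R_k, with
   inverse induced by [ev]. *)
Lemma ev_mu k u : fX k.+1 u -> fX k.+2 (u - ev (mu u k.+1)).
Proof.
elim: k u => [|k IH] u; first exact: ev_mu1.
elim=> {u} [_ [x [y [fx fy ->]]]||x y _ hx _ hy].
- rewrite rmorphM (@low_mul_lead _ 1 k.+1); [|exact: mu_aug_low|exact: mu_low].
  rewrite [ev _]rmorphM mulrBB; apply: idealDE; first by apply: (@fX_mul _ 0 k.+1) => //; apply: IH.
  apply: (@fX_mul _ 1 k); first exact: ev_mu1.
  by apply: ev_fX; apply: mu_fhom.
- by rewrite mu0E raddf0 subr0; apply: ideal0.
- by rewrite muBE raddfB subrBB; apply: idealB.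
Qed.

(** For w in gamma_k this is the leading Magnus coefficient: it is additive there ([ldM]) and turns
    group commutators into ring commutators ([ld_comm]). *)
Definition ld k w : R := mu (gr w - 1) k.

Lemma ld_low k w : gamma_ k.+1 (nsgT F) w -> low k.+1 (mu (gr w - 1)).
Proof. by move/gamma_fX/mu_low. Qed.

Lemma ldM k w w' : low k.+1 (mu (gr w - 1)) -> low k.+1 (mu (gr w' - 1)) ->
  ld k.+1 (w * w')%g = ld k.+1 w + ld k.+1 w'.
Proof.
move=> lw lw'; rewrite /ld.
have -> : gr (w * w')%g - 1 = (gr w - 1) * (gr w' - 1) + ((gr w - 1) + (gr w' - 1)).
  by rewrite grM mulM_sub1.
rewrite raddfD saddE raddfD saddE rmorphM.
by rewrite (low_mul lw lw') ?add0r //; lia.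
Qed.

Lemma ld_comm i j x y : low i.+1 (mu (gr x - 1)) -> low j.+1 (mu (gr y - 1)) ->
  ld (i + j).+2 [~ x, y]%g = ld i.+1 x * ld j.+1 y - ld j.+1 y * ld i.+1 x.
Proof.
move=> lx ly; rewrite /ld gr_comm rmorphM.
have lxy : low (i.+1 + j.+1) (mu ((gr x - 1) * (gr y - 1) - (gr y - 1) * (gr x - 1))).
  rewrite raddfB /= !rmorphM; apply: lowD; first exact: low_mul.
  by rewrite addnC; apply/lowN/low_mul.
have l0 : low 0 (mu (gr (x^-1 * y^-1)%g)) by [].
have := low_mul_lead l0 lxy; rewrite add0n addSn addnS => ->.
rewrite mu_gr0 mul1r muBE !rmorphM -addSn -addnS (low_mul_lead lx ly).
by rewrite addnC (low_mul_lead ly lx).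
Qed.

End Magnus.

(** * Hall trees and the dimension subgroups of a free group *)

Section Lex.
Variables (K : eqType) (le : rel K).
Hypothesis le_total : total le.
Hypothesis le_trans : transitive le.
Hypothesis le_anti : antisymmetric le.
Implicit Types u v w s : seq K.

Definition lts (x y : K) := (x != y) && le x y.

Lemma lts_irr x : lts x x = false. Proof. by rewrite /lts eqxx. Qed.

Lemma lts_trans : transitive lts.
Proof.
move=> y x z /andP[xy lxy] /andP[yz lyz]; rewrite /lts (le_trans lxy lyz) andbT.
by apply/eqP => e; subst z; case/eqP: xy; apply: le_anti; rewrite lxy lyz.
Qed.

Lemma lts_total x y : [\/ lts x y, x = y | lts y x].
Proof.
have [->|xy] := eqVneq x y; first exact: Or32.
by case/orP: (le_total x y) => h; [apply: Or31|apply: Or33]; rewrite /lts h andbT // eq_sym.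
Qed.

Fixpoint ltw u v : bool :=
  match u, v with
  | _, [::] => false
  | [::], _ :: _ => true
  | x :: u', y :: v' => lts x y || (x == y) && ltw u' v'
  end.

Lemma ltw_irr u : ltw u u = false.
Proof. by elim: u => //= x u ->; rewrite lts_irr andbF. Qed.

Lemma ltw_trans : transitive ltw.
Proof.
move=> v u w; elim: v u w => [|y v IH] [|x u] [|z w] //=.
case/orP => [xy|/andP[/eqP -> uv]].
  by case/orP => [yz|/andP[/eqP <- _]]; rewrite ?xy // (lts_trans xy yz).
by case/orP => [->//|/andP[/eqP -> vw]]; rewrite eqxx (IH _ _ uv vw) orbT.
Qed.

Lemma ltw_total u v : [\/ ltw u v, u = v | ltw v u].
Proof.
elim: u v => [|x u IH] [|y v]; [exact: Or32|exact: Or31|exact: Or33|].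
case: (lts_total x y) => [h|<-|h] /=; [by apply: Or31; rewrite h| |by apply: Or33; rewrite h].
by rewrite eqxx; case: (IH v) => [h|->|h]; [apply: Or31|apply: Or32|apply: Or33]; rewrite ?h ?orbT.
Qed.

Lemma ltw_cat2l w u v : ltw (w ++ u) (w ++ v) = ltw u v.
Proof. by elim: w => //= x w ->; rewrite lts_irr eqxx. Qed.

Lemma ltw_cat u v s t : ltw u v -> (size v <= size u)%N -> ltw (u ++ s) (v ++ t).
Proof.
elim: u v => [|x u IH] [|y v] //= /orP[->//|/andP[-> uv]].
by rewrite ltnS => sv; rewrite IH // orbT.
Qed.

Lemma ltw_catr u v t : ltw u v -> ltw u (v ++ t).
Proof.
elim: u v => [|x u IH] [|y v] //= /orP[->//|/andP[-> uv]].
by rewrite IH // orbT.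
Qed.

Lemma ltw_prefix u v s : ltw u v -> ltw (u ++ s) v \/ exists t, v = u ++ t.
Proof.
elim: u v => [|x u IH] [|y v] //=; first by right; exists (y :: v).
case/orP => [->|/andP[/eqP <- /IH[h|[t ->]]]]; first by left.
  by left; rewrite eqxx h orbT.
by right; exists t.
Qed.

Definition lyndon u : Prop :=
  u != [::] /\ forall p s, u = p ++ s -> p != [::] -> s != [::] -> ltw u s.

Lemma cat_eq_cat p s u v : p ++ s = u ++ v ->
  (exists q, u = p ++ q /\ s = q ++ v) \/ (exists2 q, q != [::] & p = u ++ q /\ v = q ++ s).
Proof.
elim: p u => [|x p IH] [|y u] //=; first by move=> ->; left; exists [::].
- by move=> ->; left; exists (y :: u).
- by move=> <-; right; exists (x :: p).
case=> <- /IH[[q [-> ->]]|[q q0 [-> ->]]]; first by left; exists q.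
by right; exists q.
Qed.

(** Everything reduces to uv < v. This is clear unless u is a prefix of v; if v = ut, then v < t
    because v is Lyndon, hence uv < ut = v. *)
Lemma lyndon_cat u v : lyndon u -> lyndon v -> ltw u v -> lyndon (u ++ v).
Proof.
move=> [u0 Lu] [v0 Lv] uv.
have uvv : ltw (u ++ v) v.
  case: (ltw_prefix v uv) => // [[t vE]].
  rewrite [X in ltw _ X]vE ltw_cat2l; apply: (Lv u t) => //.
  by apply/eqP => t0; move: uv; rewrite vE t0 cats0 ltw_irr.
split=> [|p s e p0 s0]; first by case: (u) u0.
case: (cat_eq_cat (esym e)) => [[q [uE ->]]|[q q0 [pE vE]]]; last first.
  by apply: ltw_trans uvv _; apply: (Lv q s).
have [q0|q0] := eqVneq q [::]; first by rewrite q0.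
by apply: ltw_cat; [apply: (Lu p q)|rewrite uE size_cat leq_addl].
Qed.

Inductive tree := Leaf of K | Node of tree & tree.

Fixpoint fol t : seq K :=
  match t with Leaf x => [:: x] | Node t1 t2 => fol t1 ++ fol t2 end.

(* Hall trees for the order on foliages, i.e. the standard bracketings of
   Lyndon words. *)
Fixpoint hall t : Prop :=
  match t with
  | Leaf _ => True
  | Node t1 t2 => [/\ hall t1, hall t2, ltw (fol t1) (fol t2) &
      if t1 is Node _ t12 then ~~ ltw (fol t12) (fol t2) else True]
  end.

Lemma fol_neq0 t : fol t != [::].
Proof. by elim: t => //= t1 h1 t2 _; case: (fol t1) h1. Qed.

Lemma fol_size t : (0 < size (fol t))%N.
Proof. by have := fol_neq0 t; case: (fol t). Qed.

Lemma hall_lyndon t : hall t -> lyndon (fol t).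
Proof.
elim: t => [x _|t1 h1 t2 h2 /= [H1 H2 H _]]; last by apply: lyndon_cat; auto.
by split=> // [[|y p] s] //= [_]; case: p s => [|? ?] [].
Qed.

(** The right factor is the least proper suffix of the foliage. The foliage therefore determines
    where the tree splits, which gives [hall_inj]. *)
Lemma hall_suffix t1 t2 p s : hall (Node t1 t2) -> fol (Node t1 t2) = p ++ s ->
  p != [::] -> s != [::] -> s = fol t2 \/ ltw (fol t2) s.
Proof.
elim: t1 t2 p s => [x|t11 IH t12 _] t2 p s /= [H1 H2 H H'] e p0 s0.
  case: p p0 e => // y p _ [_ e].
  have [p0|p0] := eqVneq p [::]; first by left; rewrite e p0.
  by right; apply: (hall_lyndon H2).2 e p0 s0.
case: (cat_eq_cat (esym e)) => [[q [uE ->]]|[q q0 [pE vE]]]; last first.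
  by right; apply: ((hall_lyndon H2).2 q s).
have [q0|q0] := eqVneq q [::]; first by left; rewrite q0.
right; have vq : fol t2 = q \/ ltw (fol t2) q.
  have := IH t12 p q H1 uE p0 q0.
  case: (ltw_total (fol t2) (fol t12)) H' => [h|<-|->] // _ [->|h']; [by right|by right; apply: ltw_trans h'|by left|by right].
case: vq => [<-|]; last exact: ltw_catr.
by rewrite -[X in ltw X _]cats0 ltw_cat2l; case: (fol t2) (fol_neq0 t2).
Qed.

Lemma hall_inj t t' : hall t -> hall t' -> fol t = fol t' -> t = t'.
Proof.
elim: t t' => [x|t1 h1 t2 h2] [x'|t1' t2'].
- by move=> _ _ [->].
- by move=> _ _ /(congr1 size) /=; rewrite size_cat; have := fol_size t1'; have := fol_size t2'; lia.
- by move=> _ _ /(congr1 size) /=; rewrite size_cat; have := fol_size t1; have := fol_size t2; lia.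
move=> H H' e.
have e2 : fol t2 = fol t2'.
  case: (hall_suffix H e (fol_neq0 _) (fol_neq0 _)) => [//|lt1].
  case: (hall_suffix H' (esym e) (fol_neq0 _) (fol_neq0 _)) => [//|lt2].
  by have := ltw_trans lt1 lt2; rewrite ltw_irr.
have e1 : fol t1 = fol t1'.
  move: e; rewrite /= e2 => /(congr1 (fun s => take (size s - size (fol t2')) s)).
  by rewrite !size_cat !addnK !take_size_cat.
by case: H => ? ? _ _; case: H' => ? ? _ _; rewrite (h1 t1') // (h2 t2').
Qed.
End Lex.

Lemma zspan_mul (R : pzRingType) (S S' T : R -> Prop) x y :
  (forall a c, S a -> S' c -> zspan T (a * c)) ->
  zspan S x -> zspan S' y -> zspan T (x * y).
Proof.
move=> h Sx Sy; elim: Sx => [a Sa||x1 x2 _ h1 _ h2].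
- elim: Sy => [c /(h _ _ Sa) //||y1 y2 _ h1 _ h2].
  + by rewrite mulr0; apply: zspan0.
  + by rewrite mulrBr; apply: zspanB.
- by rewrite mul0r; apply: zspan0.
- by rewrite mulrBl; apply: zspanB.
Qed.

Lemma zspan_sub (V : zmodType) (S T : V -> Prop) x :
  (forall y, S y -> zspan T y) -> zspan S x -> zspan T x.
Proof. by move=> h; apply: zspan_min => //; [apply: zspan0|apply: zspanB]. Qed.

HB.instance Definition _ (K : eqType) := gen_eqMixin (tree K).
HB.instance Definition _ (K : eqType) := gen_choiceMixin (tree K).

(** * Triangularity of Lie brackets along Lyndon words *)

Section LeadingTerms.
Variables (K : choiceType) (le : rel K).
Hypothesis le_total : total le.
Hypothesis le_trans : transitive le.
Hypothesis le_anti : antisymmetric le.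
Notation ltw := (ltw le).
Notation hall := (hall le).
Notation R := (frg K).

Fixpoint lie (t : tree K) : R :=
  match t with
  | Leaf x => wd [:: x]
  | Node t1 t2 => lie t1 * lie t2 - lie t2 * lie t1
  end.

Definition above u (x : R) : Prop :=
  exists w, [/\ size w = size u, ltw u w & x = wd w].

Definition from u (x : R) : Prop :=
  exists w, [/\ size w = size u, u = w \/ ltw u w & x = wd w].

Lemma from_above u x : zspan (above u) (x - wd u) -> zspan (from u) x.
Proof.
move=> h; rewrite -[x](subrK (wd u)); apply: zspanD.
  by apply: zspan_sub h => y [w [sw uw ->]]; apply: zspan_gen; exists w; split=> //; right.
by apply: zspan_gen; exists u; split=> //; left.
Qed.

(** In the bracket of subtrees with foliages u < v, the product in the given order starts at uv,
    while every word of the opposite product begins with a word at least v, and v > uv. *)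
Lemma hall_lead t : hall t -> zspan (above (fol t)) (lie t - wd (fol t)).
Proof.
elim: t => [x _|t1 h1 t2 h2 H]; first by rewrite /= subrr; apply: zspan0.
case: (H) => H1 H2 H3 _; set u := fol t1 in h1 H3 *; set v := fol t2 in h2 H3 *.
have {}h1 := h1 H1; have {}h2 := h2 H2; rewrite /= -/u -/v.
have uvv : ltw (u ++ v) v.
  exact: (proj2 (hall_lyndon le_trans le_anti H) u v erefl (fol_neq0 _) (fol_neq0 _)).
have f1 := from_above h1; have f2 := from_above h2.
have -> : lie t1 * lie t2 - lie t2 * lie t1 - wd (u ++ v) =
    lie t1 * (lie t2 - wd v) + (lie t1 - wd u) * wd v - lie t2 * lie t1.
  by rewrite mulrBr mulrBl -wdM addrA subrK addrAC.
apply: zspanB; first apply: zspanD.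
- apply: zspan_mul f1 h2 => _ _ [w [sw uw ->]] [w' [sw' vw' ->]]; rewrite -wdM.
  apply: zspan_gen; exists (w ++ w'); split=> //; first by rewrite !size_cat sw sw'.
  by case: uw => [<-|uw]; [rewrite ltw_cat2l|apply: ltw_cat; rewrite // sw].
- apply: (@zspan_mul _ _ (eq (wd v)) _ _ _ _ h1); last exact: zspan_gen.
  move=> _ _ [w [sw uw ->]] <-; rewrite -wdM.
  apply: zspan_gen; exists (w ++ v); split=> //; first by rewrite !size_cat sw.
  by apply: ltw_cat; rewrite // sw.
apply: zspan_mul f2 f1 => _ _ [w [sw vw ->]] [w' [sw' uw' ->]]; rewrite -wdM.
apply: zspan_gen; exists (w ++ w'); split=> //; first by rewrite !size_cat sw sw' addnC.
rewrite -[u ++ v]cats0; apply: ltw_cat; last by rewrite size_cat sw leq_addl.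
by case: vw => [<- //|vw]; apply: ltw_trans uvv vw.
Qed.

Lemma coeff_above u w x : zspan (above u) x -> ~~ ltw u w -> coeff w x = 0.
Proof.
move=> h uw; elim: h => [_ [w' [_ uw' ->]]||x1 x2 _ h1 _ h2].
- by rewrite coeff_wd; case: eqP => // e; rewrite -e uw' in uw.
- exact: coeff0.
- by rewrite coeffB h1 h2 subrr.
Qed.

Lemma coeff_lie t w : hall t -> ~~ ltw (fol t) w -> coeff w (lie t) = (fol t == w)%:R.
Proof.
move=> /hall_lead h tw; rewrite -[lie t](subrK (wd (fol t))) coeffD coeff_wd.
by rewrite (coeff_above h tw) add0r.
Qed.

Lemma ex_min_fol (s : seq (tree K)) : s != [::] ->
  exists2 t, t \in s & forall t', t' \in s -> ~~ ltw (fol t') (fol t).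
Proof.
elim: s => // t [|t' s] IH _.
  by exists t; rewrite ?inE // => t'; rewrite inE => /eqP ->; rewrite ltw_irr.
have [//|t0 t0s h] := IH.
have [tt|tt] := boolP (ltw (fol t) (fol t0)).
  exists t; first by rewrite inE eqxx.
  move=> t1; rewrite inE => /orP[/eqP ->|/h h1]; first by rewrite ltw_irr.
  by apply: contra h1 => /ltw_trans; apply.
exists t0; first by rewrite inE t0s orbT.
by move=> t1; rewrite inE => /orP[/eqP ->//|/h].
Qed.

(** Look at the tree of least foliage in the support: by triangularity and [hall_inj] no other tree
    contributes to the coefficient of that foliage. *)
Lemma lie_free (D : {freeg (tree K) / int}) :
  (forall t, t \in dom D -> hall t) -> fgl lie D = 0 -> D = 0.
Proof.
move=> hD D0; apply/eqP; rewrite -dom_eq0; apply/negP => /negP dD.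
have [t tD tmin] := ex_min_fol dD.
have : coeff (fol t) (fgl lie D) = coeff t D.
  rewrite -{1}(freeg_sumE D) raddf_sum raddf_sum (bigD1_seq t) ?uniq_dom //=.
  have E t' : coeff (fol t) (fgl lie << coeff t' D *g t' >>) =
      coeff t' D * coeff (fol t) (lie t').
    have -> : << coeff t' D *g t' >> = << t' >> *~ coeff t' D :> {freeg (tree K) / int}.
      by rewrite freeg_mulz intz.
    by rewrite [fgl lie _]raddfMz /= fglU raddfMz -mulrzl intz.
  rewrite E coeff_lie ?ltw_irr ?eqxx ?mulr1; [|exact: hD|by []].
  rewrite big1_seq ?addr0 // => t' /andP[tt t'D].
  rewrite E coeff_lie ?tmin //; last exact: hD.
  case: eqP => [/hall_inj e|_]; last by rewrite mulr0.
  by rewrite (e _ le_total le_trans le_anti (hD _ t'D) (hD _ tD)) ?eqxx // in tt.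
rewrite D0 coeff0 => /esym/eqP; apply/negP.
by rewrite -mem_dom.
Qed.
End LeadingTerms.

Lemma zspan_map (V W : zmodType) (f : {additive V -> W}) (S : V -> Prop) (T : W -> Prop) x :
  (forall y, S y -> zspan T (f y)) -> zspan S x -> zspan T (f x).
Proof.
move=> h; elim=> [y /h //||y z _ hy _ hz].
- by rewrite raddf0; apply: zspan0.
- by rewrite raddfB; apply: zspanB.
Qed.

(** * Collection of commutators into Hall trees *)

Section WordsOver.
Variables (K : eqType) (Y : seq K).

Fixpoint wds n : seq (seq K) :=
  if n is n'.+1 then [::] :: [seq x :: w | x <- Y, w <- wds n'] else [:: [::]].

Lemma mem_wds n w : (size w <= n)%N -> all (mem Y) w -> w \in wds n.
Proof.
elim: n w => [|n IH] [|x w] //= sw /andP[xY wY]; rewrite in_cons /=.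
by apply: allpairs_f => //; apply: IH.
Qed.
End WordsOver.

Lemma count_lt (T : eqType) (p q : pred T) s u :
  subpred p q -> u \in s -> ~~ p u -> q u -> (count p s < count q s)%N.
Proof.
move=> pq us pu qu; elim: s us => // x s IH; rewrite inE => /orP[/eqP <-|/IH h] /=.
  by rewrite (negPf pu) qu add0n add1n ltnS; apply: sub_count.
by apply: leq_ltn_trans (_ : (p x + count p s <= q x + count p s)%N) _;
  rewrite ?leq_add2r ?ltn_add2l //; case: (p x) (pq x) => // ->.
Qed.

Section HallSpan.
Variables (K : choiceType) (le : rel K).
Hypothesis le_total : total le.
Hypothesis le_trans : transitive le.
Hypothesis le_anti : antisymmetric le.
Notation ltw := (ltw le).
Notation hall := (hall le).
Variables (F : groupType) (b : K -> F).
Notation g k := (gamma_ k (nsgT F)).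
Notation cl k := (cl (g k) (g k.+1)).

Fixpoint com (t : tree K) : F :=
  match t with
  | Leaf x => b x
  | Node t1 t2 => [~ com t1, com t2]%g
  end.

Lemma fol_sizeS (t : tree K) : exists i, size (fol t) = i.+1.
Proof. by exists (size (fol t)).-1; rewrite prednK // fol_size. Qed.

Lemma com_gamma t : g (size (fol t)) (com t).
Proof.
elim: t => // t1 h1 t2 h2 /=; rewrite size_cat.
have [i ei] := fol_sizeS t1; have [j ej] := fol_sizeS t2.
by rewrite ei ej addSn addnS in h1 h2 *; apply: gamma_comm.
Qed.

Section Bracket.
Variable Y : seq K.

Definition hgen N v (z : zq (g N) (g N.+1)) : Prop :=
  exists t, [/\ hall t, size (fol t) = N, all (mem Y) (fol t), ltw (fol t) v &
    z = cl N (com t)].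

Lemma hgen_trans N u v z : ltw u v -> zspan (@hgen N u) z -> zspan (@hgen N v) z.
Proof.
move=> uv; apply: zspan_sub => _ [t [? ? ? tu ->]]; apply: zspan_gen; exists t.
by split=> //; apply: ltw_trans tu uv.
Qed.

(** The order on letters is only total and the alphabet may be infinite, so [ltw] need not be
    well-founded. Rewriting never leaves the letters [Y] of the given trees, and counting the words
    over [Y] below [v] gives a finite measure. *)
Definition rank N v := count (ltw^~ v) (wds Y N).

Lemma rank_lt N u v : (size u <= N)%N -> all (mem Y) u -> ltw u v ->
  (rank N u < rank N v)%N.
Proof.
move=> su uY uv; apply: (count_lt _ (mem_wds su uY)); rewrite ?ltw_irr //.
by move=> w wu; apply: ltw_trans uv.
Qed.

(* Well-founded induction on (total size, rank of the larger foliage): by the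
   Jacobi identity a bracket that is not standard is a combination of brackets
   with smaller maximal foliage. *)
Lemma hall_bracket N t1 t2 : hall t1 -> hall t2 ->
  all (mem Y) (fol t1) -> all (mem Y) (fol t2) -> ltw (fol t1) (fol t2) ->
  (size (fol t1) + size (fol t2))%N = N ->
  zspan (@hgen N (fol t2)) (cl N [~ com t1, com t2]%g).
Proof.
have [n] := ubnP (rank N (fol t2)); elim/ltn_ind: N n t1 t2 => N IHN.
elim=> // n IHn t1 t2 rk H1 H2 Y1 Y2 lt12 sN.
have std : hall (Node t1 t2) -> zspan (@hgen N (fol t2)) (cl N [~ com t1, com t2]%g).
  move=> H; apply: zspan_gen; exists (Node t1 t2); split=> //=.
  - by rewrite size_cat.
  - by rewrite all_cat Y1 Y2.
  - exact: (proj2 (hall_lyndon le_trans le_anti H) (fol t1) (fol t2) erefl (fol_neq0 _) (fol_neq0 _)).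
case: t1 H1 Y1 lt12 sN std => [x|ta tb] H1 Y1 lt12 sN std; first exact: std.
have [lbv|lbv] := boolP (ltw (fol tb) (fol t2)); last exact: std.
case: (H1) => Ha Hb lab _; move: Y1; rewrite /= all_cat => /andP[Ya Yb].
have lav : ltw (fol ta) (fol t2) by apply: ltw_trans lbv.
have both t t' : hall t -> hall t' -> all (mem Y) (fol t) -> all (mem Y) (fol t') ->
    ltw (fol t) (fol t2) -> ltw (fol t') (fol t2) -> (size (fol t) + size (fol t'))%N = N ->
    zspan (@hgen N (fol t2)) (cl N [~ com t, com t']%g).
  move=> Ht Ht' Yt Yt' lt lt' e.
  have go s s' : hall s -> hall s' -> all (mem Y) (fol s) -> all (mem Y) (fol s') ->
      ltw (fol s') (fol t2) -> ltw (fol s) (fol s') -> (size (fol s) + size (fol s'))%N = N ->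
      zspan (@hgen N (fol t2)) (cl N [~ com s, com s']%g).
    move=> Hs Hs' Ys Ys' ls lss es; apply: (hgen_trans ls); apply: IHn => //.
    have ss' : (size (fol s') <= N)%N by rewrite -es leq_addl.
    exact: leq_trans (rank_lt ss' Ys' ls) rk.
  case: (ltw_total le_total (fol t) (fol t')) => [h|/(hall_inj le_total le_trans le_anti Ht Ht') ->|h].
  - exact: go.
  - by rewrite commgg cl1; apply: zspan0.
  - rewrite -commgVJ clV; first by apply/zspanN/go => //; rewrite addnC.
    have [p ep] := fol_sizeS t; have [q eq] := fol_sizeS t'.
    have := com_gamma t; have := com_gamma t'; rewrite -e ep eq addSn addnS addnC => h1 h2.
    exact: gamma_comm.
have [i ei] := fol_sizeS ta; have [j ej] := fol_sizeS tb; have [k ek] := fol_sizeS t2.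
have ga := com_gamma ta; have gb := com_gamma tb; have gv := com_gamma t2.
rewrite ei in ga; rewrite ej in gb; rewrite ek in gv.
have eN : N = (i + j + k).+3 by rewrite -sN /= size_cat ei ej ek; lia.
rewrite /= (cl_jacobi (fun _ h => h) eN ga gb gv); apply: zspanD.
  have hd : N = ((i + k).+1 + j).+2 by rewrite eN; lia.
  have gav : g (i + k).+2 [~ com ta, com t2]%g by apply: gamma_comm.
  rewrite -(bracketrE hd (fun _ h => h) gb gav).
  have h : zspan (@hgen (i + k).+2 (fol t2)) (cl (i + k).+2 [~ com ta, com t2]%g).
    apply: (IHN _ _ (rank (i + k).+2 (fol t2)).+1) => //; [by rewrite eN; lia|by rewrite ei ek; lia].
  apply: zspan_map h => _ [t [Ht st Yt lt ->]].
  have gt : g (i + k).+2 (com t) by rewrite -st; apply: com_gamma.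
  rewrite (bracketrE hd (fun _ h => h) gb gt); apply: both => //.
  by rewrite st ej eN; lia.
have hd : N = (i + (j + k).+1).+2 by rewrite eN; lia.
have gbv : g (j + k).+2 [~ com tb, com t2]%g by apply: gamma_comm.
rewrite -(bracketlE hd (fun _ h => h) ga gbv).
have h : zspan (@hgen (j + k).+2 (fol t2)) (cl (j + k).+2 [~ com tb, com t2]%g).
  apply: (IHN _ _ (rank (j + k).+2 (fol t2)).+1) => //; [by rewrite eN; lia|by rewrite ej ek; lia].
apply: zspan_map h => _ [t [Ht st Yt lt ->]].
have gt : g (j + k).+2 (com t) by rewrite -st; apply: com_gamma.
rewrite (bracketlE hd (fun _ h => h) ga gt); apply: both => //.
by rewrite st ei eN; lia.
Qed.
End Bracket.
End HallSpan.

(** * Dimension subgroups of a free group *)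

Section MagnusTheorem.
Variables (K : choiceType) (le : rel K).
Hypothesis le_total : total le.
Hypothesis le_trans : transitive le.
Hypothesis le_anti : antisymmetric le.
Notation hall := (hall le).
Variables (F : groupType) (b : K -> F).
Hypothesis bF : free_on b.
Notation g k := (gamma_ k (nsgT F)).
Notation cl k := (cl (g k) (g k.+1)).
Notation ld := (ld bF).
Notation mu := (mu bF).
Notation com := (com b).

Definition hall_cl k (z : zq (g k) (g k.+1)) : Prop :=
  exists t, [/\ hall t, size (fol t) = k & z = cl k (com t)].

Lemma hall_cl_comm k t t' : hall t -> hall t' -> (size (fol t) + size (fol t'))%N = k ->
  zspan (@hall_cl k) (cl k [~ com t, com t']%g).
Proof.
have go s s' : hall s -> hall s' -> ltw le (fol s) (fol s') ->
    (size (fol s) + size (fol s'))%N = k -> zspan (@hall_cl k) (cl k [~ com s, com s']%g).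
  move=> Hs Hs' lss e; pose Y := fol s ++ fol s'.
  have Ys : all (mem Y) (fol s) by apply/allP => x xs; rewrite /= mem_cat xs.
  have Ys' : all (mem Y) (fol s') by apply/allP => x xs; rewrite /= mem_cat xs orbT.
  have := hall_bracket le_total le_trans le_anti b Hs Hs' Ys Ys' lss e.
  by apply: zspan_sub => _ [u [? ? _ _ ->]]; apply: zspan_gen; exists u.
move=> H H' e; case: (ltw_total le_total (fol t) (fol t')) => [h|h|h].
- exact: go.
- by rewrite (hall_inj le_total le_trans le_anti H H' h) commgg cl1; apply: zspan0.
rewrite -commgVJ clV; first by apply/zspanN/go => //; rewrite addnC.
have [p ep] := fol_sizeS t; have [q eq] := fol_sizeS t'.
have := com_gamma b t; have := com_gamma b t'; rewrite -e ep eq addSn addnS addnC => h1 h2.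
exact: gamma_comm.
Qed.

(** By bilinearity a generator [x, y] reduces to brackets of a letter with Hall trees of the
    previous weight, which [hall_cl_comm] collects. *)
Lemma gamma_hall k w : g k.+1 w -> zspan (@hall_cl k.+1) (cl k.+1 w).
Proof.
have base u : zspan (@hall_cl 1) (cl 1 u).
  elim/(free_ind bF): u => [|x y hx hy|x hx|x].
  - by rewrite cl1; apply: zspan0.
  - by rewrite clM //; apply: zspanD.
  - by rewrite clV //; apply: zspanN.
  - by apply: zspan_gen; exists (Leaf x).
elim: k w => [|k IH] w gw; first exact: base.
(* Membership is carried through the induction because [cl] is additive only on its subgroup and is
   junk outside it. *)
suff [] : g k.+2 w /\ zspan (@hall_cl k.+2) (cl k.+2 w) by [].
elim: gw => {w} [_ [x [y [gx gy ->]]]||x y _ [gx hx] _ [gy hy]|x _ [gx hx]].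
- split; first exact: gamma_comm1.
  have hd : k.+2 = (0 + k).+2 by [].
  rewrite -(bracketlE hd (fun _ h => h) (gx : g 1 x) gy).
  apply: zspan_map (IH y gy) => _ [t [Ht st ->]].
  have gt : g k.+1 (com t) by rewrite -st; apply: com_gamma.
  rewrite (bracketlE hd (fun _ h => h) (gx : g 1 x) gt) -(bracketrE hd (fun _ h => h) gt gx).
  apply: zspan_map (base x) => _ [t' [Ht' st' ->]].
  rewrite (bracketrE hd (fun _ h => h) gt I); apply: hall_cl_comm => //.
  by rewrite st st'.
- by split; [apply: nsg1|rewrite cl1; apply: zspan0].
- by split; [apply: nsgM|rewrite clM //; apply: zspanD].
- by split; [apply: nsgV|rewrite clV //; apply: zspanN].
Qed.

Lemma ld_com t : ld (size (fol t)) (com t) = lie t.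
Proof.
elim: t => [x|t1 h1 t2 h2] /=.
  by rewrite /ld muBE rmorph1 s1E subr0 mu_b /= mul1r.
have [p ep] := fol_sizeS t1; have [q eq] := fol_sizeS t2.
have := com_gamma b t1; have := com_gamma b t2; rewrite size_cat.
rewrite ep eq in h1 h2 *; move=> g2 g1.
by rewrite addSn addnS ld_comm ?h1 ?h2 //; apply: ld_low.
Qed.

Lemma ld_gammaS k w : g k.+2 w -> ld k.+1 w = 0.
Proof. by move/ld_low => h; apply: h. Qed.

Definition ldq k : {additive zq (g k.+1) (g k.+2) -> frg K} :=
  zq_lift (fun x y gx gy => ldM (ld_low bF gx) (ld_low bF gy)) (fun x _ gx => ld_gammaS gx).

Lemma ldqE k w : g k.+1 w -> ldq k (cl k.+1 w) = ld k.+1 w.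
Proof. by move=> gw; rewrite /ldq zq_liftE. Qed.

(** Hall trees span gamma_{k+1} modulo gamma_{k+2} and their leading coefficients are independent,
    so taking leading coefficients is injective on this quotient. *)
Lemma ld_eq0 k w : g k.+1 w -> ld k.+1 w = 0 -> g k.+2 w.
Proof.
move=> gw; rewrite -(ldqE gw) => l0.
apply: (cl_eq0 _ gw); first by move=> x y gx gy; apply: gamma_comm1.
have [D [hD DE DL]] : exists D : {freeg (tree K) / int},
    [/\ forall t, t \in dom D -> hall t, cl k.+1 w = fgl (fun t => cl k.+1 (com t)) D &
        ldq k (cl k.+1 w) = fgl (@lie K) D].
  elim: (gamma_hall gw) => [_ [t [Ht st ->]]||x y _ [D [hD -> DL]] _ [D' [hD' -> DL']]].
  - exists << t >>; rewrite !fglU ldqE -?st ?ld_com //; last exact: com_gamma.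
    by split=> // t'; rewrite domU1 inE => /eqP ->.
  - by exists 0; rewrite !raddf0; split=> // t; rewrite dom0.
  - exists (D - D'); rewrite [ldq k _]raddfB DL DL' !raddfB.
    by split=> // t /domB; rewrite mem_cat => /orP[/hD|/hD'].
by rewrite DE (lie_free le_total le_trans le_anti hD) ?raddf0 // -DL.
Qed.

(** Each vanishing coefficient moves [w] one step down the lower central series through [ld_eq0]. *)
Lemma magnus k w : low k.+1 (mu (gr w - 1)) -> g k.+1 w.
Proof.
elim: k => [//|k IH] h; apply: ld_eq0; last exact: h.
by apply: IH; apply: low_le h.
Qed.
End MagnusTheorem.

(** * Lower central quotients of the free metabelian group *)

Section Metabelian.
Variables (K : choiceType) (le : rel K).
Hypothesis le_total : total le.
Hypothesis le_trans : transitive le.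
Hypothesis le_anti : antisymmetric le.
Variables (F : groupType) (b : K -> F).
Hypothesis bF : free_on b.
Notation g k := (gamma_ k (nsgT F)).
Notation ld := (ld bF).
Notation mu := (mu bF).
Notation F' := (derived (nsgT F)).
Notation F'' := (derived F').
Notation R := (frg K).
Notation sort := (sort le).

Lemma sort_eq s t : perm_eq s t -> sort s = sort t.
Proof. by move/(perm_sortP le_total le_trans le_anti). Qed.

(** The projection from the tensor algebra to the symmetric algebra, the latter realised by sorted
    words. *)
Definition srt : {additive R -> R} := flin (fun s => wd (sort s)).
(* The retraction of A^(k+1) onto A (x) S^k(A), the symmetric power being
   embedded by sorted words. *)
Definition tau : {additive R -> R} :=
  flin (fun s => if s is x :: t then wd (x :: sort t) else wd [::]).

Lemma srtE s : srt (wd s) = wd (sort s). Proof. exact: flinE. Qed.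
Lemma tau_cons x s : tau (wd (x :: s)) = wd (x :: sort s). Proof. exact: flinE. Qed.
Lemma tau_nil : tau 1 = 1. Proof. exact: (flinE _ [::]). Qed.

Lemma srt_swap u P Q v : srt (wd u * (P * Q) * wd v) = srt (wd u * (Q * P) * wd v).
Proof.
elim/frg_ind: P => [|P P' hP hP'|s]; first by rewrite !(mul0r, mulr0).
  by rewrite !(mulrBl, mulrBr) !raddfB hP hP'.
elim/frg_ind: Q => [|Q Q' hQ hQ'|t]; first by rewrite !(mul0r, mulr0).
  by rewrite !(mulrBl, mulrBr) !raddfB hQ hQ'.
rewrite -!wdM !srtE; congr wd; apply: sort_eq.
by rewrite perm_cat2r perm_cat2l perm_catC.
Qed.

Lemma srt_swap4 U P Q V : srt (U * (P * Q) * V) = srt (U * (Q * P) * V).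
Proof.
elim/frg_ind: U => [|U U' hU hU'|u]; first by rewrite !mul0r.
  by rewrite !mulrBl !raddfB hU hU'.
elim/frg_ind: V => [|V V' hV hV'|v]; first by rewrite !mulr0.
  by rewrite !mulrBr !raddfB hV hV'.
exact: srt_swap.
Qed.

Lemma srt_mulr P Q : srt (P * Q) = srt (P * srt Q).
Proof.
elim/frg_ind: P => [|P P' hP hP'|s]; first by rewrite !mul0r.
  by rewrite !mulrBl !raddfB hP hP'.
elim/frg_ind: Q => [|Q Q' hQ hQ'|t]; first by rewrite raddf0 mulr0.
  by rewrite [srt (Q - Q')]raddfB !mulrBr !raddfB hQ hQ'.
rewrite srtE -!wdM !srtE; congr wd; apply: sort_eq.
by rewrite perm_cat2l perm_sym perm_sort.
Qed.

Lemma srt_mull P Q : srt (P * Q) = srt (srt P * Q).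
Proof.
have := srt_swap4 1 P Q 1; rewrite !mulr1 !mul1r => ->; rewrite srt_mulr.
by have := srt_swap4 1 Q (srt P) 1; rewrite !mulr1 !mul1r.
Qed.

Lemma tau_mull P Q : tau (P * Q) = tau (tau P * Q).
Proof.
elim/frg_ind: P => [|P P' hP hP'|s]; first by rewrite raddf0 mul0r.
  by rewrite [tau (P - P')]raddfB !mulrBl !raddfB hP hP'.
case: s => [|x s]; first by rewrite wd0 tau_nil.
elim/frg_ind: Q => [|Q Q' hQ hQ'|t]; first by rewrite !mulr0.
  by rewrite !mulrBr !raddfB hQ hQ'.
rewrite tau_cons -!wdM !cat_cons !tau_cons; congr (wd (_ :: _)); apply: sort_eq.
by rewrite perm_cat2r perm_sym perm_sort.
Qed.

Lemma tau_letter x P : tau (wd [:: x] * P) = wd [:: x] * srt P.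
Proof.
elim/frg_ind: P => [|P P' hP hP'|s]; first by rewrite raddf0 mulr0 raddf0.
  by rewrite [srt _]raddfB !mulrBr !raddfB hP hP'.
by rewrite srtE -!wdM tau_cons.
Qed.

Lemma srt_fhom k P : fhom k P -> fhom k (srt P).
Proof.
elim=> [_ [s ss ->]||x y _ hx _ hy].
- by rewrite srtE -ss -(size_sort le s); apply: fhom_wd.
- by rewrite raddf0; apply: zspan0.
- by rewrite (raddfB srt); apply: zspanB.
Qed.

(** Since P has positive degree it supplies the unsorted first letter, so Q enters through its
    symmetrization alone. *)
Lemma tau_fhomM P Q k : fhom k.+1 P -> srt Q = 0 -> tau (P * Q) = 0.
Proof.
move=> hP Q0; elim: hP => [_ [s ss ->]||P1 P2 _ h1 _ h2].
- case: s ss => // x s _; rewrite wd_cons -mulrA tau_letter srt_mulr Q0 mulr0.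
  by rewrite raddf0 mulr0.
- by rewrite mul0r raddf0.
- by rewrite mulrBl raddfB h1 h2 subrr.
Qed.

Lemma tau_fhom1 P Q : fhom 1 P -> tau (P * Q) = P * srt Q.
Proof.
elim=> [_ [s ss ->]||P1 P2 _ h1 _ h2].
- by case: s ss => [|x [|]] // _; apply: tau_letter.
- by rewrite !mul0r raddf0.
- by rewrite !mulrBl raddfB h1 h2.
Qed.

(** Identifies F_ab with the free abelian group on the letters through the linear Magnus
    coefficient; [unl] recovers the class from it. *)
Definition ell : {additive ab F -> R} :=
  ab_lift (fun x y => ldM (ld_low bF (I : g 1 x)) (ld_low bF (I : g 1 y))).

Lemma ellE w : ell (ab_pi w) = ld 1 w. Proof. exact: ab_liftE. Qed.

Lemma ld_b x : ld 1 (b x) = wd [:: x].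
Proof. exact: (ld_com bF (Leaf x)). Qed.

Lemma ell_b x : ell (ab_pi (b x)) = wd [:: x]. Proof. by rewrite ellE ld_b. Qed.

Lemma ell_fhom a : fhom 1 (ell a).
Proof. by elim/ab_pi_ind: a => w; rewrite ellE; apply: mu_fhom. Qed.

Definition unl : {additive R -> ab F} :=
  flin (fun s => if s is [:: x] then ab_pi (b x) else 0).

Lemma unl_wd x : unl (wd [:: x]) = ab_pi (b x). Proof. exact: flinE. Qed.

Lemma ellK a : unl (ell a) = a.
Proof.
elim/ab_pi_ind: a => w; elim/(free_ind bF): w => [|x y hx hy|x hx|x].
- by have -> : ab_pi 1%g = 0 :> ab F; rewrite ?raddf0.
- by rewrite ab_piM !raddfD hx hy.
- by rewrite ab_piV !raddfN hx.
- by rewrite ell_b unl_wd.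
Qed.

Definition piS (x : R) : symalg (ab F) := frmap (fun k => gl _ (ab_pi (b k))) x.
HB.instance Definition _ :=
  GRing.RMorphism.copy piS (frmap (fun k => gl _ (ab_pi (b k)) : symalg (ab F))).

Lemma piS1 x : piS (wd [:: x]) = gl _ (ab_pi (b x)). Proof. exact: frmap1. Qed.

Let gam_word (s : seq (ab F)) : R := srt (\prod_(a <- s) ell a).

Let gam_wordD s t x y :
  gam_word (s ++ (x + y) :: t) = gam_word (s ++ x :: t) + gam_word (s ++ y :: t).
Proof.
by rewrite /gam_word !big_cat !big_cons /= [ell (x + y)]raddfD mulrDl mulrDr raddfD.
Qed.

Let gam_wordS s t x y : gam_word (s ++ [:: x, y & t]) = gam_word (s ++ [:: y, x & t]).
Proof.
by rewrite /gam_word !big_cat !big_cons /= ![_ * (_ * \prod_(_ <- t) _)]mulrA !mulrA -2![srt (_ * _ * _ * _)]/(srt (_ * _ * _ * _)) -(mulrA _ (ell x)) -(mulrA _ (ell y)) srt_swap4.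
Qed.

(** Embeds the symmetric algebra of F_ab by sorted words. Through [Gam_piS], an element whose image
    in that algebra is zero has zero [srt]. *)
Definition Gam : {additive symalg (ab F) -> R} :=
  galg_lift (rho := fun _ _ => False) gam_wordD gam_wordS
    (fun _ _ _ _ (e : False) => False_ind _ e).

Lemma Gam_gw s : Gam (gw _ s) = srt (\prod_(a <- s) ell a).
Proof. exact: galg_liftE. Qed.

Lemma Gam_piS x : Gam (piS x) = srt x.
Proof.
elim/frg_ind: x => [|x y hx hy|s]; first by rewrite !raddf0.
  have -> : piS (x - y) = piS x - piS y by apply: raddfB.
  by rewrite !raddfB hx hy.
have -> : piS (wd s) = gw _ [seq ab_pi (b k) | k <- s].
  by rewrite gwE big_map; apply: frmapE.
rewrite Gam_gw big_map; suff -> : \prod_(i <- s) ell (ab_pi (b i)) = wd s by [].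
elim: s => [|x s IH]; first by rewrite big_nil.
by rewrite big_cons IH ell_b -wd_cons.
Qed.

(** Over the commutative ring Sym(F_ab) the series commute, so commutators expand to 1; hence all
    positive-degree coefficients of elements of F' have zero symmetrization. *)
Lemma smu_derived w : F' w -> series_map piS (mu (gr w)) = 1.
Proof.
pose S u := series_map piS (mu (gr u)).
have SM x y : S (x * y)%g = S x * S y by rewrite /S grM rmorphM series_mapM.
have S1 : S 1%g = 1 by rewrite /S gr1 rmorph1 series_map1.
rewrite -/(S w); elim=> {w} [_ [x [y [_ _ ->]]]||x y _ hx _ hy|x _ hx].
- rewrite /commg /conjg !SM [S x * S y]smulC !mulrA -(mulrA _ (S y^-1)%g) -SM.
  by rewrite mulVg S1 mulr1 -SM mulVg.
- exact: S1.
- by rewrite SM hx hy mulr1.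
- by have := SM x x^-1%g; rewrite mulgV S1 hx mul1r => <-.
Qed.

Lemma srt_derived w k : F' w -> srt (mu (gr w) k.+1) = 0.
Proof.
move=> /smu_derived e; rewrite -Gam_piS.
have -> : piS (mu (gr w) k.+1) = series_map piS (mu (gr w)) k.+1 by [].
by rewrite e s1E raddf0.
Qed.

Lemma ldS k w : ld k.+1 w = mu (gr w) k.+1.
Proof. by rewrite /ld muBE rmorph1 s1E subr0. Qed.

Lemma srt_ld w k : F' w -> srt (ld k.+1 w) = 0.
Proof. by rewrite ldS; apply: srt_derived. Qed.

(** Additivity holds on all of F', in every degree: a mixed term has a left factor of positive
    degree and a right factor of zero symmetrization. This matters because an element of F'' /\
    gamma_k is a product of commutators that need not lie in gamma_k themselves. *)
Lemma tau_derivedM x y k : F' x -> F' y ->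
  tau (ld k.+1 (x * y)%g) = tau (ld k.+1 x) + tau (ld k.+1 y).
Proof.
move=> Fx Fy; rewrite !ldS grM rmorphM smulE big_ord_recl big_ord_recr /=.
rewrite mu_gr0 mul1r subn0 addrC !raddfD raddf_sum /bump /= add1n subnn mu_gr0 mulr1.
rewrite big1 => [|i _]; first by rewrite ?add0r ?addr0 addrC.
rewrite (@tau_fhomM _ _ i) //; first exact: mu_fhom.
have hi := ltn_ord i; have -> : (k.+1 - bump 0 i)%N = (k - i).-1.+1 by rewrite /bump; lia.
exact: srt_derived.
Qed.

(** A homomorphism from F' to an abelian group kills F''. *)
Lemma tau_derived2 w k : F'' w -> tau (ld k.+1 w) = 0.
Proof.
pose S u := tau (ld k.+1 u).
have S1 : S 1%g = 0 by rewrite /S /ld gr1 subrr mu0E raddf0.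
have SV x : F' x -> S x^-1%g = - S x.
  move=> Fx; apply/eqP; rewrite -addr_eq0 /S -tau_derivedM //; last exact: nsgV.
  by rewrite mulVg -/(S _) S1.
rewrite -/(S w) => h.
suff [] : F' w /\ S w = 0 by [].
elim: h => {w} [_ [x [y [Fx Fy ->]]]||x y _ [Fx hx] _ [Fy hy]|x _ [Fx hx]].
- have Fxy : F' (x * y)%g by apply: nsgM.
  have Fyx : F' (y * x)%g by apply: nsgM.
  have -> : [~ x, y]%g = ((y * x)^-1 * (x * y))%g by rewrite /commg /conjg invgM !mulgA.
  split; first by apply/nsgM/Fxy/nsgV.
  rewrite /S tau_derivedM //; last exact: nsgV.
  by rewrite -/(S _) SV // /S !tau_derivedM // addrC [tau (ld _ y) + _]addrC subrr.
- by split; [apply: nsg1|].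
- by split; [apply: nsgM|rewrite /S tau_derivedM // -!/(S _) hx hy addr0].
- by split; [apply: nsgV|rewrite SV // hx oppr0].
Qed.
End Metabelian.

(** * Left-normed commutators modulo the second derived subgroup *)

Section MetabelianQuotient.
Variable F : groupType.
Notation g k := (gamma_ k (nsgT F)).
Notation F' := (derived (nsgT F)).
Notation F'' := (derived F').

Definition mgamma k : nsubgroup F := nsgMul (nsgI F'' (g k)) (g k.+1).
Notation clm k := (cl (g k) (mgamma k)).

Lemma mgammaS k x : g k.+1 x -> mgamma k x.
Proof. by move=> gx; exists 1%g, x; rewrite mul1g; split=> //; apply: nsg1. Qed.

Lemma mgamma_F2 k x : F'' x -> g k x -> mgamma k x.
Proof. by move=> Fx gx; exists x, 1%g; rewrite mulg1; split=> //; apply: nsg1. Qed.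

Definition foldc (c : F) (s : seq F) : F := foldl (fun c z => [~ c, z]%g) c s.

Lemma foldc_gamma k c s : g k.+1 c -> g (k + size s).+1 (foldc c s).
Proof.
elim: s k c => [|z s IH] k c gc; first by rewrite addn0.
rewrite addnS -addSn; apply: IH.
by have := gamma_comm gc (I : g 1 z); rewrite addn0.
Qed.

Lemma derived_comm c z : F' c -> F' [~ c, z]%g.
Proof. by move=> Fc; rewrite -commgVJ; apply/nsgV/(@nsgR_sub _ (nsgT F))/nsgR_comm. Qed.

Lemma foldc_derived c s : F' c -> F' (foldc c s).
Proof. by elim: s c => //= z s IH c Fc; apply/IH/derived_comm. Qed.

Lemma foldc1 s : foldc 1%g s = 1%g.
Proof. by elim: s => //= z s IH; rewrite comm1g. Qed.

Let hd k : k.+2 = (k + 0).+2. Proof. by rewrite addn0. Qed.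

Let brq_M k z x y : g k.+1 x -> g k.+1 y ->
  clm k.+2 [~ x * y, z]%g = clm k.+2 [~ x, z]%g + clm k.+2 [~ y, z]%g.
Proof.
by move=> gx gy; apply: (@cl_commMl _ k 0) => // w; apply: mgammaS.
Qed.

Let brq_0 k z x : g k.+1 x -> mgamma k.+1 x -> clm k.+2 [~ x, z]%g = 0.
Proof.
move=> gx [u [v [[Fu gu] gv xE]]]; rewrite xE brq_M //; last exact: gammaS_sub.
have gz (w : F) j : g j.+1 w -> g j.+2 [~ w, z]%g.
  by move=> gw; have := gamma_comm gw (I : g 1 z); rewrite addn0.
rewrite (cl0 _ (mgammaS (gz _ _ gv))) addr0; apply/cl0/mgamma_F2; last exact: gz.
have -> : [~ u, z]%g = (u^-1 * u ^ z)%g by [].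
by apply: nsgM; [apply: nsgV|apply: nsgJ].
Qed.

Definition brq k z : {additive zq (g k.+1) (mgamma k.+1) -> zq (g k.+2) (mgamma k.+2)} :=
  zq_lift (fun x y gx gy => brq_M z gx gy) (fun x gx mx => brq_0 z gx mx).

Lemma brqE k z x : g k.+1 x -> brq k z (clm k.+1 x) = clm k.+2 [~ x, z]%g.
Proof. by move=> gx; rewrite /brq zq_liftE. Qed.

(** Bracketing with a fixed element descends to classes modulo [mgamma] ([brq]), so a linear
    relation between heads survives any tail. *)
Lemma foldc_rel k s c c1 c2 : g k.+1 c -> g k.+1 c1 -> g k.+1 c2 ->
  clm k.+1 c = clm k.+1 c1 - clm k.+1 c2 ->
  clm (k + size s).+1 (foldc c s) =
    clm (k + size s).+1 (foldc c1 s) - clm (k + size s).+1 (foldc c2 s).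
Proof.
elim: s k c c1 c2 => [|z s IH] k c c1 c2 gc gc1 gc2 e; first by rewrite addn0.
have gz w : g k.+1 w -> g k.+2 [~ w, z]%g.
  by move=> gw; have := gamma_comm gw (I : g 1 z); rewrite addn0.
rewrite addnS -addSn; apply: IH; try exact: gz.
by rewrite -!brqE // e raddfB.
Qed.

Lemma foldc_cat c s t : foldc c (s ++ t) = foldc (foldc c s) t.
Proof. exact: foldl_cat. Qed.

(** By the Jacobi identity the two sides differ by [c, [z, z']], which lies in F''. *)
Lemma clm_swap k c z z' : F' c -> g k.+1 c ->
  clm k.+3 [~ [~ c, z], z']%g = clm k.+3 [~ [~ c, z'], z]%g.
Proof.
move=> Fc gc; have e : k.+3 = (k + 0 + 0).+3 by rewrite !addn0.
rewrite (cl_jacobi (@mgammaS k.+3) e gc (I : g 1 z) (I : g 1 z')).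
rewrite [X in _ + X]cl0 ?addr0 //; apply: mgamma_F2.
  by apply: nsgR_comm => //; apply: nsgR_comm.
have := gamma_comm gc (gamma_comm1 z (I : g 1 z')); by rewrite addnS addn0.
Qed.

Lemma perm_invariant (T : eqType) (V : Type) (f : seq T -> V) :
  (forall s t x y, f (s ++ [:: x, y & t]) = f (s ++ [:: y, x & t])) ->
  forall s t, perm_eq s t -> f s = f t.
Proof.
move=> sw.
have mv x u w v : f (w ++ x :: u ++ v) = f (w ++ u ++ x :: v).
  elim: u w => //= y u IH w; rewrite sw.
  by have := IH (rcons w y); rewrite !cat_rcons.
suff H s w t : perm_eq s t -> f (w ++ s) = f (w ++ t) by move=> s t /(H s [::]).
elim: s w t => [|x s IH] w t; first by case: t => // y t /perm_size.
move=> p; have xt : x \in t by rewrite -(perm_mem p) mem_head.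
case/splitPr: xt p => t1 t2; rewrite -mv.
rewrite perm_sym -(cat1s x) perm_catCA /= perm_cons perm_sym => p.
by have := IH (rcons w x) (t1 ++ t2) p; rewrite !cat_rcons.
Qed.

Lemma foldc_perm k c s t : F' c -> g k.+1 c -> perm_eq s t ->
  clm (k + size s).+1 (foldc c s) = clm (k + size s).+1 (foldc c t).
Proof.
move=> Fc gc; move sn : (size s) => n.
(* [perm_invariant] concerns a function on all lists, while the degree is fixed here; lists of
   another length get the dummy value 0. *)
suff H : forall s t, perm_eq s t ->
    (if size s == n then clm (k + n).+1 (foldc c s) else 0) =
    (if size t == n then clm (k + n).+1 (foldc c t) else 0).
  by move=> p; have := H s t p; rewrite -(perm_size p) sn eqxx.
apply: perm_invariant => {sn}s {}t x y; rewrite !size_cat /=.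
case: eqP => // e; rewrite -e !foldc_cat /=.
have gs := foldc_gamma s gc; have Fs := foldc_derived s Fc.
have gz w j z : g j.+1 w -> g j.+2 [~ w, z]%g.
  by move=> gw; have := gamma_comm gw (I : g 1 z); rewrite addn0.
have e2 : (k + (size s + (size t).+2) = (k + size s).+2 + size t)%N by lia.
rewrite e2 (@foldc_rel _ t _ [~ [~ foldc c s, y], x]%g 1%g).
- by rewrite foldc1 cl1 subr0.
- exact/gz/gz.
- exact/gz/gz.
- exact: nsg1.
- by rewrite cl1 subr0; apply: clm_swap.
Qed.

Section LeftNormed.
Variables (K : choiceType) (b : K -> F).
Hypothesis bF : free_on b.

Definition lc x y s : F := foldc [~ b x, b y]%g (map b s).

Lemma lc_base x y : g 2 [~ b x, b y]%g. Proof. exact: gamma_comm1. Qed.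

Lemma lc_gamma x y s : g (size s).+2 (lc x y s).
Proof. by have := foldc_gamma (map b s) (lc_base x y); rewrite size_map. Qed.

Notation beta k x y s := (clm k (lc x y s)).

Lemma lc_perm x y s t : perm_eq s t -> beta (size s).+2 x y s = beta (size s).+2 x y t.
Proof.
move=> p; have := @foldc_perm 1 [~ b x, b y]%g _ _ (lc_base x y) (lc_base x y) (perm_map b p).
by rewrite size_map.
Qed.

Lemma lc_anti x y s : beta (size s).+2 x y s = - beta (size s).+2 y x s.
Proof.
have := @foldc_rel 1 (map b s) [~ b x, b y]%g 1%g [~ b y, b x]%g (lc_base x y) (nsg1 _) (lc_base y x).
rewrite foldc1 !cl1 !sub0r size_map; apply.
by rewrite -commgVJ clV //; apply: lc_base.
Qed.

Lemma lc_diag x s : lc x x s = 1%g.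
Proof. by rewrite /lc commgg foldc1. Qed.

Lemma lc_jacobi x y z s : beta (size s).+3 x y (z :: s) =
  beta (size s).+3 x z (y :: s) - beta (size s).+3 y z (x :: s).
Proof.
have gz c z' : g 2 c -> g 3 [~ c, z']%g by move=> gc; apply: (gamma_comm gc (I : g 1 z')).
have := @foldc_rel 2 (map b s) [~ [~ b x, b y], b z]%g [~ [~ b x, b z], b y]%g [~ [~ b y, b z], b x]%g.
rewrite size_map; apply; try by apply/gz/lc_base.
rewrite (@cl_jacobi _ 3 _ (@mgammaS 3) 0 0 0) //; congr (_ + _).
by rewrite -commgVJ clV //; apply/gz/lc_base.
Qed.

(** A generator of gamma_{k+2} has an arbitrary element on the left. Inverting the commutator moves
    it to the right, where bilinearity replaces it by basis letters appended to the list. *)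
Lemma gamma_lc k w : g k.+2 w ->
  zspan (fun z => exists x y s, size s = k /\ z = cl (g k.+2) (g k.+3) (lc x y s))
    (cl (g k.+2) (g k.+3) w).
Proof.
have base u : zspan (fun z => exists x, z = cl (g 1) (g 2) (b x)) (cl (g 1) (g 2) u).
  elim/(free_ind bF): u => [|x y hx hy|x hx|x].
  - by rewrite cl1; apply: zspan0.
  - by rewrite clM //; apply: zspanD.
  - by rewrite clV //; apply: zspanN.
  - by apply: zspan_gen; exists x.
have step (k' : nat) (S : zq (g k'.+1) (g k'.+2) -> Prop) (T : zq (g k'.+2) (g k'.+3) -> Prop) :
    (forall y, g k'.+1 y -> zspan S (cl (g k'.+1) (g k'.+2) y)) ->
    (forall z, S z -> exists2 y, g k'.+1 y & z = cl (g k'.+1) (g k'.+2) y /\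
       forall x, zspan T (cl (g k'.+2) (g k'.+3) [~ y, b x]%g)) ->
    forall v, g k'.+2 v -> zspan T (cl (g k'.+2) (g k'.+3) v).
  move=> hS hT v gv; suff [] : g k'.+2 v /\ zspan T (cl (g k'.+2) (g k'.+3) v) by [].
  elim: gv => {v} [_ [x [y [gx gy ->]]]||x y _ [gx hx] _ [gy hy]|x _ [gx hx]].
  - split; first exact: gamma_comm1.
    have hd' : k'.+2 = (k' + 0).+2 by rewrite addn0.
    rewrite -commgVJ clV; last by have := gamma_comm gy (gx : g 1 x); rewrite addn0.
    apply: zspanN; rewrite -(bracketrE hd' (fun _ h => h) (gx : g 1 x) gy).
    apply: zspan_map (hS y gy) => _ /hT [y' gy' [-> h]].
    rewrite (bracketrE hd' (fun _ h => h) (gx : g 1 x) gy').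
    rewrite -(bracketlE hd' (fun _ h => h) gy' (gx : g 1 x)).
    apply: zspan_map (base x) => _ [x' ->].
    by rewrite (bracketlE hd' (fun _ h => h) gy' I).
  - by split; [apply: nsg1|rewrite cl1; apply: zspan0].
  - by split; [apply: nsgM|rewrite clM //; apply: zspanD].
  - by split; [apply: nsgV|rewrite clV //; apply: zspanN].
elim: k w => [|k IH] w.
  apply: (step 0%N _ _ (fun y _ => base y)) => _ [x ->]; exists (b x) => //.
  by split=> // y; apply: zspan_gen; exists x, y, [::].
apply: (step k.+1 _ _ IH) => _ [x [y [s [ss ->]]]]; exists (lc x y s).
  by rewrite -ss; apply: lc_gamma.
split=> // z; apply: zspan_gen; exists x, y, (rcons s z); rewrite size_rcons ss.
by split=> //; rewrite /lc map_rcons -cats1 foldc_cat.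
Qed.
End LeftNormed.
End MetabelianQuotient.

(** * The embedding of metabelian quotients into A (x) S^k(A) *)

Section Retraction.
Variables (K : choiceType) (le : rel K).
Hypothesis le_total : total le.
Hypothesis le_trans : transitive le.
Hypothesis le_anti : antisymmetric le.
Variables (F : groupType) (b : K -> F).
Hypothesis bF : free_on b.
Notation g k := (gamma_ k (nsgT F)).
Notation ld := (ld bF).
Notation F' := (derived (nsgT F)).
Notation R := (frg K).
Notation sort := (sort le).
Notation tau := (tau le).
Notation srt := (srt le).
Notation clm k := (cl (g k) (mgamma F k)).
Notation lc := (lc b).

Lemma kapM k x y : g k.+1 x -> g k.+1 y ->
  tau (ld k.+1 (x * y)%g) = tau (ld k.+1 x) + tau (ld k.+1 y).
Proof. by move=> gx gy; rewrite (ldM (ld_low bF gx) (ld_low bF gy)) raddfD. Qed.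

Lemma kap0 k x : mgamma F k.+1 x -> tau (ld k.+1 x) = 0.
Proof.
case=> u [v [[Fu gu] gv ->]]; rewrite kapM //; last exact: gammaS_sub.
by rewrite (ld_gammaS bF gv) tau_derived2 // raddf0 addr0.
Qed.

Definition kapq k : {additive zq (g k.+1) (mgamma F k.+1) -> R} :=
  zq_lift (fun x y gx gy => kapM gx gy) (fun x _ mx => kap0 mx).

Lemma kapqE k w : g k.+1 w -> kapq k (clm k.+1 w) = tau (ld k.+1 w).
Proof. by move=> gw; rewrite /kapq zq_liftE. Qed.

Lemma kap_foldc k c s : F' c -> g k.+1 c ->
  tau (ld (k + size s).+1 (foldc c (map b s))) = tau (ld k.+1 c * wd s).
Proof.
elim: s k c => [|z s IH] k c Fc gc /=; first by rewrite addn0 mulr1.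
have gz : g k.+2 [~ c, b z]%g by have := gamma_comm gc (I : g 1 (b z)); rewrite addn0.
rewrite addnS -addSn IH //; last exact: derived_comm.
have := ld_comm (ld_low bF gc) (ld_low bF (I : g 1 (b z))); rewrite addn0 => ->.
rewrite ld_b mulrBl raddfB -!mulrA [wd (z :: s)]wd_cons -[RHS]subr0; congr (_ - _).
by rewrite tau_letter (srt_mull le_total le_trans le_anti) (srt_ld le_total le_trans le_anti) // mul0r raddf0 mulr0.
Qed.

Lemma kap_lc x y s : tau (ld (size s).+2 (lc x y s)) =
  wd (x :: sort (y :: s)) - wd (y :: sort (x :: s)).
Proof.
rewrite /lc -[(size s).+2]/((1 + size s).+1) kap_foldc; try exact: gamma_comm1.
have := ld_comm (ld_low bF (I : g 1 (b x))) (ld_low bF (I : g 1 (b y))) => ->.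
by rewrite !ld_b mulrBl raddfB -!wdM !tau_cons.
Qed.

(** An inverse for [tau] of the leading coefficient. On words x m t with m t sorted, m is the least
    letter of the tail, and the commutators [x, m, t] with x > m are the classical basis of the
    metabelian quotient. The image of such a commutator has two terms; the second one starts with
    the least letter and is sent to 0. *)
Definition rho k : {additive R -> zq (g k) (mgamma F k)} :=
  flin (fun s => if s is [:: x, m & t] then if le x m then 0 else clm k (lc x m t) else 0).

Lemma rhoE k x m t : rho k (wd [:: x, m & t]) = if le x m then 0 else clm k (lc x m t).
Proof. exact: flinE. Qed.

Lemma le_refl x : le x x. Proof. by have := le_total x x; rewrite orbb. Qed.

Lemma sort_min z l : z \in l -> {in l, forall y, le z y} -> sort l = z :: sort (rem z l).
Proof.
move=> zl zmin; apply: (sorted_eq le_trans le_anti).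
- exact: sort_sorted.
- rewrite /= path_min_sorted; first exact: sort_sorted.
  by apply/allP => y; rewrite mem_sort => /mem_rem/zmin.
by rewrite perm_sort (perm_trans (perm_to_rem zl)) // perm_cons perm_sym perm_sort.
Qed.

Lemma rho_sort x z l k : (size l).+1 = k -> z \in l -> {in l, forall y, le z y} ->
  rho k (wd (x :: sort l)) = if le x z then 0 else clm k (lc x z (rem z l)).
Proof.
move=> <- zl zmin; rewrite (sort_min zl zmin) rhoE; case: ifP => // _.
have e : size l = (size (rem z l)).+1 by rewrite size_rem //; case: (l) zl.
by rewrite e -(size_sort le (rem z l)); apply: lc_perm; rewrite perm_sort.
Qed.

Lemma ex_min_seq (l : seq K) : l != [::] -> exists2 z, z \in l & {in l, forall y, le z y}.
Proof.
move=> l0; have s0 : sort l != [::] by rewrite -size_eq0 size_sort size_eq0.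
have := sort_sorted le_total l; case E : (sort l) s0 => [|z t] // _ /= zt.
exists z; first by rewrite -(mem_sort le) E mem_head.
move=> y; rewrite -(mem_sort le) E inE => /orP[/eqP -> |yt]; first exact: le_refl.
by have /allP := order_path_min le_trans zt; apply.
Qed.

Lemma rho_small k x l : (size l).+1 = k -> l != [::] -> {in l, forall y, le x y} ->
  rho k (wd (x :: sort l)) = 0.
Proof.
move=> sl l0 h; have [z zl zmin] := ex_min_seq l0.
by rewrite (rho_sort _ sl zl zmin) h.
Qed.

(** Let z be the least letter of x, y, s. If it is x or y, one of the two terms is killed and the
    other returns the commutator, up to the sign of [lc_anti]; if it lies in s, the two terms are
    the two sides of the Jacobi identity. *)
Lemma rho_kap_lc x y s :
  rho (size s).+2 (tau (ld (size s).+2 (lc x y s))) = clm (size s).+2 (lc x y s).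
Proof.
rewrite kap_lc raddfB.
have two x' y' : {in s, forall z, le y' z} -> le y' x' ->
    rho (size s).+2 (wd (x' :: sort (y' :: s))) - rho (size s).+2 (wd (y' :: sort (x' :: s))) =
    clm (size s).+2 (lc x' y' s).
  move=> ys yx; rewrite (@rho_sort _ y') //=; last 2 first.
  - exact: mem_head.
  - by move=> z; rewrite inE => /orP[/eqP ->|/ys //]; apply: le_refl.
  rewrite eqxx (@rho_small _ y') ?subr0 //; last first.
    by move=> z; rewrite inE => /orP[/eqP ->|/ys].
  case: ifP => // xy; have -> : x' = y' by apply: le_anti; rewrite xy yx.
  by rewrite lc_diag cl1.
have [z zl zmin] := @ex_min_seq [:: x, y & s] isT.
have hx : le z x by apply: zmin; rewrite mem_head.
have hy : le z y by apply: zmin; rewrite !inE eqxx orbT.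
have hs : {in s, forall z', le z z'} by move=> z' z's; apply: zmin; rewrite !inE z's !orbT.
have [xz|xz] := eqVneq x z.
  by rewrite -opprB two ?xz // -lc_anti.
have [yz|yz] := eqVneq y z; first by rewrite two ?yz.
have zs : z \in s by move: zl; rewrite !inE eq_sym (negPf xz) eq_sym (negPf yz).
have nxz u : u != z -> le z u -> le u z = false.
  by move=> uz zu; apply: contraNF uz => uz; apply/eqP/le_anti; rewrite uz zu.
have E u v : v != z -> le z v -> u != z -> le z u -> rho (size s).+2 (wd (u :: sort (v :: s))) =
    clm (size s).+2 (lc u z (v :: rem z s)).
  move=> vz zv uz zu; rewrite (@rho_sort _ z) //=; last 2 first.
  - by rewrite inE zs orbT.
  - by move=> w; rewrite inE => /orP[/eqP ->|/hs].
  by rewrite (nxz u) // (negPf vz).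
rewrite !E // (lc_perm b x y (perm_to_rem zs)).
have e : size s = (size (rem z s)).+1 by rewrite size_rem //; case: (s) zs.
by rewrite e [RHS]lc_jacobi.
Qed.

Lemma rho_kap k w : g k.+2 w -> rho k.+2 (tau (ld k.+2 w)) = clm k.+2 w.
Proof.
move=> gw.
pose pr : {additive zq (g k.+2) (g k.+3) -> zq (g k.+2) (mgamma F k.+2)} :=
  zq_lift (fun x y gx gy => clM (mgamma F k.+2) gx gy)
    (fun x (_ : g k.+2 x) gx => cl0 (g k.+2) (mgammaS gx)).
have prE u : g k.+2 u -> pr (cl (g k.+2) (g k.+3) u) = clm k.+2 u.
  by move=> gu; rewrite /pr zq_liftE.
rewrite -kapqE // -prE //.
elim: (gamma_lc bF gw) => [_ [x [y [s [ss ->]]]]||z1 z2 _ h1 _ h2].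
- have gl : g k.+2 (lc x y s) by rewrite -ss; apply: lc_gamma.
  by rewrite prE // kapqE // -ss; apply: rho_kap_lc.
- by rewrite !raddf0.
- by rewrite !raddfB h1 h2.
Qed.

Lemma kap_eq0 k w : g k.+2 w -> tau (ld k.+2 w) = 0 -> mgamma F k.+2 w.
Proof.
move=> gw w0; apply: (cl_eq0 _ gw); last by rewrite -rho_kap // w0 raddf0.
by move=> x y gx gy; apply/mgammaS/gamma_comm1.
Qed.

(** Hence an element of A (x) S^{k+1}(A) that vanishes in S^{k+2}(A) is realised by gamma_{k+2};
    this is the source of surjectivity in [Kset_Rel]. *)
Lemma kap_rho k D : fhom k.+2 D -> kapq k.+1 (rho k.+2 (tau D)) = tau D - srt D.
Proof.
elim=> [_ [s ss ->]||x y _ hx _ hy]; last 2 first.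
- by rewrite !raddf0 addr0.
- by rewrite [tau (x - y)]raddfB [srt _]raddfB [rho _ _]raddfB [kapq _ _]raddfB hx hy subrBB.
case: s ss => [|x l] ss //; have sl : size l = k.+1 by case: ss.
rewrite tau_cons srtE.
have l0 : l != [::] by rewrite -size_eq0 sl.
have [z zl zmin] := ex_min_seq l0.
rewrite (rho_sort _ _ zl zmin) ?sl //.
have srem : size (rem z l) = k by rewrite size_rem // sl.
case: ifP => [xz|xz].
  have xmin : {in x :: l, forall y, le x y}.
    by move=> y; rewrite inE => /orP[/eqP ->|/zmin]; [apply: le_refl|apply: le_trans].
  by rewrite raddf0 (sort_min (mem_head _ _) xmin) /= eqxx subrr.
have glc : g k.+2 (lc x z (rem z l)) by rewrite -{1}srem; apply: lc_gamma.
rewrite kapqE // -{1}srem kap_lc; congr (wd (_ :: _) - wd _).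
  by apply: sort_eq => //; rewrite perm_sym perm_to_rem.
have zx : le z x by have := le_total x z; rewrite xz.
have zxl : {in x :: l, forall y, le z y}.
  by move=> y; rewrite inE => /orP[/eqP ->|/zmin].
have zin : z \in x :: l by rewrite inE zl orbT.
rewrite (sort_min zin zxl) /=; case: eqP => // e.
by rewrite e le_refl in xz.
Qed.
End Retraction.

(** * From the numerator to arrows *)

Section Relation.
Variable X : free_presentation.
Notation F := (presF X).
Notation G := (presG X).
Notation Rk := (pres_ker X).
Notation f := (aug (nsgT F)).
Notation fX := (idealX f).
Notation g k := (gamma_ k (nsgT F)).
Notation F' := (derived (nsgT F)).
Notation F'' := (derived F').

Definition piX : {additive ab F -> ab G} := ab_map (pres_pi X).

Lemma piXE w : piX (ab_pi w) = ab_pi (pres_pi X w). Proof. exact: ab_mapE. Qed.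

Lemma piX_ker w : Rk w -> piX (ab_pi w) = 0.
Proof. by move=> Rw; rewrite piXE Rw. Qed.

Lemma derived_lift v : derived (nsgT G) v -> exists2 u, F' u & pres_pi X u = v.
Proof.
elim=> {v} [_ [x [y [_ _ ->]]]||x y _ [u Fu <-] _ [v Fv <-]|x _ [u Fu <-]].
- have [x' <-] := pres_surj x; have [y' <-] := pres_surj y.
  by exists [~ x', y']%g; [apply: nsgR_comm|rewrite morphR].
- by exists 1%g; [apply: nsg1|rewrite morph1].
- by exists (u * v)%g; [apply: nsgM|rewrite gmulfM].
- by exists u^-1%g; [apply: nsgV|rewrite morphV].
Qed.

(** A class that dies in G_ab is represented by some w mapping into G'; as G' is the image of F', w
    can be corrected by an element of F' to lie in R. *)
Lemma ker_lift c : piX c = 0 -> exists2 r, Rk r & ab_pi r = c.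
Proof.
elim/ab_pi_ind: c => w; rewrite piXE => /ab_pi_eq0/derived_lift [u Fu uw].
exists (w * u^-1)%g; first by rewrite /= gmulfM morphV uw mulgV.
have -> : ab_pi u = 0 -> ab_pi (w * u^-1)%g = ab_pi w.
  by move=> u0; rewrite ab_piM ab_piV u0 subr0.
  by [].
by apply/qpiP; rewrite mulg1; apply: nsgV.
Qed.

Lemma ker_eq c (h : piX c = 0) : piX 0 = piX c. Proof. by rewrite raddf0 h. Qed.

(* The arrow from 0 to c, with junk value 0 when c is not in the kernel of piX. *)
Definition karrow (c : ab F) : Tr piX :=
  if pselect (piX c = 0) is left h then gl _ (ep (ker_eq h)) else 0.

Lemma karrowE c (h : piX c = 0) : karrow c = gl _ (ep (ker_eq h)).
Proof. by rewrite /karrow; case: pselect => // h'; congr gl; apply: ep_ext. Qed.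

Lemma karrow_src c : srcT (karrow c) = 0.
Proof.
rewrite /karrow; case: pselect => [h|_]; last by rewrite rmorph0.
by rewrite srcT1 raddf0.
Qed.

Lemma karrow_tgt c : piX c = 0 -> tgtT (karrow c) = gl _ c.
Proof. by move=> h; rewrite (karrowE h) tgtT1. Qed.

Lemma karrowB c c' : piX c = 0 -> piX c' = 0 -> karrow (c - c') = karrow c - karrow c'.
Proof.
move=> h h'; have hB : piX (c - c') = 0 by rewrite raddfB h h' subrr.
rewrite (karrowE h) (karrowE h') (karrowE hB) -raddfB; congr gl.
by apply: ep_ext; rewrite /src /tgt /= ?subrr.
Qed.

Notation dl := (fun w => gl _ (ediag piX (ab_pi w)) : Tr piX).

(** Since (0, c)(c', 0) = 0, the left side equals (0, c)(0, c'), which is symmetric in c and c'.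
    This is what makes [r, r'] represent the zero arrow. *)
Lemma karrow_sym c c' : piX c = 0 -> piX c' = 0 ->
  karrow c * gl _ (ediag piX c') = karrow c' * gl _ (ediag piX c).
Proof.
have E a a' (h : piX a = 0) (h' : piX a' = 0) :
    karrow a * gl _ (ediag piX a') = karrow a * karrow a'.
  apply/eqP; rewrite -subr_eq0 -mulrBr (karrowE h) (karrowE h') -raddfB; apply/eqP.
  by apply: gl_rho; split; rewrite /src /tgt //= subrr.
by move=> h h'; rewrite !E // mulrC.
Qed.

Definition Sgen k (z : groupring F * Tr piX) : Prop := exists r ws,
  [/\ Rk r, size ws = k &
    z = ((gr r - 1) * \prod_(w <- ws) (gr w - 1), karrow (ab_pi r) * \prod_(w <- ws) dl w)].

Definition I0 k : ideal (groupring F) := idealD (idealM f (idealI (aug F') (fX k))) (fX k.+2).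

(* Modulo I0, w - 1 is a sum of products (r - 1)(w_1 - 1)...(w_k - 1) and th is
   the corresponding sum of arrows (0, r) w_1 ... w_k. *)
Definition Rel k w (th : Tr piX) : Prop :=
  exists i, I0 k i /\ zspan (Sgen k) (gr w - 1 - i, th).

Lemma prod_fX (ws : seq F) k : size ws = k.+1 -> fX k.+1 (\prod_(w <- ws) (gr w - 1)).
Proof.
elim: ws k => // w [|w' ws] IH k [<-] /=; first by rewrite big_seq1; apply: augT_gr.
by rewrite big_cons; apply: (@fX_mul _ 0); [apply: augT_gr|apply: IH].
Qed.

Lemma Sgen_ideal k z : zspan (Sgen k.+1) z -> idealM (aug Rk) (fX k.+1) z.1.
Proof.
elim=> [_ [r [ws [Rr sw ->]]]||x y _ hx _ hy].
- exact: (idealM_gen (aug_gr Rr) (prod_fX sw)).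
- exact: (ideal0 (idealM _ _)).
- exact: (idealB hx hy).
Qed.

Lemma I0_sub k i : I0 k.+1 i -> fX k.+2 i.
Proof.
case=> a [c [ha hc ->]]; apply: idealDE; last exact: fX_sub.
elim: ha => [_ [x [y [fx [_ fy] ->]]]||x y _ h _ h'].
- exact: idealM_gen.
- exact: ideal0.
- exact: idealB.
Qed.

Lemma rf_sub k u : idealM (aug Rk) (fX k.+1) u -> fX k.+2 u.
Proof.
elim=> [_ [x [y [fx fy ->]]]||x y _ h _ h']; [|exact: ideal0|exact: idealB].
apply: idealM_gen => //; apply: zspan_sub fx => _ [h [a [_ ->]]].
by apply: zspan_gen; exists h, a.
Qed.

Lemma Rel_numerator k w th : Rel k.+1 w th -> numerator X k.+1 w.
Proof.
case=> i [[a [c [ha hc iE]]] /Sgen_ideal /= hu].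
rewrite /numerator /=; exists (a + (gr w - 1 - i)), c; split=> //.
  by exists a, (gr w - 1 - i).
by rewrite iE addrAC [a + c + _]addrC subrK.
Qed.

Lemma numerator_fX k w : numerator X k.+1 w -> fX k.+2 (gr w - 1).
Proof.
case=> _ [c [[a [u [ha hu ->]] hc ->]]]; apply: idealDE; last exact: fX_sub.
apply: idealDE; last exact: rf_sub.
by apply: (@I0_sub k); exists a, 0; rewrite addr0; split=> //; apply: ideal0.
Qed.

(** Both w - 1 and w' - 1 lie in f^(k+2), so the cross term (w - 1)(w' - 1) lies in f^(k+3) and is
    absorbed by [I0]. *)
Lemma RelM k w w' th th' : Rel k.+1 w th -> Rel k.+1 w' th' -> Rel k.+1 (w * w')%g (th + th').
Proof.
move=> h h'; have fw := numerator_fX (Rel_numerator h).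
have fw' := numerator_fX (Rel_numerator h').
case: h => i [hi hu]; case: h' => i' [hi' hu'].
exists ((gr w - 1) * (gr w' - 1) + (i + i')); split.
  apply: idealDE; last exact: idealDE.
  exists 0, ((gr w - 1) * (gr w' - 1)); rewrite add0r; split=> //; first exact: ideal0.
  by apply: (@fX_le _ _ (k.+1 + k.+1).+2); [lia|apply: fX_mul].
have -> : (gr (w * w')%g - 1 - ((gr w - 1) * (gr w' - 1) + (i + i')), th + th') =
    (gr w - 1 - i, th) + (gr w' - 1 - i', th').
  by congr pair; rewrite grM mulM_sub1 opprD addrACA subrr add0r opprD addrACA.
exact: zspanD.
Qed.

Lemma RelV k w th : Rel k.+1 w th -> Rel k.+1 w^-1%g (- th).
Proof.
move=> h; have fw := numerator_fX (Rel_numerator h).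
case: h => i [hi hu]; exists (- ((gr w - 1) * (gr w^-1%g - 1)) - i); split.
  apply: idealB => //; rewrite -sub0r; apply: idealB; first exact: ideal0.
  exists 0, ((gr w - 1) * (gr w^-1%g - 1)); rewrite add0r; split=> //; first exact: ideal0.
  apply: (@fX_le _ _ (k.+1 + 0).+2); first by lia.
  by apply: fX_mul => //; apply: augT_gr.
have e : gr w^-1%g - 1 = - (gr w - 1) - (gr w - 1) * (gr w^-1%g - 1) :> groupring F.
  have := mulM_sub1 (gr w) (gr w^-1%g); rewrite -grM mulgV gr1 subrr addrA => /esym/eqP.
  by rewrite addrC addr_eq0 => /eqP e'; rewrite {1}e' opprD addrC.
have -> : (gr w^-1%g - 1 - (- ((gr w - 1) * (gr w^-1%g - 1)) - i), - th) =
    - (gr w - 1 - i, th).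
  congr pair; rewrite {1}e [- (- _ - i)]opprD !opprK addrA subrK [RHS]opprB.
  by rewrite addrC.
exact: zspanN.
Qed.

Lemma Rel_zero k w : I0 k (gr w - 1) -> Rel k w 0.
Proof. by move=> h; exists (gr w - 1); rewrite subrr; split=> //; apply: zspan0. Qed.
End Relation.

(** * Commutators of relators give the zero arrow *)

Section CommutatorPart.
Variable X : free_presentation.
Notation F := (presF X).
Notation Rk := (pres_ker X).
Notation f := (aug (nsgT F)).
Notation fX := (idealX f).
Notation F' := (derived (nsgT F)).
Notation dl w := (gl _ (ediag (piX X) (ab_pi w)) : Tr (piX X)).

Lemma Sgen_mulr k u (th : Tr (piX X)) w : zspan (@Sgen X k) (u, th) ->
  zspan (@Sgen X k.+1) (u * (gr w - 1), th * dl w).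
Proof.
have H (z : groupring F * Tr (piX X)) : zspan (@Sgen X k) z ->
    zspan (@Sgen X k.+1) (z.1 * (gr w - 1), z.2 * dl w).
  elim=> [_ [r [ws [Rr sw ->]]]||x y _ hx _ hy].
  - apply: zspan_gen; exists r, (rcons ws w); rewrite size_rcons sw; split=> //=.
    by rewrite -cats1 !big_cat !big_seq1 /= !mulrA.
  - by rewrite /= !mul0r; apply: zspan0.
  - by rewrite /= !mulrBl; apply: (zspanB hx hy).
exact: (H (u, th)).
Qed.

Lemma gr_comm_split (x y : F) : exists2 q, f q &
  gr [~ x, y]%g - 1 = q * ((gr x - 1) * (gr y - 1) - (gr y - 1) * (gr x - 1)) +
    ((gr x - 1) * (gr y - 1) - (gr y - 1) * (gr x - 1)).
Proof.
exists (gr (x^-1 * y^-1)%g - 1); first exact: augT_gr.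
by rewrite mulrBl mul1r subrK -gr_comm.
Qed.

Lemma I0_fX k x : fX k.+2 x -> I0 X k x.
Proof. by move=> h; exists 0, x; rewrite add0r; split=> //; apply: ideal0. Qed.

(** Modulo f^3, [r, r'] - 1 is (r - 1)(r' - 1) - (r' - 1)(r - 1), whose two arrows cancel by
    [karrow_sym]. Membership in F' is recorded for use in [Rel_comm]. *)
Lemma RR_Rel d : nsgR Rk Rk d -> F' d /\ Rel 1 d (0 : Tr (piX X)).
Proof.
elim=> [_ [r [r' [Rr Rr' ->]]]||x y _ [Fx hx] _ [Fy hy]|x _ [Fx hx]].
- split; first exact: nsgR_comm.
  have [q fq e] := gr_comm_split r r'; set y := (gr r - 1) * (gr r' - 1) - _ in e.
  exists (q * y); split.
    apply/I0_fX/(@fX_mul _ 0 1) => //.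
    by apply: idealB; apply: (@fX_mul _ 0 0); apply: augT_gr.
  rewrite e addrAC subrr add0r.
  have -> : (y, 0) = ((gr r - 1) * \prod_(w <- [:: r']) (gr w - 1),
        karrow (ab_pi r) * \prod_(w <- [:: r']) dl w) -
      ((gr r' - 1) * \prod_(w <- [:: r]) (gr w - 1),
        karrow (ab_pi r') * \prod_(w <- [:: r]) dl w) :> groupring F * Tr (piX X).
    by rewrite !big_seq1 (karrow_sym (piX_ker Rr) (piX_ker Rr')); congr pair; rewrite /= subrr.
  by apply: zspanB; apply: zspan_gen; [exists r, [:: r']|exists r', [:: r]].
- by split; [apply: nsg1|apply: Rel_zero; rewrite gr1 subrr; apply: ideal0].
- by split; [apply: nsgM|rewrite -[0]addr0; apply: RelM].
- by split; [apply: nsgV|rewrite -oppr0; apply: RelV].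
Qed.

(** Up to higher powers of f, [c, z] - 1 is (c - 1)(z - 1) - (z - 1)(c - 1). The first term appends
    z to a decomposition with zero arrow; the second lies in f((F' - 1)Z[F] /\ f^(k+2)) because c is
    in F', and so is absorbed by [I0]. *)
Lemma Rel_comm k c z : F' c -> Rel k.+1 c (0 : Tr (piX X)) ->
  Rel k.+2 [~ c, z]%g (0 : Tr (piX X)).
Proof.
move=> Fc h; have fc := numerator_fX (Rel_numerator h).
case: h => i [[a [c0 [ha hc0 iE]]] hu].
have [q fq e] := gr_comm_split c z; set y := (gr c - 1) * (gr z - 1) - _ in e.
have fy : fX k.+3 y.
  apply: idealB; last exact: (@fX_mul _ 0 k.+1 _ _ (augT_gr z) fc).
  by have := @fX_mul _ k.+1 0 _ _ fc (augT_gr z); rewrite addn0.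
exists (q * y + (i * (gr z - 1) - (gr z - 1) * (gr c - 1))); split.
  apply: idealDE; first by apply/I0_fX/(@fX_mul _ 0 k.+2).
  rewrite iE mulrDl; apply: idealB.
    exists (a * (gr z - 1)), (c0 * (gr z - 1)); split=> //.
      elim: ha => [_ [x [x' [fx [gx fx'] ->]]]||x x' _ hx _ hx'].
      - rewrite -mulrA; apply: idealM_gen => //; split; first exact: idealMr.
        by have := @fX_mul _ k 0 _ _ fx' (augT_gr z); rewrite addn0.
      - by rewrite mul0r; apply: ideal0.
      - by rewrite mulrBl; apply: idealB.
    by have := @fX_mul _ k.+2 0 _ _ hc0 (augT_gr z); rewrite addn0.
  exists ((gr z - 1) * (gr c - 1)), 0; rewrite addr0; split=> //; last exact: ideal0.
  by apply: idealM_gen; [apply: augT_gr|split=> //; apply: aug_gr].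
have -> : gr [~ c, z]%g - 1 - (q * y + (i * (gr z - 1) - (gr z - 1) * (gr c - 1))) =
    (gr c - 1 - i) * (gr z - 1).
  by rewrite e opprD addrACA subrr add0r /y subrBB subrr subr0 -mulrBl.
by have := Sgen_mulr z hu; rewrite mul0r.
Qed.

Lemma RRn_Rel k d : nsgRn k (nsgR Rk Rk) (nsgT F) d -> F' d /\ Rel k.+1 d (0 : Tr (piX X)).
Proof.
elim: k d => [|k IH] d; first exact: RR_Rel.
elim=> [_ [c [z [/IH[Fc hc] _ ->]]]||x y _ [Fx hx] _ [Fy hy]|x _ [Fx hx]].
- by split; [apply: derived_comm|apply: Rel_comm].
- by split; [apply: nsg1|apply: Rel_zero; rewrite gr1 subrr; apply: ideal0].
- by split; [apply: nsgM|rewrite -[0]addr0; apply: RelM].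
- by split; [apply: nsgV|rewrite -oppr0; apply: RelV].
Qed.

Lemma RRn_gamma k d : nsgRn k (nsgR Rk Rk) (nsgT F) d -> gamma_ k.+2 (nsgT F) d.
Proof.
elim: k d => [|k IH] d; first by apply: nsgR_min => x y _ _; apply: gamma_comm1.
apply: nsgR_min => x y /IH gx _.
by have := gamma_comm gx (I : gamma_ 1 (nsgT F) y); rewrite addn0.
Qed.

Lemma gamma_Rel k w : gamma_ k.+2 (nsgT F) w -> Rel k w (0 : Tr (piX X)).
Proof. by move=> /gamma_fX h; apply/Rel_zero/I0_fX. Qed.
End CommutatorPart.

(** * The ideal [I0] in terms of Magnus coefficients *)

Section EvPart.
Variables (K : choiceType) (le : rel K).
Hypothesis le_total : total le.
Hypothesis le_trans : transitive le.
Hypothesis le_anti : antisymmetric le.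
Variables (X : free_presentation) (b : K -> presF X).
Hypothesis bF : free_on b.
Notation F := (presF X).
Notation f := (aug (nsgT F)).
Notation fX := (idealX f).
Notation F' := (derived (nsgT F)).
Notation ev := (ev b).
Notation tau := (tau le).
Notation srt := (srt le).

Lemma evM x y : ev (x * y) = ev x * ev y. Proof. exact: rmorphM. Qed.
Lemma evB x y : ev (x - y) = ev x - ev y. Proof. exact: raddfB. Qed.

(** Z[F] modulo (F' - 1)Z[F] is commutative. *)
Lemma ev_perm s t : perm_eq s t -> aug F' (ev (wd s) - ev (wd t)).
Proof.
move=> p; apply: zspan_sub (_ : zspan (aug_set F') _).
  by move=> y.
apply/zpiP; apply: (@perm_invariant _ _ (fun s => zpi (aug_set F') (ev (wd s)))) p.
move=> {}s {}t x y; apply/zpiP/zspan_gen.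
have E u v : ev (wd (s ++ [:: u, v & t])) = ev (wd s) * ((gr (b u) - 1) * (gr (b v) - 1)) * ev (wd t).
  rewrite -[s ++ _]/(s ++ [:: u] ++ [:: v] ++ t) !wdM.
  by rewrite !evM !ev1 !mulrA.
rewrite !E -mulrBl -mulrBr; apply: (@idealMr _ (aug F')); apply: (@idealMl _ (aug F')).
have -> : (gr (b x) - 1) * (gr (b y) - 1) - (gr (b y) - 1) * (gr (b x) - 1) =
    gr (b y * b x)%g * (gr [~ b x, b y]%g - 1).
  by rewrite gr_comm mulrA -grM -invgM mulgV gr1 mul1r.
by apply: (@idealMl _ (aug F')); apply/aug_gr/nsgR_comm.
Qed.

Lemma ev_srt k D : fhom k.+1 D -> aug F' (ev (D - srt D)) /\ fX k.+1 (ev (D - srt D)).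
Proof.
move=> hD; split; last by apply/ev_fX/zspanB => //; apply: srt_fhom.
elim: hD => [_ [s ss ->]||x y _ hx _ hy].
- rewrite srtE evB; apply: ev_perm; by rewrite perm_sym perm_sort.
- by rewrite raddf0 subr0 raddf0; apply: ideal0.
- have -> : x - y - srt (x - y) = (x - srt x) - (y - srt y) by rewrite raddfB subrBB.
  by rewrite evB; apply: idealB.
Qed.

(** [tau] changes only the order of the letters after the first one. The evaluated tail changes by
    an element of (F' - 1)Z[F] /\ f^(k+1), and the first letter contributes the factor in f. *)
Lemma ev_tau k D : fhom k.+2 D -> idealM f (idealI (aug F') (fX k.+1)) (ev (D - tau D)).
Proof.
elim=> [_ [s ss ->]||x y _ hx _ hy].
- case: s ss => [|x s] ss //; have {}ss : size s = k.+1 by case: ss.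
  rewrite tau_cons wd_cons [wd (x :: sort _ _)]wd_cons -mulrBr evM.
  apply: idealM_gen; first by rewrite ev1; apply: augT_gr.
  by rewrite -srtE; apply: ev_srt; rewrite -ss; apply: fhom_wd.
- by rewrite raddf0 subr0 raddf0; apply: ideal0.
- have -> : x - y - tau (x - y) = (x - tau x) - (y - tau y) by rewrite raddfB subrBB.
  by rewrite evB; apply: idealB.
Qed.

(** Together with [I0_mu] this characterises [I0] inside f^(k+2): it consists of the elements whose
    leading coefficient is killed by [tau]. *)
Lemma tau_I0 k v : fX k.+2 v -> tau (mu bF v k.+2) = 0 -> I0 X k.+1 v.
Proof.
move=> fv t0; rewrite -[v](subrK (ev (mu bF v k.+2))); apply: idealDE.
  exact/I0_fX/ev_mu.
exists (ev (mu bF v k.+2)), 0; rewrite addr0; split=> //; last exact: ideal0.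
by rewrite -[mu bF v k.+2]subr0 -t0; apply/ev_tau/mu_fhom.
Qed.

Lemma mgamma_Rel k w : mgamma F k.+2 w -> Rel k.+1 w (0 : Tr (piX X)).
Proof.
case=> u [v [[Fu gu] gv ->]]; rewrite -[0]addr0; apply: RelM.
  by apply/Rel_zero/tau_I0; [apply: gamma_fX|apply: tau_derived2].
exact: gamma_Rel.
Qed.

Lemma denominator_Rel k w : denominator X k.+1 w -> Rel k.+1 w (0 : Tr (piX X)).
Proof.
case=> d [v [[d' [u [hd' hu ->]]] gv ->]].
rewrite -[0]addr0; apply: RelM; last exact: gamma_Rel.
rewrite -[0]addr0; apply: RelM; first by have [] := RRn_Rel hd'.
apply: mgamma_Rel; exists u, 1%g; rewrite mulg1; split=> //; exact: nsg1.
Qed.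
End EvPart.

(** * Existence, uniqueness and surjectivity of the arrow of an element *)

Section RelationFunctional.
Variables (K : choiceType) (le : rel K).
Hypothesis le_total : total le.
Hypothesis le_trans : transitive le.
Hypothesis le_anti : antisymmetric le.
Variables (X : free_presentation) (b : K -> presF X).
Hypothesis bF : free_on b.
Notation F := (presF X).
Notation Rk := (pres_ker X).
Notation R := (frg K).
Notation f := (aug (nsgT F)).
Notation fX := (idealX f).
Notation F' := (derived (nsgT F)).
Notation ev := (ev b).
Notation tau := (tau le).
Notation srt := (srt le).
Notation mu := (mu bF).
Notation ld := (ld bF).
Notation ell := (ell bF).
Notation piS := (piS b).
Notation T := (Tr (piX X)).
Notation idT := (idT (piX X)).
Notation dl w := (gl _ (ediag (piX X) (ab_pi w)) : T).

(** In (r - 1) y with y in f^(k+1), replace y by the evaluation of its leading coefficient: the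
    error lies in f^(k+3), and what remains is a combination of the generators in [Sgen]. *)
Lemma numerator_split k u : idealM (aug Rk) (fX k.+1) u ->
  exists i th, fX k.+3 i /\ zspan (@Sgen X k.+1) (u - i, th).
Proof.
have sub u1 u2 : (exists i th, fX k.+3 i /\ zspan (@Sgen X k.+1) (u1 - i, th)) ->
    (exists i th, fX k.+3 i /\ zspan (@Sgen X k.+1) (u2 - i, th)) ->
    exists i th, fX k.+3 i /\ zspan (@Sgen X k.+1) (u1 - u2 - i, th).
  move=> [i1 [t1 [h1 z1]]] [i2 [t2 [h2 z2]]]; exists (i1 - i2), (t1 - t2); split.
    exact: idealB.
  by rewrite subrBB; apply: (zspanB z1 z2).
have zero : exists i th, fX k.+3 i /\ zspan (@Sgen X k.+1) (0 - i, th).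
  by exists 0, 0; rewrite subrr; split; [apply: ideal0|apply: zspan0].
elim=> [_ [x [y [hx fy ->]]]||x y _ hx _ hy]; [|exact: zero|exact: sub].
elim: hx => [_ [r [a [Rr ->]]]||x1 x2 _ h1 _ h2]; last 2 first.
- by rewrite mul0r; apply: zero.
- by rewrite mulrBl; apply: sub.
have fay : fX k.+1 (a * y) by apply: idealMl.
have H D : fhom k.+1 D -> exists th, zspan (@Sgen X k.+1) ((gr r - 1) * ev D, th).
  elim=> [_ [s ss ->]||D1 D2 _ [t1 h1] _ [t2 h2]].
  - eexists; apply: zspan_gen; exists r, (map b s); rewrite size_map ss; split=> //.
    by rewrite big_map [ev _]frmapE.
  - by exists 0; rewrite raddf0 mulr0; apply: zspan0.
  - by exists (t1 - t2); rewrite evB mulrBr; apply: (zspanB h1 h2).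
have [th hth] := H _ (mu_fhom bF (a * y) k.+1).
exists ((gr r - 1) * (a * y - ev (mu (a * y) k.+1))), th; split.
  by apply: (@fX_mul _ 0 k.+1); [apply: augT_gr|apply: ev_mu].
by rewrite -mulrA -mulrBr subKr.
Qed.

Lemma numerator_Rel k w : numerator X k.+1 w -> exists th : T, Rel k.+1 w th.
Proof.
case=> _ [c [[a [u [ha hu ->]] hc e]]].
have [i [th [hi hth]]] := numerator_split hu.
exists th, (a + (c + i)); split.
  by exists a, (c + i); split=> //; apply: idealDE.
rewrite e; have -> : a + u + c - (a + (c + i)) = u - i; last by [].
by rewrite -[a + u + c]addrA opprD addrACA subrr add0r opprD addrA addrK.
Qed.

Lemma piSM x y : piS (x * y) = piS x * piS y. Proof. exact: rmorphM. Qed.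
Lemma piSB x y : piS (x - y) = piS x - piS y. Proof. exact: raddfB. Qed.
Lemma piS0 : piS 0 = 0. Proof. exact: raddf0. Qed.
Lemma piSD x y : piS (x + y) = piS x + piS y. Proof. exact: raddfD. Qed.
Lemma piSN x : piS (- x) = - piS x. Proof. exact: raddfN. Qed.

Lemma piS_ell a : piS (ell a) = gl _ a.
Proof.
elim/ab_pi_ind: a => w; elim/(free_ind bF): w => [|x y hx hy|x hx|x].
- by have -> : ab_pi 1%g = 0 :> ab F by []; rewrite [ell _]raddf0 piS0 raddf0.
- by rewrite ab_piM [ell _]raddfD piSD hx hy raddfD.
- by rewrite ab_piV [ell _]raddfN piSN hx raddfN.
- by rewrite ell_b piS1.
Qed.

Lemma piS_wd s : piS (wd s) = \prod_(x <- s) gl _ (ab_pi (b x)).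
Proof. exact: frmapE. Qed.

Lemma piS_srt D : piS (srt D) = piS D.
Proof.
elim/frg_ind: D => [|x y hx hy|s]; first by rewrite raddf0.
  by rewrite raddfB !piSB hx hy.
by rewrite srtE !piS_wd; apply: perm_big; rewrite perm_sort.
Qed.

Definition psi D : T := idT (piS D).

Lemma psiM x y : psi (x * y) = psi x * psi y.
Proof. by rewrite /psi piSM; apply: rmorphM. Qed.

Lemma psi_sum (I : Type) (s : seq I) (D : I -> R) :
  psi (\sum_(i <- s) D i) = \sum_(i <- s) psi (D i).
Proof.
have -> : psi (\sum_(i <- s) D i) = idT (\sum_(i <- s) piS (D i)).
  by congr idT; apply: raddf_sum.
exact: raddf_sum.
Qed.

Lemma psiMz D z : psi (D *~ z) = psi D *~ z.
Proof.
have -> : psi (D *~ z) = idT (piS D *~ z) by congr idT; apply: raddfMz.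
exact: raddfMz.
Qed.

Lemma psiB x y : psi (x - y) = psi x - psi y. Proof. by rewrite /psi piSB raddfB. Qed.

Lemma mu_prod ws k : size ws = k ->
  low k (mu (\prod_(w <- ws) (gr w - 1))) /\
  mu (\prod_(w <- ws) (gr w - 1)) k = \prod_(w <- ws) ell (ab_pi w).
Proof.
elim: ws k => [|w ws IH] k /= <-; first by rewrite !big_nil rmorph1.
have [l e] := IH _ erefl; rewrite !big_cons rmorphM.
have l1 : low 1 (mu (gr w - 1)) by apply/mu_aug_low/augT_gr.
split; first exact: (low_mul l1 l).
by rewrite (low_mul_lead l1 l) e ellE.
Qed.

Lemma psi_prod ws : psi (\prod_(w <- ws) ell (ab_pi w)) = \prod_(w <- ws) dl w.
Proof.
elim: ws => [|w ws IH]; first by rewrite !big_nil /psi [piS 1]rmorph1 rmorph1.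
by rewrite !big_cons psiM IH /psi piS_ell idT1.
Qed.

Lemma Sgen_mu k r ws : Rk r -> size ws = k ->
  mu ((gr r - 1) * \prod_(w <- ws) (gr w - 1)) k.+1 =
    ell (ab_pi r) * \prod_(w <- ws) ell (ab_pi w).
Proof.
move=> Rr sw; have [l e] := mu_prod sw; rewrite rmorphM.
have l1 : low 1 (mu (gr r - 1)) by apply/mu_aug_low/augT_gr.
by rewrite (low_mul_lead l1 l) e ellE.
Qed.

(** The leading coefficients of [Sgen] after [tau]: a tensor c (x) D with D in the symmetric
    algebra, kept together with its arrow. *)
Definition Qgen (z : R * T) : Prop := exists c D,
  piX X c = 0 /\ z = (ell c * srt D, karrow c * psi D).

Lemma Sgen_Qgen k u th : zspan (@Sgen X k) (u, th) -> zspan Qgen (tau (mu u k.+1), th).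
Proof.
have H (z : groupring F * T) : zspan (@Sgen X k) z -> zspan Qgen (tau (mu z.1 k.+1), z.2).
  elim=> [_ [r [ws [Rr sw ->]]]||x y _ hx _ hy].
  - apply: zspan_gen; exists (ab_pi r), (\prod_(w <- ws) ell (ab_pi w)).
    split; first exact: piX_ker.
    by rewrite (Sgen_mu Rr sw) tau_fhom1 ?psi_prod //; apply: ell_fhom.
  - by rewrite mu0E raddf0; apply: zspan0.
  - by rewrite muBE raddfB; apply: (zspanB hx hy).
exact: (H (u, th)).
Qed.

(** A (x) S^n(A) is a sum of copies of A indexed by sorted words; this is the coordinate, in A =
    F_ab, along the tail [y]. *)
Definition comp y : {additive R -> ab F} :=
  flin (fun s => if s is x :: t then (if t == y then ab_pi (b x) else 0) else 0).

Lemma comp_mul y P D : fhom 1 P -> comp y (P * D) = unl b P *~ coeff y D.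
Proof.
elim=> [_ [s ss ->]||P1 P2 _ h1 _ h2]; last 2 first.
- by rewrite mul0r !raddf0 mul0rz.
- by rewrite mulrBl !raddfB h1 h2 mulrzBl.
case: s ss => [|x [|]] // _; elim/frg_ind: D => [|D D' hD hD'|s].
- by rewrite mulr0 raddf0 coeff0 mulr0z.
- by rewrite mulrBr raddfB hD hD' coeffB mulrzBr.
rewrite -wdM /= coeff_wd unl_wd [comp _ _]flinE /=.
by case: eqP.
Qed.

Lemma karrow0 : karrow (0 : ab F) = 0 :> T.
Proof. by rewrite -(subrr 0) karrowB ?subrr // raddf0. Qed.

Lemma karrowMz c z : piX X c = 0 -> karrow (c *~ z) = karrow c *~ z :> T.
Proof.
move=> h; have hz : piX X (c *~ z) = 0 by rewrite raddfMz h mul0rz.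
rewrite (karrowE h) (karrowE hz) -raddfMz; congr gl.
by apply: ep_ext; rewrite raddfMz //= /src /tgt /= mul0rz.
Qed.

Lemma frg_sum_over (D : R) Y : uniq Y -> {subset dom D <= Y} ->
  D = \sum_(y <- Y) wd y *~ coeff y D.
Proof.
move=> uY sY; rewrite (bigID (mem (dom D))) /= [X in _ + X]big1 ?addr0; last first.
  by move=> y /coeff_outdom ->; rewrite mulr0z.
rewrite -big_filter -{1}(freeg_sumE D).
rewrite (perm_big (filter (mem (dom D)) Y)) /=.
  by apply: eq_bigr => y _; rewrite /wd freeg_mulz intz.
apply: uniq_perm; rewrite ?uniq_dom ?filter_uniq // => y.
by rewrite mem_filter /=; case: (boolP (y \in dom D)) => // /sY ->.
Qed.

(* Over the free group S^n(A) is free, so an element of A (x) S^n(A) determines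
   its components in A; this replaces the injectivity of
   B (x) S^n(A) -> A (x) S^n(A). *)
Lemma Qgen_sum z th : zspan Qgen (z, th) ->
  (forall y, piX X (comp y z) = 0) /\
  exists Y0 : seq (seq K), forall Y, uniq Y -> {subset Y0 <= Y} ->
    th = \sum_(y <- Y) karrow (comp y z) * psi (wd y).
Proof.
have H (p : R * T) : zspan Qgen p -> (forall y, piX X (comp y p.1) = 0) /\
    exists Y0 : seq (seq K), forall Y, uniq Y -> {subset Y0 <= Y} ->
      p.2 = \sum_(y <- Y) karrow (comp y p.1) * psi (wd y).
  elim=> [_ [c [D [hc ->]]]||x x' _ [h [Y hY]] _ [h' [Y' hY']]] /=.
  - have E y : comp y (ell c * srt D) = c *~ coeff y (srt D).
      by rewrite comp_mul ?ellK //; apply: ell_fhom.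
    split=> [y|]; first by rewrite E raddfMz hc mul0rz.
    exists (dom (srt D)) => Y uY sY.
    have -> : psi D = psi (srt D) by rewrite /psi piS_srt.
    rewrite {1}(frg_sum_over uY sY) psi_sum mulr_sumr.
    by apply: eq_bigr => y _; rewrite E karrowMz // psiMz mulrzAl mulrzAr.
  - split=> [y|]; first by rewrite !raddf0.
    by exists [::] => Y _ _; rewrite big1 // => y _; rewrite raddf0 karrow0 mul0r.
  - split=> [y|]; first by rewrite !raddfB h h' subrr.
    exists (Y ++ Y') => Y1 uY1 sY1.
    rewrite (hY Y1) ?(hY' Y1) // -?sumrB; last 2 first.
    + by move=> y yY; apply: sY1; rewrite mem_cat yY orbT.
    + by move=> y yY; apply: sY1; rewrite mem_cat yY.
    by apply: eq_bigr => y _; rewrite raddfB (karrowB (h y) (h' y)) mulrBl.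
exact: (H (z, th)).
Qed.

Lemma Qgen_flat th : zspan Qgen (0, th) -> th = 0.
Proof.
move=> /Qgen_sum [_ [Y0 hY]]; rewrite (hY (undup Y0)) ?undup_uniq //; last first.
  by move=> y; rewrite mem_undup.
by rewrite big1 // => y _; rewrite raddf0 karrow0 mul0r.
Qed.

Lemma aug_derived_piS y j : aug F' y -> piS (mu y j) = 0.
Proof.
elim=> [_ [h [a [Fh ->]]]||x x' _ hx _ hx'].
- rewrite mulrBl mul1r muBE piSB; apply/eqP; rewrite subr_eq0; apply/eqP.
  rewrite -[LHS]/(series_map piS (mu (gr h * a)) j) rmorphM series_mapM.
  by rewrite (smu_derived bF Fh) mul1r.
- by rewrite mu0E piS0.
- by rewrite muBE piSB hx hx' subrr.
Qed.

Lemma I0_mu k i : I0 X k.+1 i -> tau (mu i k.+2) = 0 /\ piS (mu i k.+2) = 0.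
Proof.
case=> a [c [ha hc ->]]; have c0 : mu c k.+2 = 0 by apply: (mu_low bF hc).
have -> : mu (a + c) k.+2 = mu a k.+2.
  by apply/eqP; rewrite -subr_eq0 -muBE addrAC subrr add0r c0.
elim: ha => [_ [x [y [fx [gy fy] ->]]]||x y _ [h1 h2] _ [h1' h2']].
- have lx := mu_aug_low bF fx; have ly := mu_low bF fy.
  rewrite rmorphM (low_mul_lead lx ly) piSM (aug_derived_piS _ gy) mulr0; split=> //.
  rewrite (tau_fhom1 _ _ (mu_fhom bF x 1)) -(Gam_piS le_total le_trans le_anti bF).
  by rewrite (aug_derived_piS _ gy) raddf0 mulr0.
- by rewrite mu0E piS0 raddf0.
- by rewrite muBE piSB raddfB h1 h2 h1' h2' !subrr.
Qed.

(** Two decompositions of w - 1 differ by an element of [I0], whose tensor is zero by [I0_mu]; by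
    [Qgen_flat] the difference of the arrows is then zero. *)
Lemma Rel_unique k w (th th' : T) : Rel k.+1 w th -> Rel k.+1 w th' -> th = th'.
Proof.
move=> [i [hi hu]] [i' [hi' hu']]; apply/eqP; rewrite -subr_eq0; apply/eqP.
apply: Qgen_flat.
have <- : tau (mu (i' - i) k.+2) = 0 by apply: (proj1 (I0_mu (idealB hi' hi))).
apply: Sgen_Qgen; have := zspanB hu hu'.
suff -> : (gr w - 1 - i, th) - (gr w - 1 - i', th') = (i' - i, th - th') by [].
by congr pair; rewrite /= subrBB subrr add0r opprB.
Qed.

Lemma Sgen_tgt k u (th : T) : zspan (@Sgen X k) (u, th) ->
  [/\ ghom k.+1 th, srcT th = 0 & tgtT th = piS (mu u k.+1)].
Proof.
have H (z : groupring F * T) : zspan (@Sgen X k) z ->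
    [/\ ghom k.+1 z.2, srcT z.2 = 0 & tgtT z.2 = piS (mu z.1 k.+1)].
  elim=> [_ [r [ws [Rr sw ->]]]||x y _ [h1 h2 h3] _ [h1' h2' h3']] /=.
  - split; last 2 first.
    + by rewrite srcTM karrow_src mul0r.
    + rewrite tgtTM (karrow_tgt (piX_ker Rr)) (Sgen_mu Rr sw) piSM piS_ell; congr (_ * _).
      by rewrite -psi_prod /psi tgt_idT.
    apply: zspan_gen; exists (ep (ker_eq (piX_ker Rr)) :: map (fun w => ediag (piX X) (ab_pi w)) ws).
      by rewrite /= size_map sw.
    by rewrite gw_cons gwE big_map (karrowE (piX_ker Rr)).
  - by split; rewrite ?srcT0 ?tgtT0 ?mu0E ?piS0 //; apply: zspan0.
  - by split; rewrite ?srcTB ?tgtTB ?h2 ?h2' ?subrr ?h3 ?h3' ?muBE ?piSB //; apply: zspanB.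
exact: (H (u, th)).
Qed.

Lemma numerator_derived k w : numerator X k.+1 w -> gamma_ k.+2 (nsgT F) w.
Proof. by move=> /numerator_fX h; exact: (magnus le_total le_trans le_anti (mu_low bF h)). Qed.

Lemma gamma_derived k w : gamma_ k.+2 (nsgT F) w -> F' w.
Proof. by apply: (@gamma_le _ 2). Qed.

(** The target of the arrow is the symmetrized leading coefficient of w - 1. It vanishes because w
    lies in F', which follows from the dimension subgroup theorem. *)
Lemma Rel_Kset k w (th : T) : Rel k.+1 w th -> Kset k.+2 th.
Proof.
move=> h; have Fw := gamma_derived (numerator_derived (Rel_numerator h)).
case: h => i [hi /Sgen_tgt [h1 h2 h3]]; split=> //; rewrite h3 muBE piSB.
rewrite (proj2 (I0_mu hi)) subr0 muBE rmorph1 s1E subr0.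
by rewrite -[LHS]/(series_map piS (mu (gr w)) k.+2) (smu_derived bF Fw) s1E.
Qed.

(** Telescoping: a product of arrows minus the identity at its source is a sum of terms in which one
    factor e is replaced by e - id(src e), an arrow from 0 to a class of R, and the remaining
    factors by identities. *)
Lemma ghom_Sgen k (x : T) : ghom k.+1 x ->
  exists u, fX k.+1 u /\ zspan (@Sgen X k) (u, x - idT (srcT x)).
Proof.
elim=> [_ [s ss ->]||x1 x2 _ [u1 [f1 h1]] _ [u2 [f2 h2]]]; last 2 first.
- by exists 0; rewrite srcT0 idT0 subrr; split; [apply: ideal0|apply: zspan0].
- exists (u1 - u2); rewrite srcTB idTB subrBB; split; first exact: idealB.
  exact: (zspanB h1 h2).
have letter (e : epair (piX X)) : exists2 r, Rk r & gl _ e - idT (gl _ (src e)) = karrow (ab_pi r) :> T.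
  have h : piX X (tgt e - src e) = 0 by rewrite raddfB epairP subrr.
  have [r Rr rE] := ker_lift h; exists r => //.
  rewrite rE (karrowE h) idT1 -raddfB; congr gl.
  by apply: ep_ext; rewrite /src /tgt /= ?subrr.
elim: s k ss => // e s IH k [sk]; rewrite gw_cons srcTM idTM srcT1.
have [r Rr rE] := letter e.
have E : gl _ e * gw _ s - idT (gl _ (src e)) * idT (srcT (gw _ s)) =
    karrow (ab_pi r) * idT (tgtT (gw _ s)) + (gw _ s - idT (srcT (gw _ s))) * idT (gl _ (src e)) :> T.
  (* Multiplied by an element of source 0, an arrow may be replaced by the identity at its target,
     since the difference has target 0. *)
  have -> : karrow (ab_pi r) * idT (tgtT (gw _ s)) = karrow (ab_pi r) * gw _ s :> T.
    apply/eqP; rewrite -subr_eq0 -mulrBr; apply/eqP/ker_src_tgt.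
      exact: karrow_src.
    by rewrite tgtTB tgt_idT subrr.
  rewrite -rE mulrBl mulrBl addrA; congr (_ - _); last by rewrite mulrC.
  by rewrite [gw _ s * _]mulrC subrK.
have [v vE] : exists v, ab_pi v = src e by elim/ab_pi_ind: (src e) => v; exists v.
have tgtE : exists ws, size ws = k /\ idT (tgtT (gw _ s)) = \prod_(w <- ws) dl w.
  rewrite -{}sk; elim: (s) => [|e' s' [ws [sws wsE]]].
    by exists [::]; rewrite big_nil gw_nil tgtT_1 idT_1.
  have [v' vE'] : exists v', ab_pi v' = tgt e' by elim/ab_pi_ind: (tgt e') => v'; exists v'.
  exists (v' :: ws); rewrite /= sws big_cons gw_cons tgtTM idTM tgtT1 idT1 wsE vE'.
  by split.
have [ws [sws wsE]] := tgtE.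
have g1 : zspan (@Sgen X k) ((gr r - 1) * \prod_(w <- ws) (gr w - 1), karrow (ab_pi r) * idT (tgtT (gw _ s))).
  by apply: zspan_gen; exists r, ws; rewrite wsE.
have fg1 : fX k.+1 ((gr r - 1) * \prod_(w <- ws) (gr w - 1)).
  have := @prod_fX X (r :: ws) k; rewrite /= big_cons; apply; by rewrite sws.
(* For a single arrow the remaining word is empty, so the second summand of [E] vanishes and the
   induction hypothesis does not apply. *)
case: k IH sk sws g1 fg1 {tgtE} => [|k] IH sk sws g1 fg1.
  exists ((gr r - 1) * \prod_(w <- ws) (gr w - 1)); split=> //.
  rewrite E; have -> : s = [::] by case: (s) sk.
  by rewrite gw_nil srcT_1 idT_1 subrr mul0r addr0; case: (s) sk g1 => // _; rewrite gw_nil ?srcT_1 ?tgtT_1 ?idT_1.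
have [u [fu hu]] := IH k sk.
exists ((gr r - 1) * \prod_(w <- ws) (gr w - 1) + u * (gr v - 1)); split.
  apply: idealDE => //.
  by have := @fX_mul _ k 0 _ _ fu (augT_gr v); rewrite addn0.
rewrite E; apply: (zspanD g1 (_ : zspan _ (u * (gr v - 1), _))).
by rewrite idT1 -vE; apply: Sgen_mulr.
Qed.

(** Target 0 says that the leading coefficient has zero symmetrization, so [kap_rho] supplies w in
    gamma_{k+2} with the same image under [tau]; the remaining difference is in [I0] by [tau_I0]. *)
Lemma Kset_Rel k (th : T) : Kset k.+2 th -> exists2 w, gamma_ k.+2 (nsgT F) w & Rel k.+1 w th.
Proof.
case=> hg hs ht; have [u [fu hu]] := ghom_Sgen hg.
rewrite hs idT0 subr0 in hu.
have [_ _] := Sgen_tgt hu; rewrite ht => /esym mu0.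
pose D := mu u k.+2.
have D0 : srt D = 0 by rewrite -(Gam_piS le_total le_trans le_anti bF) mu0 raddf0.
have hD : fhom k.+2 D := mu_fhom bF u k.+2.
have := kap_rho le_total le_trans le_anti bF hD; rewrite D0 subr0.
elim/zq_ind: (rho le b k.+2 (tau D)) => w gw; rewrite kapqE // => e.
exists w => //; exists (gr w - 1 - u); rewrite subKr; split=> //.
apply: (tau_I0 (le := le) (bF := bF)).
  by apply: idealB => //; apply: gamma_fX.
by rewrite muBE raddfB; apply/eqP; rewrite subr_eq0; apply/eqP.
Qed.
End RelationFunctional.

(** * Elements representing the zero arrow *)

Section RelationKernel.
Variables (K : choiceType) (le : rel K).
Hypothesis le_total : total le.
Hypothesis le_trans : transitive le.
Hypothesis le_anti : antisymmetric le.
Variables (X : free_presentation) (b : K -> presF X).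
Hypothesis bF : free_on b.
Notation F := (presF X).
Notation Rk := (pres_ker X).
Notation R := (frg K).
Notation F' := (derived (nsgT F)).
Notation tau := (tau le).
Notation srt := (srt le).
Notation mu := (mu bF).
Notation ld := (ld bF).
Notation ell := (ell bF).
Notation T := (Tr (piX X)).
Notation psi := (@psi K X b).

(** Koszul boundaries in A (x) S(A) of pairs from the kernel of A -> G_ab. For c, c' the classes of
    r, r' and D a word, this is the image of a left-normed commutator [r, r', x_1, ...]. *)
Definition L2gen (z : R) : Prop := exists c c' D, [/\ piX X c = 0, piX X c' = 0 &
  z = ell c * srt (ell c' * D) - ell c' * srt (ell c * D)].

Definition tgt_word (s : seq (epair (piX X))) : R := \prod_(e <- s) ell (tgt e).

(* Telescoping a product of arrows, one factor at a time, as a sum of arrows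
   (0, c) multiplied by identities. *)
Fixpoint arrow_word (s : seq (epair (piX X))) : R :=
  if s is e :: s' then ell (tgt e - src e) * srt (tgt_word s') + tau (arrow_word s' * ell (src e))
  else 0.

Lemma tgt_word_cat s t : tgt_word (s ++ t) = tgt_word s * tgt_word t.
Proof. exact: big_cat. Qed.

Lemma tgt_word_cons e s : tgt_word (e :: s) = ell (tgt e) * tgt_word s.
Proof. exact: big_cons. Qed.

Lemma tgt_word_add s t x y :
  tgt_word (s ++ (x + y) :: t) = tgt_word (s ++ x :: t) + tgt_word (s ++ y :: t).
Proof.
rewrite !tgt_word_cat !tgt_word_cons.
have -> : tgt (x + y) = tgt x + tgt y by [].
by rewrite (raddfD ell) mulrDl mulrDr.
Qed.

Lemma arrow_word_add s t x y :
  arrow_word (s ++ (x + y) :: t) = arrow_word (s ++ x :: t) + arrow_word (s ++ y :: t).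
Proof.
elim: s => [|e s IH] /=.
  have -> : tgt (x + y) - src (x + y) = (tgt x - src x) + (tgt y - src y).
    by rewrite /src /tgt /= opprD addrACA.
  have -> : src (x + y) = src x + src y by [].
  by rewrite !(raddfD ell) mulrDl mulrDr (raddfD tau) addrACA.
by rewrite IH tgt_word_add (raddfD srt) !(mulrDl, mulrDr) (raddfD tau) addrACA.
Qed.

Lemma srtC P Q : srt (P * Q) = srt (Q * P).
Proof.
by have := srt_swap4 le_total le_trans le_anti 1 P Q 1; rewrite !mul1r !mulr1.
Qed.

Lemma tau_ell c D : tau (ell c * D) = ell c * srt D.
Proof. exact: tau_fhom1 (ell_fhom bF c). Qed.

Lemma tau_arrow_word s Z : tau (arrow_word s * Z) = tau (arrow_word s * srt Z).
Proof.
elim: s Z => [|e s IH] Z /=; first by rewrite !mul0r.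
rewrite !mulrDl !(raddfD tau) -!mulrA !tau_ell -srt_mulr //; congr (_ + _).
rewrite -!tau_mull // -!mulrA IH [RHS]IH; congr (tau (_ * _)).
by rewrite -srt_mulr.
Qed.

Lemma L2_mulr z a : zspan L2gen z -> zspan L2gen (tau (z * ell a)).
Proof.
elim=> [_ [c [c' [D [hc hc' ->]]]]||x y _ hx _ hy].
- rewrite mulrBl (raddfB tau) -!mulrA !tau_ell -!srt_mull // -!mulrA.
  by apply: zspan_gen; exists c, c', (D * ell a).
- by rewrite mul0r raddf0; apply: zspan0.
- by rewrite mulrBl (raddfB tau); apply: zspanB.
Qed.

Lemma epair_diff (e : epair (piX X)) : piX X (tgt e - src e) = 0.
Proof. by rewrite raddfB epairP subrr. Qed.

Lemma srt_tgt_swap s t x y :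
  srt (tgt_word (s ++ [:: x, y & t])) = srt (tgt_word (s ++ [:: y, x & t])).
Proof.
have := srt_swap4 le_total le_trans le_anti (tgt_word s) (ell (tgt x)) (ell (tgt y)) (tgt_word t).
by rewrite !tgt_word_cat !tgt_word_cons !mulrA.
Qed.

(** For two adjacent arrows at the front, the two orders of telescoping differ by the Koszul
    boundary of the kernel elements tgt x - src x and tgt y - src y; factors further left preserve
    such boundaries by [L2_mulr]. *)
Lemma arrow_word_swap s t x y :
  zspan L2gen (arrow_word (s ++ [:: x, y & t]) - arrow_word (s ++ [:: y, x & t])).
Proof.
elim: s => [|e s IH] /=; last first.
  rewrite srt_tgt_swap opprD addrACA subrr add0r -(raddfB tau) -mulrBl.
  exact: L2_mulr.
rewrite !tgt_word_cons !mulrDl !(raddfD tau) -!mulrA !tau_ell -!tau_mull // -!mulrA.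
have -> : tau (arrow_word t * (ell (src y) * ell (src x))) =
    tau (arrow_word t * (ell (src x) * ell (src y))).
  by rewrite tau_arrow_word srtC -tau_arrow_word.
rewrite !addrA opprD addrA addrAC addrK.
apply: zspan_gen; exists (tgt x - src x), (tgt y - src y), (tgt_word t).
split; [exact: epair_diff|exact: epair_diff|].
rewrite -!srt_mull // ![srt (tgt_word t * _)]srtC.
have E (x1 x2 x3 x4 : R) : x1 + x2 - (x3 + x4) = (x1 - x4) - (x3 - x2).
  by rewrite opprB opprD [- x3 - x4]addrC addrACA.
by rewrite E -!mulrBr -!(raddfB srt) -!mulrBl -!(raddfB ell).
Qed.

Lemma arrow_word_null s t (x y : epair (piX X)) : comp_null x y -> arrow_word (s ++ [:: x, y & t]) = 0.
Proof.
case=> hx hy; elim: s => [|e s IH] /=.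
  rewrite tgt_word_cons hx hy !(raddf0 ell) !(mulr0, mul0r) !(raddf0 srt, raddf0 tau).
  by rewrite !mulr0 addr0.
have -> : tgt_word (s ++ [:: x, y & t]) = 0.
  by rewrite tgt_word_cat !tgt_word_cons hy raddf0 mul0r !mulr0.
by rewrite IH mul0r !raddf0 mulr0 addr0.
Qed.

Fact arrow_mapD s t (x y : epair (piX X)) : zpi L2gen (arrow_word (s ++ (x + y) :: t)) =
  zpi L2gen (arrow_word (s ++ x :: t)) + zpi L2gen (arrow_word (s ++ y :: t)).
Proof. by rewrite arrow_word_add raddfD. Qed.

Fact arrow_mapS s t (x y : epair (piX X)) :
  zpi L2gen (arrow_word (s ++ [:: x, y & t])) = zpi L2gen (arrow_word (s ++ [:: y, x & t])).
Proof. exact/zpiP/arrow_word_swap. Qed.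

Fact arrow_mapR s t (x y : epair (piX X)) : comp_null x y ->
  zpi L2gen (arrow_word (s ++ [:: x, y & t])) = 0.
Proof. by move=> n; rewrite arrow_word_null // raddf0. Qed.

(** Sends the arrow (0, c) D back to the tensor c (x) D modulo Koszul boundaries. Hence a tensor
    whose arrow is zero is a combination of such boundaries. *)
Definition arrow_map : {additive T -> quotz L2gen} :=
  galg_lift (h := fun s => zpi L2gen (arrow_word s)) arrow_mapD arrow_mapS arrow_mapR.

Lemma psi_wd s : psi (wd s) = gw _ (map (fun x => ediag (piX X) (ab_pi (b x))) s).
Proof.
elim: s => [|x s IH]; first by rewrite wd0 /psi [piS _ _]rmorph1 idT_1.
by rewrite wd_cons psiM IH /= gw_cons /psi piS1 idT1.
Qed.

Lemma arrow_map_karrow c D : piX X c = 0 ->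
  arrow_map (karrow c * psi D) = zpi L2gen (ell c * srt D).
Proof.
move=> hc; elim/frg_ind: D => [|x y hx hy|s].
- by rewrite /psi piS0 idT0 !raddf0 !mulr0 !raddf0.
- by rewrite psiB (raddfB srt) !mulrBr raddfB hx hy [RHS]raddfB.
rewrite psi_wd (karrowE hc) -gw_cons galg_liftE /= subr0 (raddf0 ell) mulr0 raddf0 addr0.
suff -> : tgt_word (map (fun x => ediag (piX X) (ab_pi (b x))) s) = wd s by [].
elim: s => [|x s IH]; first exact: big_nil.
by rewrite /= tgt_word_cons IH [wd (x :: s)]wd_cons ell_b.
Qed.

Lemma Qgen_map z th : zspan (@Qgen _ le X b bF) (z, th) -> arrow_map th = zpi L2gen z.
Proof.
have H (p : R * T) : zspan (@Qgen _ le X b bF) p -> arrow_map p.2 = zpi L2gen p.1.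
  elim=> [_ [c [D [hc ->]]]||x y _ hx _ hy].
  - exact: arrow_map_karrow.
  - by rewrite !raddf0.
  - by rewrite !raddfB hx hy.
exact: (H (z, th)).
Qed.

(** [L2gen] does not fix a degree; projecting to degree k+2 leaves the words D of length k, realised
    with k further brackets. *)
Definition proj k : {additive R -> R} := flin (fun s => if size s == k then wd s else 0).

Lemma proj_fhom k P : fhom k P -> proj k P = P.
Proof.
elim=> [_ [s ss ->]||x y _ hx _ hy]; last 2 first.
- by rewrite raddf0.
- by rewrite raddfB hx hy.
by rewrite [proj _ _]flinE ss eqxx.
Qed.

Lemma proj_fhom0 k j P : fhom j P -> j != k -> proj k P = 0.
Proof.
move=> h jk; elim: h => [_ [s ss ->]||x y _ hx _ hy]; last 2 first.
- by rewrite raddf0.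
- by rewrite raddfB hx hy subrr.
by rewrite [proj _ _]flinE ss (negPf jk).
Qed.

Lemma tau_fhom k P : fhom k P -> fhom k (tau P).
Proof.
elim=> [_ [[|x s] <- ->]||x y _ hx _ hy].
- by rewrite tau_nil; apply: (fhom_wd [::]).
- by rewrite tau_cons /= -(size_sort le s); apply: (fhom_wd (x :: _)).
- by rewrite raddf0; apply: zspan0.
- by rewrite (raddfB tau); apply: zspanB.
Qed.

Lemma tau_ldV k x y : F' x -> F' y ->
  tau (ld k.+1 (x * y^-1)%g) = tau (ld k.+1 x) - tau (ld k.+1 y).
Proof.
move=> Fx Fy; apply: (addIr (tau (ld k.+1 y))).
by rewrite subrK -tau_derivedM ?mulgVK //; apply: nsgM => //; apply: nsgV.
Qed.

Lemma foldc_nsgRn j c s (A : nsubgroup F) : nsgRn j A (nsgT F) c ->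
  nsgRn (j + size s) A (nsgT F) (foldc c s).
Proof.
elim: s j c => [|z s IH] j c hc; first by rewrite addn0.
by rewrite addnS -addSn; apply: IH; apply: nsgR_comm.
Qed.

(** A word D of length k is realised by bracketing [r, r'] with its letters; a word of another
    length projects to 0. Differences of D become quotients in the group, by additivity of [tau] on
    F'. *)
Lemma L2_realize k z : L2gen z ->
  exists2 d, nsgRn k (nsgR Rk Rk) (nsgT F) d & proj k.+2 z = tau (ld k.+2 d).
Proof.
case=> c [c' [D [hc hc' ->]]].
pose N := nsgRn k (nsgR Rk Rk) (nsgT F).
have [r Rr <-] := ker_lift hc; have [r' Rr' <-] := ker_lift hc'.
elim/frg_ind: D => [|x y [d hd ed] [e he ee]|s].
- exists 1%g; first exact: nsg1.
  by rewrite !mulr0 raddf0 !mulr0 subrr raddf0 /ld gr1 subrr mu0E raddf0.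
- exists (d * e^-1)%g; first by apply: nsgM => //; apply: nsgV.
  have Fd := (RRn_Rel hd).1; have Fe := (RRn_Rel he).1.
  rewrite (tau_ldV _ Fd Fe) -ed -ee -(raddfB (proj _)) !(mulrBr, raddfB srt) [in LHS]subrBB.
  by congr (proj _ _).
have h i c0 P : fhom i P -> fhom i.+1 (ell c0 * srt P).
  by move=> hP; apply: (@fhomM _ 1) (ell_fhom _ _) (srt_fhom le hP).
have hz : fhom (size s).+2 (ell (ab_pi r) * srt (ell (ab_pi r') * wd s) -
    ell (ab_pi r') * srt (ell (ab_pi r) * wd s)).
  by apply: zspanB; apply/h/(@fhomM _ 1 _ _ _ (ell_fhom bF _) (fhom_wd s)).
case: (eqVneq (size s) k) => [sk|sk]; last first.
  exists 1%g; first exact: nsg1.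
  by rewrite (proj_fhom0 hz) // /ld gr1 subrr mu0E raddf0.
exists (foldc [~ r, r']%g (map b s)).
  by have := @foldc_nsgRn 0 [~ r, r']%g (map b s) (nsgR Rk Rk) (nsgR_comm Rr Rr'); rewrite size_map sk.
rewrite -sk (proj_fhom hz).
have Fc : F' [~ r, r']%g by apply: nsgR_comm.
rewrite -[(size s).+2]/(1 + size s).+1 (kap_foldc le_total le_trans le_anti bF s Fc); last by [].
have := ld_comm (ld_low bF (I : gamma_ 1 (nsgT F) r)) (ld_low bF (I : gamma_ 1 (nsgT F) r')).
rewrite add0n => ->; rewrite -!ellE mulrBl raddfB -!mulrA.
by rewrite !tau_ell.
Qed.

Lemma L2_realize_span k z : zspan L2gen z ->
  exists2 d, nsgRn k (nsgR Rk Rk) (nsgT F) d & proj k.+2 z = tau (ld k.+2 d).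
Proof.
elim=> [y /(L2_realize k) //||x y _ [d hd ed] _ [e he ee]].
- exists 1%g; first exact: nsg1.
  by rewrite raddf0 /ld gr1 subrr mu0E raddf0.
- exists (d * e^-1)%g; first by apply: nsgM => //; apply: nsgV.
  by rewrite raddfB ed ee (tau_ldV _ (RRn_Rel hd).1 (RRn_Rel he).1).
Qed.

(** The tensor of w is a combination of Koszul boundaries, so some d in [R, R, F, ..., F] has the
    same image under [tau]; then [kap_eq0] puts w d^-1 in [mgamma]. *)
Lemma Rel0_denominator k w : Rel k.+1 w (0 : T) -> denominator X k.+1 w.
Proof.
move=> h; have gw := numerator_derived le_total le_trans le_anti bF (Rel_numerator h).
have Fw := gamma_derived gw.
case: h => i [hi /(Sgen_Qgen le bF)].
rewrite -/(ld k.+2 w) muBE raddfB (proj1 (I0_mu le_total le_trans le_anti bF hi)) subr0.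
move=> /Qgen_map; rewrite raddf0 => /esym/zpi_eq0/(L2_realize_span k)[d hd].
rewrite proj_fhom; last first.
  by apply/tau_fhom/mu_fhom.
move=> e; have Fd := (RRn_Rel hd).1.
have t0 : tau (ld k.+2 (w * d^-1)%g) = 0 by rewrite tau_ldV // -/(ld _ _) e subrr.
have gwd : gamma_ k.+2 (nsgT F) (w * d^-1)%g by apply: nsgM => //; apply/nsgV/RRn_gamma.
have [u [v [[Fu gu] gv uv]]] := kap_eq0 le_total le_trans le_anti gwd t0.
(* From w = u v d, conjugation by d moves d to the front, the order demanded by [denominator]. *)
exists (d * u ^ d)%g, (v ^ d)%g; split.
- by exists d, (u ^ d)%g; split=> //; split; apply: nsgJ.
- exact: nsgJ.
by rewrite -mulgA -conjMg -uv /conjg !mulgA mulgV mul1g mulgVK.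
Qed.

End RelationKernel.

(** * Naturality *)

(** A basis carries no order of its own; sorting and Lyndon words need one. Transitivity is read off
    from the least of three elements. *)
Lemma exists_total_order (T : eqType) : exists le : rel T,
  [/\ total le, transitive le & antisymmetric le].
Proof.
have [le wo] := well_ordering_principle T; exists le.
have woT : wo_chain le predT by apply: withinW.
have tot : total le by move=> x y; apply: (wo_chainW woT).
have anti : antisymmetric le by move=> x y; apply: (wo_chain_antisymmetric woT).
split=> // y x z xy yz.
have [|u [[uA lu] _]] := wo (mem [:: x; y; z]); first by exists x; apply: mem_head.
have [ux uy uz] : [/\ le u x, le u y & le u z] by split; apply: lu; rewrite !inE eqxx ?orbT.
move: uA; rewrite !inE => /or3P[] /eqP e; rewrite -?e //.
- by have -> : x = u by apply: anti; rewrite ux {1}e xy.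
- by have <- : y = u by apply: anti; rewrite uy {1}e yz.
Qed.

Lemma free_basis (F : groupType) : is_free F -> exists (K : choiceType) (le : rel K) (b : K -> F),
  [/\ total le, transitive le, antisymmetric le & free_on b].
Proof.
case=> T [b bF]; have [le [h1 h2 h3]] := exists_total_order {classic T}.
by exists {classic T}, le, b.
Qed.

Section Naturality.
Variables (X Y : free_presentation) (m : presentation_map X Y).
Notation phi := (pmapF m).

Lemma ab_lies_over : lies_over (piX X) (piX Y) (ab_map (pmapG m)) (ab_map phi).
Proof. by elim/ab_pi_ind=> w /=; rewrite ab_mapE !piXE ab_mapE pmap_comm. Qed.

Lemma Tmap_karrow c : piX X c = 0 -> Tmap ab_lies_over (karrow c) = karrow (ab_map phi c).
Proof.
move=> h; have h' : piX Y (ab_map phi c) = 0 by rewrite ab_lies_over h raddf0.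
rewrite (karrowE h) (karrowE h') Tmap1; congr gl.
by apply: ep_ext; rewrite /src /tgt /= ?raddf0.
Qed.

Lemma Tmap_diag w : Tmap ab_lies_over (gl _ (ediag (piX X) (ab_pi w))) =
  gl _ (ediag (piX Y) (ab_pi (phi w))).
Proof. by rewrite Tmap1; congr gl; apply: ep_ext; rewrite /src /tgt /= ab_mapE. Qed.

Lemma grmap_sub1 w : grmap phi (gr w - 1) = gr (phi w) - 1.
Proof. by rewrite raddfB /= grmapE -(gr1 (presF X)) grmapE morph1. Qed.

Lemma Rel_map k w th : Rel k w th -> Rel k (phi w) (Tmap ab_lies_over th).
Proof.
case=> i [hi hu]; exists (grmap phi i); split.
  apply: idealD_map hi; last first.
    by apply: idealX_map; apply: aug_map.
  apply: idealM_map; first exact: aug_map.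
  apply: idealI_map; first by apply: aug_map; apply: derivedT_morph.
  by apply: idealX_map; apply: aug_map.
have H (z : groupring (presF X) * Tr (piX X)) : zspan (@Sgen X k) z ->
    zspan (@Sgen Y k) (grmap phi z.1, Tmap ab_lies_over z.2).
  elim=> [_ [r [ws [Rr sw ->]]]||x y _ hx _ hy] /=.
  - apply: zspan_gen; exists (phi r), (map phi ws); rewrite size_map sw; split=> //.
      exact: pres_ker_map.
    rewrite grmapM grmap_sub1 !big_map TmapM (Tmap_karrow (piX_ker Rr)) ab_mapE.
    congr (_ * _, _ * _).
      elim: ws {sw} => [|u ws IH]; first by rewrite !big_nil -(gr1 (presF X)) grmapE morph1.
      by rewrite !big_cons grmapM grmap_sub1 IH.
    elim: ws {sw} => [|u ws IH]; first by rewrite !big_nil Tmap_1.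
    by rewrite !big_cons TmapM Tmap_diag IH.
  - by rewrite raddf0 Tmap0; apply: zspan0.
  - by rewrite raddfB TmapB; apply: (zspanB hx hy).
by have := H _ hu; rewrite [(_, _).1]/= [(_, _).2]/= grmapB grmap_sub1.
Qed.
End Naturality.

(** * The correspondence without a chosen basis *)

Section BasisFree.
Variables (X : free_presentation) (k : nat).
Notation T := (Tr (piX X)).

Lemma Rel_exists w : numerator X k.+1 w -> exists th : T, Rel k.+1 w th.
Proof.
have [K [le [b [h1 h2 h3 bF]]]] := free_basis (presF_free X).
exact: (numerator_Rel bF).
Qed.

Lemma Rel_functional w (th th' : T) : Rel k.+1 w th -> Rel k.+1 w th' -> th = th'.
Proof.
have [K [le [b [h1 h2 h3 bF]]]] := free_basis (presF_free X).
exact: (Rel_unique h1 h2 h3 bF).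
Qed.

Lemma Rel_homotopy w (th : T) : Rel k.+1 w th -> Kset k.+2 th.
Proof.
have [K [le [b [h1 h2 h3 bF]]]] := free_basis (presF_free X).
exact: (Rel_Kset h1 h2 h3 bF).
Qed.

Lemma Rel_onto (th : T) : Kset k.+2 th -> exists w, Rel k.+1 w th.
Proof.
have [K [le [b [h1 h2 h3 bF]]]] := free_basis (presF_free X).
by case/(Kset_Rel h1 h2 h3 bF) => w _ hw; exists w.
Qed.

Lemma Rel0P w : Rel k.+1 w (0 : T) <-> denominator X k.+1 w.
Proof.
have [K [le [b [h1 h2 h3 bF]]]] := free_basis (presF_free X).
by split=> [/(Rel0_denominator h1 h2 h3 bF)|/(denominator_Rel h1 h2 h3 bF)].
Qed.

Lemma ab_resolution_lift (P : resolution (ab (presG X))) :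
  exists f : {additive ab (presF X) -> P 0%N}, lies_over (piX X) (res_aug P) id f.
Proof.
have [K [le [b [h1 h2 h3 bF]]]] := free_basis (presF_free X).
have /choice [p hp] : forall x, exists y, res_aug P y = piX X (ab_pi (b x)).
  by move=> x; apply: res_surj.
pose h : {additive frg K -> P 0%N} := flin (fun s => if s is [:: x] then p x else 0).
exists (h \o ell bF : {additive _ -> _}) => a /=.
rewrite -[in RHS](ellK bF a).
apply: (frg_ext (f := res_aug P \o h) (g := piX X \o unl b)) => s /=.
rewrite /h /unl !flinE; case: s => [|x [|y s]]; rewrite ?raddf0 //; exact: hp.
Qed.
End BasisFree.

(** * The comparison isomorphism *)

Section Comparison.
Variables (X : free_presentation) (P : resolution (ab (presG X))) (k : nat).
Notation sq := (subquotient (numerator X k.+1) (denominator X k.+1)).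

(* The relation between q and y is that y corresponds to the image of a
   representative under some lift F_ab -> P_0; being a relation it involves no choices. *)
Definition theta_rel (q : sq) (y : derived_functor (SP k.+2) 1 P) : Prop :=
  exists x th f (hf : lies_over (piX X) (res_aug P) id f),
    [/\ q = qpi _ x, Rel k.+1 (subg_val x) th & lamH k.+2 P y = Tmap hf th].

Lemma Rel_coset x x' (th th' : Tr (piX X)) : Rel k.+1 x th -> Rel k.+1 x' th' ->
  denominator X k.+1 (x^-1 * x')%g <-> th = th'.
Proof.
move=> h h'; rewrite -Rel0P; split=> [h0|e].
  by apply: Rel_functional h'; have := RelM h h0; rewrite mulgA mulgV mul1g addr0.
by have := RelM (RelV h) h'; rewrite e addNr.
Qed.

Lemma theta_rel_exists q : exists y, theta_rel q y.
Proof.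
elim/qpi_ind: q => x; have [th hth] := Rel_exists (subg_valP x).
have [f hf] := ab_resolution_lift P.
have [y hy] := lamH_Kset (Kset_Tmap hf (Rel_homotopy hth)).
by exists y, x, th, f, hf.
Qed.

Lemma theta_rel_Tmap x th f (hf : lies_over (piX X) (res_aug P) id f) y :
  Rel k.+1 (subg_val x) th -> theta_rel (qpi _ x) y -> lamH k.+2 P y = Tmap hf th.
Proof.
move=> h [x' [th' [f' [hf' [/qpiP qe h' ->]]]]].
rewrite (proj1 (Rel_coset h h') qe).
by have [_ s0 t0] := Rel_homotopy h'; apply: Tmap_homotopy.
Qed.

Lemma theta_rel_functional q y y' : theta_rel q y -> theta_rel q y' -> y = y'.
Proof.
move=> [x [th [f [hf [-> h e]]]]] h'; apply: (@lamH_inj k.+2).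
by rewrite e (theta_rel_Tmap hf h h').
Qed.

Lemma ab_resolution_colift :
  exists g : {additive P 0%N -> ab (presF X)}, lies_over (res_aug P) (piX X) id g.
Proof.
have piX_surj y : exists x, piX X x = y.
  elim/ab_pi_ind: y => v; have [w <-] := pres_surj v.
  by exists (ab_pi w); rewrite piXE.
by have [g hg] := @res_proj _ P 0%N _ _ (piX X) (res_aug P) piX_surj; exists g => a; apply: hg.
Qed.

(** The composite of the two lifts and the identity both lie over the identity of C, so
    [Tmap_homotopy] makes them agree on arrows from 0 to 0. *)
Lemma Tmap_retract (A B C : zmodType) (p : {additive A -> C}) (p' : {additive B -> C})
    f g (hf : lies_over p p' id f) (hg : lies_over p' p id g) m x :
  Kset m x -> Tmap hg (Tmap hf x) = x.
Proof.
case=> _ s0 t0; have hgf : lies_over p p id (g \o f : {additive _ -> _}).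
  by move=> a /=; rewrite hg hf.
have hid : lies_over p p id (idfun : {additive A -> A}) by [].
rewrite (Tmap_comp hf hg hgf (fun=> erefl)) (Tmap_homotopy hgf hid s0 t0).
exact: Tmap_id.
Qed.

Lemma theta_rel_inj q q' y : theta_rel q y -> theta_rel q' y -> q = q'.
Proof.
move=> [x [th [f [hf [-> h e]]]]] [x' [th' [f' [hf' [-> h' e']]]]].
apply/qpiP/(Rel_coset h h').
have [g hg] := ab_resolution_colift.
rewrite -(Tmap_retract hf hg (Rel_homotopy h)) -(Tmap_retract hf' hg (Rel_homotopy h')).
by rewrite -e -e'.
Qed.

Lemma theta_rel_onto y : exists q, theta_rel q y.
Proof.
have [g hg] := ab_resolution_colift; have [f hf] := ab_resolution_lift P.
have hy := Kset_lamH y; have [w hw] := Rel_onto (Kset_Tmap hg hy).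
have nw : nsgb (numerator X k.+1) w by apply/asboolP/(Rel_numerator hw).
exists (qpi _ (exist _ w nw : subg _)), (exist _ w nw : subg _), (Tmap hg (lamH k.+2 P y)), f, hf.
by split=> //; rewrite (Tmap_retract hg hf hy).
Qed.

Lemma theta_relM q q' y y' : theta_rel q y -> theta_rel q' y' ->
  theta_rel (q * q')%g (y + y').
Proof.
move=> [x [th [f [hf [-> h e]]]]]; elim/qpi_ind: q' => x' hx'.
have [th' h'] := Rel_exists (subg_valP x').
exists (x * x')%g, (th + th'), f, hf; split.
- by rewrite gmulfM.
- by rewrite gmulfM; apply: RelM.
- by rewrite raddfD e (theta_rel_Tmap hf h' hx') TmapD.
Qed.
End Comparison.

(** Going through P or through F_ab of the second presentation gives two lifts of the same map G_ab
    -> G'_ab, which agree on arrows from 0 to 0. *)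
Lemma theta_rel_natural (X Y : free_presentation) (m : presentation_map X Y) k
    (P : resolution (ab (presG X))) (Q : resolution (ab (presG Y)))
    (phi : resolution_map (ab_map (pmapG m)) P Q) q y :
  theta_rel (P := P) (k := k) q y ->
  theta_rel (quotient_map m q) (derived_functor_map (SP k.+2) 1 phi y).
Proof.
move=> [x [th [f [hf [-> h e]]]]].
have [f' hf'] := ab_resolution_lift Q.
exists (subg_map (@numerator_map _ _ m k.+1) x), (Tmap (ab_lies_over m) th), f', hf'; split.
- exact: quotient_mapE.
- exact: Rel_map.
have hphi : lies_over (res_aug P) (res_aug Q) (ab_map (pmapG m)) (phi 0%N) := rmap_aug phi.
rewrite (lamH_natural hphi) e.
have h1 : lies_over (piX X) (res_aug Q) (ab_map (pmapG m)) (phi 0%N \o f : {additive _ -> _}).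
  by move=> a /=; rewrite hphi hf.
have h2 : lies_over (piX X) (res_aug Q) (ab_map (pmapG m)) (f' \o ab_map (pmapF m) : {additive _ -> _}).
  by move=> a; rewrite -(ab_lies_over m a); apply: hf'.
have [_ s0 t0] := Rel_homotopy h.
rewrite (Tmap_comp hf hphi h1 (fun=> erefl)) (Tmap_comp (ab_lies_over m) hf' h2 (fun=> erefl)).
exact: Tmap_homotopy.
Qed.

Theorem theorem4p5 (n : nat) (hn : (2 <= n)%N) :
  (forall (X : free_presentation) (w : presF X),
      denominator X n w -> numerator X n w) /\
  exists theta : forall (X : free_presentation) (P : resolution (ab (presG X))),
      subquotient (numerator X n) (denominator X n) ->
      derived_functor (SP n.+1) 1 P,
    (forall (X : free_presentation) (P : resolution (ab (presG X))),
        bijective (theta X P) /\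
        (forall x y, theta X P (x * y)%g = (theta X P x + theta X P y)%R)) /\
    (forall (X Y : free_presentation) (m : presentation_map X Y)
            (P : resolution (ab (presG X))) (Q : resolution (ab (presG Y)))
            (phi : resolution_map (ab_map (pmapG m)) P Q)
            (x : subquotient (numerator X n) (denominator X n)),
        theta Y Q (quotient_map m x) =
        derived_functor_map (SP n.+1) 1 phi (theta X P x)).
Proof.
(* With n = k + 1, the arrows have degree n + 1 = k + 2 and the commutators contain n - 1 = k copies
   of F. *)
case: n hn => // k _; split=> [X w /Rel0P/Rel_numerator //|].
exists (fun X P q => projT1 (cid (theta_rel_exists P q))).
have thetaP X P q := projT2 (cid (theta_rel_exists (X := X) (k := k) P q)).
split=> [X P|X Y m P Q phi q]; last first.
  apply: theta_rel_functional (thetaP _ _ _) _.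
  exact: theta_rel_natural (thetaP _ _ _).
split=> [|q q']; last first.
  by apply: theta_rel_functional (thetaP _ _ _) _; apply: theta_relM; apply: thetaP.
exists (fun y => projT1 (cid (theta_rel_onto y))) => [q|y].
  apply: theta_rel_inj (thetaP X P q); exact: projT2 (cid (theta_rel_onto _)).
apply: theta_rel_functional (thetaP _ _ _) _; exact: projT2 (cid (theta_rel_onto y)).
Qed.
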